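(* A star product $\star_{\mathrm{Wick}}$ of Wick type (resp. a star product $\star_{\overline{\mathrm{Wick}}}$ of anti-Wick type) on a pseudo-K\''ahler manifold $(M,\omega,I)$ is Hermitian if and only if its characterizing form $K(\star_{\mathrm{Wick}})$ (resp. $\overline K(\star_{\overline{\mathrm{Wick}}})$) is real, i.e. $\mathrm CK(\star_{\mathrm{Wick}})=K(\star_{\mathrm{Wick}})$ (resp. $\mathrm C\overline K(\star_{\overline{\mathrm{Wick}}})=\overline K(\star_{\overline{\mathrm{Wick}}})$).
   Context: $(M,\omega,I)$ is a pseudo-K\''ahler manifold, $\dim_{\mathbb R}M=2n$: $g$ is a pseudo-Riemannian metric, $I$ is an almost complex structure that is a $g$-isometry and is parallel for the Levi-Civita connection $\nabla$ of $g$; then $M$ is a complex manifold and $\omega(X,Y)=g(IX,Y)$ is a symplectic form. All functions and forms are smooth and complex-valued; the summation convention is used. In local holomorphic coordinates $Z_k=\partial_{z^k}$, $\overline Z_l=\partial_{\overline z^l}$, $\omega=\frac{\mathrm i}{2}g_{k\overline l}\,dz^k\wedge d\overline z^l$, $g^{k\overline l}g_{k\overline n}=\delta^{\overline l}_{\overline n}$, and $\{f,h\}=\frac{2}{\mathrm i}g^{k\overline l}(Z_k(f)\overline Z_l(h)-\overline Z_l(f)Z_k(h))$. $\mathcal O(U)$ and $\overline{\mathcal O}(U)$ denote holomorphic and anti-holomorphic functions on $U$. A star product on $(M,\omega,I)$ is a $\mathbb C[[\nu]]$-bilinear associative product $f\star h=\sum_{r\ge0}\nu^rC_r(f,h)$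 on $\mathcal C^\infty(M)[[\nu]]$ with bidifferential operators $C_r$, $C_0(f,h)=fh$, $C_1(f,h)-C_1(h,f)=\{f,h\}$, and $C_r$ vanishing on constants for $r\ge1$ (so it restricts to open subsets). It is of Wick type (resp. anti-Wick type) if for all open $U\subseteq M$ and all $f,g,h,h'\in\mathcal C^\infty(M)$ with $h|_U\in\mathcal O(U)$, $h'|_U\in\overline{\mathcal O}(U)$ one has $f\star h|_U=fh|_U$ and $h'\star g|_U=h'g|_U$ (resp. $h\star f|_U=hf|_U$ and $g\star h'|_U=gh'|_U$). $\mathrm C$ denotes complex conjugation on formal series of functions and forms, where the formal parameter is considered purely imaginary: $\mathrm C\nu=-\nu$. A star product $\star$ is Hermitian if $\mathrm C(f\star h)=(\mathrm Ch)\star(\mathrm Cf)$ for all $f,h\in\mathcal C^\infty(M)[[\nu]]$. Characterizing forms. $\nu Z^2_{\mathrm{dR}}(M,\mathbb C)^{1,1}[[\nu]]$ is the set of formal series in $\nu\Gamma^\infty(\bigwedge^2T^*M)[[\nu]]$ of closed two-forms of type $(1,1)$. For a star product $\star$ of Wick type and a holomorphic chart $(z,V)$ with $V$ contractible there are $u_k\in\mathcal C^\infty(V)[[\nu]]$ with $u_k\star z^l-z^l\star u_k=-\nu\delta^l_k$ and $\overline v_l\in\mathcal C^\infty(V)[[\nu]]$ with $\overline v_l\star\overline z^k-\overline z^k\star\overline v_l=\nu\delta^{\overline k}_{\overline l}$. Karabegov's characterizing form is given by $K(\star)|_V=\overline\partial(-u_kdz^k)=\partial(\overline v_ld\overline z^l)$;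 this is independent of all choices and yields a global $K(\star)\in\omega+\nu Z^2_{\mathrm{dR}}(M,\mathbb C)^{1,1}[[\nu]]$. With $\mathrm P=(-1)^{\deg_\nu}$ (i.e. $\nu\mapsto-\nu$) and $f\star_{\mathrm P,\mathrm{opp}}h=\mathrm P((\mathrm Ph)\star(\mathrm Pf))$, a star product $\star$ is of anti-Wick type iff $\star_{\mathrm P,\mathrm{opp}}$ is of Wick type, and for $\star$ of anti-Wick type one sets $\overline K(\star)=\mathrm PK(\star_{\mathrm P,\mathrm{opp}})$. *)

(* Defs.v *)
From HB Require Import structures.
From mathcomp Require Import all_boot all_order all_algebra.
From mathcomp Require Import complex.
From mathcomp Require Import all_classical all_reals all_analysis.
Set Implicit Arguments.
Unset Strict Implicit.
Unset Printing Implicit Defensive.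
Import Order.TTheory GRing.Theory Num.Theory.
Import numFieldNormedType.Exports.
Local Open Scope classical_set_scope.
Local Open Scope ring_scope.

Section RealSmooth.
Variables (R : realType) (m : nat).

Definition evec (i : 'I_m) : 'rV[R]_m := delta_mx 0 i.

Definition iterpd (s : seq 'I_m) (F : 'rV[R]_m -> R) : 'rV[R]_m -> R :=
  foldr (fun i G x => 'D_(evec i) G x) F s.

Definition smooth_on (O : set 'rV[R]_m) (F : 'rV[R]_m -> R) : Prop :=
  forall (s : seq 'I_m) (x : 'rV[R]_m), O x ->
    {for x, continuous (iterpd s F)} /\
    (forall i : 'I_m, derivable (iterpd s F) x (evec i)).

End RealSmooth.

(* A chart is total on [M] with total inverse; only the values on [cdom] and on
   [cmap @` cdom] are meaningful. *)
Record chart (R : realType) (M : topologicalType) (m : nat) := Chart {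
  cdom : set M;
  cmap : M -> 'rV[R]_m;
  cinv : 'rV[R]_m -> M;
  cdom_open : open cdom;
  cim_open : open (cmap @` cdom);
  cmapK : forall p, cdom p -> cinv (cmap p) = p;
  cmap_cont : forall p, cdom p -> {for p, continuous cmap};
  cinv_cont : forall p, cdom p -> {for cmap p, continuous cinv} }.

Definition compatible (R : realType) (M : topologicalType) (m : nat)
    (c c' : chart R M m) : Prop :=
  forall k : 'I_m, smooth_on (cmap c @` (cdom c `&` cdom c'))
                             (fun x => cmap c' (cinv c x) 0 k).

Record smooth_structure (R : realType) (M : topologicalType) (m : nat) :=
  SmoothStructure {
  atlas : set (chart R M m);
  atlas_cover : forall p, exists c, atlas c /\ cdom c p;
  atlas_compatible : forall c c', atlas c -> atlas c' -> compatible c c';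
  atlas_maximal : forall c,
    (forall c', atlas c' -> compatible c c' /\ compatible c' c) -> atlas c }.

Section Manifold.
Variables (R : realType) (M : topologicalType) (m : nat).
Variable A : smooth_structure R M m.
Local Notation C := R[i].

Definition smoothR (U : set M) (f : M -> R) : Prop :=
  forall c, atlas A c ->
    smooth_on (cmap c @` (U `&` cdom c)) (fun x => f (cinv c x)).

Definition smoothC (U : set M) (f : M -> C) : Prop :=
  smoothR U (fun p => complex.Re (f p)) /\ smoothR U (fun p => complex.Im (f p)).

Definition pdR (c : chart R M m) (i : 'I_m) (f : M -> R) (p : M) : R :=
  'D_(evec R i) (fun x => f (cinv c x)) (cmap c p).

Definition pdC (c : chart R M m) (i : 'I_m) (f : M -> C) (p : M) : C :=
  Complex (pdR c i (fun q => complex.Re (f q)) p)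
          (pdR c i (fun q => complex.Im (f q)) p).

Definition mpd (c : chart R M m) (N : nat) (a : {ffun 'I_m -> 'I_N.+1})
    (f : M -> C) : M -> C :=
  foldr (fun i g => iter (a i) (pdC c i) g) f (enum 'I_m).

(* A bidifferential operator acts on functions which are smooth only on an open
   subset, by the same local formula: [B f h] is meaningful at [p] as soon as
   [f] and [h] are smooth near [p].  This is the canonical restriction of the
   operator to open subsets. *)
Definition bidifferential (B : (M -> C) -> (M -> C) -> M -> C) : Prop :=
  forall c, atlas A c -> forall p, cdom c p ->
  exists (U : set M) (N : nat)
         (b : {ffun 'I_m -> 'I_N.+1} -> {ffun 'I_m -> 'I_N.+1} -> M -> C),
    [/\ open U, U p, U `<=` cdom c,
        forall al be, smoothC U (b al be) &
        forall W : set M, open W -> W `<=` U ->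
        forall f h, smoothC W f -> smoothC W h -> forall q, W q ->
        B f h q = \sum_(al : {ffun 'I_m -> 'I_N.+1})
                  \sum_(be : {ffun 'I_m -> 'I_N.+1})
                    b al be q * mpd c al f q * mpd c be h q].

(* Tensor fields of rank two are families of component matrices, one for each
   chart; off the atlas and off the domain of the chart they are unspecified. *)
Definition jacobian (c c' : chart R M m) (p : M) : 'M[R]_m :=
  \matrix_(k, i) pdR c i (fun q => cmap c' q 0 k) p.

Definition covariant2 (T : chart R M m -> M -> 'M[C]_m) : Prop :=
  (forall c, atlas A c -> forall i j, smoothC (cdom c) (fun p => T c p i j)) /\
  (forall c c' p, atlas A c -> atlas A c' -> cdom c p -> cdom c' p ->
     let J := map_mx (real_complex R) (jacobian c c' p) in
     T c p = J^T *m T c' p *m J).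

Definition endomorphism_field (T : chart R M m -> M -> 'M[R]_m) : Prop :=
  (forall c, atlas A c -> forall i j, smoothR (cdom c) (fun p => T c p i j)) /\
  (forall c c' p, atlas A c -> atlas A c' -> cdom c p -> cdom c' p ->
     jacobian c c' p *m T c p = T c' p *m jacobian c c' p).

Definition complexified (T : chart R M m -> M -> 'M[R]_m) :
    chart R M m -> M -> 'M[C]_m :=
  fun c p => map_mx (real_complex R) (T c p).

Definition two_form (T : chart R M m -> M -> 'M[C]_m) : Prop :=
  covariant2 T /\
  forall c p, atlas A c -> cdom c p -> (T c p)^T = - T c p.

Definition closed_form (T : chart R M m -> M -> 'M[C]_m) : Prop :=
  forall c p, atlas A c -> cdom c p -> forall i j k,
    pdC c i (fun q => T c q j k) p + pdC c j (fun q => T c q k i) p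
      + pdC c k (fun q => T c q i j) p = 0.

Definition pseudo_riemannian (g : chart R M m -> M -> 'M[R]_m) : Prop :=
  covariant2 (complexified g) /\
  forall c p, atlas A c -> cdom c p -> (g c p)^T = g c p /\ g c p \in unitmx.

(* [christoffel g c p k i j] is the Christoffel symbol $\Gamma^k_{ij}$ of the
   Levi-Civita connection of [g] in the chart [c]. *)
Definition christoffel (g : chart R M m -> M -> 'M[R]_m) (c : chart R M m)
    (p : M) (k i j : 'I_m) : R :=
  2^-1 * \sum_(l < m) invmx (g c p) k l *
    (pdR c i (fun q => g c q j l) p + pdR c j (fun q => g c q i l) p
       - pdR c l (fun q => g c q i j) p).

Definition parallel (g J : chart R M m -> M -> 'M[R]_m) : Prop :=
  forall c p, atlas A c -> cdom c p -> forall i j k : 'I_m,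
    pdR c i (fun q => J c q k j) p
      + \sum_(l < m) christoffel g c p k i l * J c p l j
      - \sum_(l < m) christoffel g c p l i j * J c p k l = 0.

End Manifold.

(* The matrix of [I] acts on column vectors of components. *)
Record pseudo_kahler (R : realType) (M : topologicalType) (n : nat) :=
  PseudoKahler {
  pk_hausdorff : hausdorff_space M;
  pk_countable : @second_countable M;
  pk_smooth :> smooth_structure R M (n + n);
  pk_g : chart R M (n + n) -> M -> 'M[R]_(n + n);
  pk_I : chart R M (n + n) -> M -> 'M[R]_(n + n);
  pk_metric : pseudo_riemannian pk_smooth pk_g;
  pk_endo : endomorphism_field pk_smooth pk_I;
  pk_almost_complex : forall c p, atlas pk_smooth c -> cdom c p ->
    pk_I c p *m pk_I c p = - 1%:M;
  pk_isometry : forall c p, atlas pk_smooth c -> cdom c p ->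
    (pk_I c p)^T *m pk_g c p *m pk_I c p = pk_g c p;
  pk_parallel : parallel pk_smooth pk_g pk_I }.

Section StarProducts.
Variables (R : realType) (M : topologicalType) (n : nat).
Variable X : pseudo_kahler R M n.
Local Notation C := R[i].
Local Notation ii := (Complex 0 1 : C).
Local Notation chart := (chart R M (n + n)).
Local Notation atlas := (atlas X).
Local Notation smoothC := (smoothC X).

(* Components of $\omega(X,Y) = g(IX,Y)$. *)
Definition pk_omega (c : chart) (p : M) : 'M[C]_(n + n) :=
  map_mx (real_complex R) ((pk_I X c p)^T *m pk_g X c p).

(* Holomorphic charts are the smooth charts [c], with real coordinates
   $(x^1, \dots, x^n, y^1, \dots, y^n)$, such that $I\partial_{x^k} =
   \partial_{y^k}$ on the domain; the complex coordinates are
   $z^k = x^k + \mathrm i y^k$. *)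
Definition holomorphic_chart (c : chart) : Prop :=
  atlas c /\
  forall p, cdom c p -> pk_I X c p = block_mx 0 (- 1%:M) 1%:M 0.

Definition zcoord (c : chart) (k : 'I_n) (p : M) : C :=
  Complex (cmap c p 0 (lshift n k)) (cmap c p 0 (rshift n k)).

Definition zbcoord (c : chart) (k : 'I_n) (p : M) : C := conjc (zcoord c k p).

Definition Zder (c : chart) (k : 'I_n) (f : M -> C) (p : M) : C :=
  2^-1 * (pdC c (lshift n k) f p - ii * pdC c (rshift n k) f p).

Definition Zbder (c : chart) (k : 'I_n) (f : M -> C) (p : M) : C :=
  2^-1 * (pdC c (lshift n k) f p + ii * pdC c (rshift n k) f p).

(* Components of the vectors $Z_k$, $\overline Z_k$ and of the covectors $dz^k$,
   $d\overline z^k$ in the real coordinates. *)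
Definition Zvec (k : 'I_n) : 'cV[C]_(n + n) :=
  2^-1 *: (delta_mx (lshift n k) 0 - ii *: delta_mx (rshift n k) 0).

Definition Zbvec (k : 'I_n) : 'cV[C]_(n + n) :=
  2^-1 *: (delta_mx (lshift n k) 0 + ii *: delta_mx (rshift n k) 0).

Definition dz (k : 'I_n) : 'rV[C]_(n + n) :=
  delta_mx 0 (lshift n k) + ii *: delta_mx 0 (rshift n k).

Definition dzb (k : 'I_n) : 'rV[C]_(n + n) :=
  delta_mx 0 (lshift n k) - ii *: delta_mx 0 (rshift n k).

Definition wedge (a b : 'rV[C]_(n + n)) : 'M[C]_(n + n) :=
  a^T *m b - b^T *m a.

(* $g_{k\overline l}$, read off from
   $\omega = \frac{\mathrm i}{2} g_{k\overline l} dz^k\wedge d\overline z^l$. *)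
Definition gkl (c : chart) (p : M) : 'M[C]_n :=
  \matrix_(k, l) (2 / ii * ((Zvec k)^T *m pk_omega c p *m Zbvec l) 0 0).

(* $g^{k\overline l}$, the solution of
   $g^{k\overline l} g_{k\overline n} = \delta^{\overline l}_{\overline n}$. *)
Definition gklinv (c : chart) (p : M) : 'M[C]_n := (invmx (gkl c p))^T.

Definition poisson (c : chart) (f h : M -> C) (p : M) : C :=
  2 / ii * \sum_(k < n) \sum_(l < n) gklinv c p k l *
    (Zder c k f p * Zbder c l h p - Zbder c l f p * Zder c k h p).

(* $df\circ I = \mathrm i\,df$ on $U$. *)
Definition holomorphic (U : set M) (f : M -> C) : Prop :=
  smoothC U f /\
  forall c p, atlas c -> cdom c p -> U p -> forall i,
    \sum_(j < n + n) pdC c j f p * (pk_I X c p j i)%:C%C = ii * pdC c i f p.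

Definition antiholomorphic (U : set M) (f : M -> C) : Prop :=
  smoothC U f /\
  forall c p, atlas c -> cdom c p -> U p -> forall i,
    \sum_(j < n + n) pdC c j f p * (pk_I X c p j i)%:C%C = - ii * pdC c i f p.

Definition fseries := nat -> M -> C.

Definition smooth_series (U : set M) (F : fseries) : Prop :=
  forall r, smoothC U (F r).

Definition fconst (f : M -> C) : fseries := fun r => if r is 0%N then f else cst 0.

(* Complex conjugation with $\mathrm C\nu = -\nu$. *)
Definition conj_series (F : fseries) : fseries :=
  fun r p => (-1) ^+ r * conjc (F r p).

Definition par_series (F : fseries) : fseries := fun r p => (-1) ^+ r * F r p.

(* The $\nu$-bilinear extension of $\sum_r \nu^r B_r$; the coefficient of $\nu^r$
   is the sum of the $B_a(F_b, H_{r-a-b})$. *)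
Definition fstar (B : nat -> (M -> C) -> (M -> C) -> M -> C) (F H : fseries) :
    fseries :=
  fun r p => \sum_(a < r.+1) \sum_(b < (r - a).+1) B a (F b) (H (r - a - b)%N) p.

Record star_product (B : nat -> (M -> C) -> (M -> C) -> M -> C) : Prop :=
  StarProduct {
  star_bidiff : forall r, bidifferential X (B r);
  star_assoc : forall F G H,
    smooth_series setT F -> smooth_series setT G -> smooth_series setT H ->
    forall r p, fstar B (fstar B F G) H r p = fstar B F (fstar B G H) r p;
  star_C0 : forall f h, smoothC setT f -> smoothC setT h ->
    forall p, B 0%N f h p = f p * h p;
  star_C1 : forall f h, smoothC setT f -> smoothC setT h ->
    forall c p, holomorphic_chart c -> cdom c p ->
    B 1%N f h p - B 1%N h f p = poisson c f h p;
  star_const : forall r (a : C) f, smoothC setT f ->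
    forall p, B r.+1 (cst a) f p = 0 /\ B r.+1 f (cst a) p = 0 }.

Definition wick_type (S : fseries -> fseries -> fseries) : Prop :=
  forall U : set M, open U ->
  forall f g h h', smoothC setT f -> smoothC setT g ->
    smoothC setT h -> smoothC setT h' ->
    holomorphic U h -> antiholomorphic U h' ->
    forall r p, U p ->
      S (fconst f) (fconst h) r p = fconst (f \* h) r p /\
      S (fconst h') (fconst g) r p = fconst (h' \* g) r p.

Definition anti_wick_type (S : fseries -> fseries -> fseries) : Prop :=
  forall U : set M, open U ->
  forall f g h h', smoothC setT f -> smoothC setT g ->
    smoothC setT h -> smoothC setT h' ->
    holomorphic U h -> antiholomorphic U h' ->
    forall r p, U p ->
      S (fconst h) (fconst f) r p = fconst (h \* f) r p /\
      S (fconst g) (fconst h') r p = fconst (g \* h') r p.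

Definition hermitian_star (S : fseries -> fseries -> fseries) : Prop :=
  forall F H, smooth_series setT F -> smooth_series setT H ->
  forall r p, conj_series (S F H) r p = S (conj_series H) (conj_series F) r p.

Definition par_opp (S : fseries -> fseries -> fseries) :
    fseries -> fseries -> fseries :=
  fun F H => par_series (S (par_series H) (par_series F)).

Definition form_series := nat -> chart -> M -> 'M[C]_(n + n).

Definition par_form (K : form_series) : form_series :=
  fun r c p => (-1) ^+ r *: K r c p.

Definition conj_form (K : form_series) : form_series :=
  fun r c p => (-1) ^+ r *: map_mx conjc (K r c p).

Definition real_form (K : form_series) : Prop :=
  forall r c p, atlas c -> cdom c p -> conj_form K r c p = K r c p.

(* Type (1,1): the form vanishes on pairs of vectors of type (1,0) and on pairs
   of vectors of type (0,1), the eigenvectors of [I] for $\pm\mathrm i$. *)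
Definition type11 (T : chart -> M -> 'M[C]_(n + n)) : Prop :=
  forall c p, atlas c -> cdom c p ->
  forall e : C, e = ii \/ e = - ii ->
  forall v w : 'cV[C]_(n + n),
    complexified (pk_I X) c p *m v = e *: v ->
    complexified (pk_I X) c p *m w = e *: w ->
    v^T *m T c p *m w = 0.

(* $\omega + \nu Z^2_{\mathrm{dR}}(M,\mathbb C)^{1,1}[[\nu]]$ *)
Definition omega_plus_closed11 (K : form_series) : Prop :=
  (forall r, two_form X (K r)) /\
  (forall c p, atlas c -> cdom c p -> K 0%N c p = pk_omega c p) /\
  (forall r, closed_form X (K r.+1) /\ type11 (K r.+1)).

Definition contractible (V : set M) : Prop :=
  exists (x0 : M) (H : R * M -> M),
    [/\ V x0, {within `[0, 1]%classic `*` V, continuous H},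
        forall t x, 0 <= t <= 1 -> V x -> V (H (t, x)),
        forall x, V x -> H (0, x) = x & forall x, V x -> H (1, x) = x0].

(* $\overline\partial(a_k dz^k)$ and $\partial(b_l d\overline z^l)$ *)
Definition dbar10 (c : chart) (a : 'I_n -> M -> C) (p : M) : 'M[C]_(n + n) :=
  \sum_(k < n) \sum_(l < n) Zbder c l (a k) p *: wedge (dzb l) (dz k).

Definition del01 (c : chart) (b : 'I_n -> M -> C) (p : M) : 'M[C]_(n + n) :=
  \sum_(l < n) \sum_(k < n) Zder c k (b l) p *: wedge (dz k) (dzb l).

Definition fnu (a : C) : fseries := fun r _ => if r == 1%N then a else 0.

(* $u_k\star z^l - z^l\star u_k = -\nu\delta^l_k$ on the domain of [c] *)
Definition u_relation (S : fseries -> fseries -> fseries) (c : chart)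
    (u : 'I_n -> fseries) : Prop :=
  (forall k, smooth_series (cdom c) (u k)) /\
  forall k l r p, cdom c p ->
    S (u k) (fconst (zcoord c l)) r p - S (fconst (zcoord c l)) (u k) r p
      = fnu (- (k == l)%:R) r p.

(* $\overline v_l\star\overline z^k - \overline z^k\star\overline v_l
   = \nu\delta^{\overline k}_{\overline l}$ on the domain of [c] *)
Definition v_relation (S : fseries -> fseries -> fseries) (c : chart)
    (v : 'I_n -> fseries) : Prop :=
  (forall l, smooth_series (cdom c) (v l)) /\
  forall k l r p, cdom c p ->
    S (v l) (fconst (zbcoord c k)) r p - S (fconst (zbcoord c k)) (v l) r p
      = fnu ((k == l)%:R) r p.

(* [K] is the characterizing form of the star product [S] of Wick type: around
   every point it is computed, in some contractible holomorphic chart [(z, V)],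
   from solutions [u], [v] of the above relations, by
   $K|_V = \overline\partial(-u_k dz^k) = \partial(\overline v_l d\overline z^l)$.
   Since this expression does not depend on the choice of the chart and of the
   solutions, at most one [K] (up to values outside the charts) qualifies.
   Requiring solutions on all contractible charts instead of on small ones
   would be too much: on a contractible open set that is not Stein the
   $\overline\partial$-equation may have no solution. *)
Definition characterizing_form (S : fseries -> fseries -> fseries)
    (K : form_series) : Prop :=
  omega_plus_closed11 K /\
  forall p0, exists (c : chart) (u v : 'I_n -> fseries),
    [/\ holomorphic_chart c, cdom c p0, contractible (cdom c),
        u_relation S c u /\ v_relation S c v &
        forall r p, cdom c p ->
          K r c p = dbar10 c (fun k q => - u k r q) p /\
          K r c p = del01 c (fun l => v l r) p].

(* $\overline K(\star) = \mathrm P K(\star_{\mathrm P,\mathrm{opp}})$, that is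
   $\mathrm P\overline K(\star) = K(\star_{\mathrm P,\mathrm{opp}})$ as
   $\mathrm P$ is an involution. *)
Definition anti_characterizing_form (S : fseries -> fseries -> fseries)
    (K : form_series) : Prop :=
  characterizing_form (par_opp S) (par_form K).

End StarProducts.

(* Main.v *)
Require Import Defs.
From mathcomp Require Import all_boot all_order all_algebra.
From mathcomp Require Import complex.
From mathcomp Require Import all_classical all_reals all_analysis.
From mathcomp Require Import ring lra.
Set Implicit Arguments.
Unset Strict Implicit.
Unset Printing Implicit Defensive.
Import Order.TTheory GRing.Theory Num.Theory.
Import numFieldNormedType.Exports.
Local Open Scope classical_set_scope.
Local Open Scope ring_scope.


(** Let [bar B] denote the conjugate product [f, h |-> C (C h * C f)]; the
    product is Hermitian exactly when it equals [bar B] ([hermitian_bar]), and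
    [bar B] is again of Wick type. If [u_k] and [v_l] solve the two commutation
    relations of the product in a holomorphic chart, then the series [- C v_k]
    solve the first relation for [bar B], so that [C K] is the characterizing
    form of [bar B]. The theorem thus says that a product of Wick type is
    determined by its characterizing form.

    All the arguments take place near one point, after multiplying the local
    functions [z], [u] and [v] by a cut-off function equal to 1 near that point
    ([exists_cutoff]); this makes associativity, which concerns global
    functions, available. They rest on one principle: a functional of finite
    order at a point [q] that kills all the multiples of finitely many
    functions vanishing at [q] is a multiple of the evaluation at [q], provided
    that these functions have independent differentials
    ([functional_value_independent]), or provided that they are the holomorphic
    coordinates and one evaluates on holomorphic functions
    ([functional_value_holomorphic]). It is proved by descending induction on
    the order of vanishing: the leading part of a jet of order [k] is
    recovered, up to the factor [k], by the Euler field ([ipd_euler]). All the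
    jets are taken in one holomorphic chart.

    For a product of Wick type, right multiplication by [u_k] commutes with
    left multiplication by the conjugate coordinates, which is pointwise, and
    has the commutators of [u_k + nu Z_k] with right multiplication by [z],
    which is also pointwise; the principle gives [f * u_k = f u_k + nu Z_k f]
    ([star_u]). The formula for left multiplication by [v_l] is the same
    statement for the opposite product ([star_v]).

    If [K] is real, then [u_k] and [- C v_k] differ by holomorphic functions,
    so both products have the same right multiplications by [z_l] and by
    [- C v_k]. Left multiplications commute with them. As [K] starts with the
    nondegenerate form [omega], the leading terms of these functions have
    independent differentials, and the principle shows degree by degree that
    the two products agree ([wick_product_unique]). Conversely, if they agree,
    then [u_k] and [- C v_k] are two solutions of the same relation; their
    difference multiplies pointwise from the right, and since left
    multiplication by [v_l] is [v_l + nu Zb_l], the difference is holomorphic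
    ([potential_unique]), that is, [K] is real.

    The anti-Wick case is reduced to the Wick case by passing to the product
    with the order of the factors and the sign of [nu] reversed. *)

(** * Calculus of iterated partial derivatives *)

Section CkFunctions.
Variables (R : realType) (m : nat).
Implicit Types (O : set 'rV[R]_m) (F G : 'rV[R]_m -> R) (i j : 'I_m).

Local Notation pd i F := (fun x => 'D_(evec R i) F x).

Definition c1_on O F : Prop := forall x, O x ->
  {for x, continuous F} /\ forall i, derivable F x (evec R i).

Fixpoint ck_on k O F : Prop :=
  c1_on O F /\ if k is k'.+1 then forall i, ck_on k' O (pd i F) else True.

Lemma ck_onS k O F : ck_on k.+1 O F -> ck_on k O F.
Proof.
elim: k F => [|k IH] F; first by case=> cF _; split.
by case=> cF dF; split => // i; apply: IH (dF i).
Qed.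

Lemma ck_on_c1 k O F : ck_on k O F -> c1_on O F.
Proof. by case: k => [|k] []. Qed.

Lemma iterpd_rcons s i F : iterpd (rcons s i) F = iterpd s (pd i F).
Proof. by rewrite /iterpd foldr_rcons. Qed.

(** Induction on the order needs the innermost derivative to be split off,
    whereas the iterated derivatives of [smooth_on] are built from outside. *)
Lemma smooth_on_ckP O F : smooth_on O F <-> forall k, ck_on k O F.
Proof.
split=> [sF k|ckF].
  elim: k F sF => [|k IH] F sF.
    by split=> // x Ox; exact: (sF [::] x Ox).
  split=> [x Ox|i]; first exact: (sF [::] x Ox).
  by apply: IH => s x Ox; have := sF (rcons s i) x Ox; rewrite iterpd_rcons.
move=> s; elim/last_ind: s F ckF => [|s i IH] F ckF x Ox.
  exact: (ck_on_c1 (ckF 0%N)).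
rewrite iterpd_rcons; apply: IH => // k.
by case: (ckF k.+1) => _; exact.
Qed.

Lemma c1_on_eq O F G : open O -> (forall x, O x -> F x = G x) ->
  c1_on O F -> c1_on O G.
Proof.
move=> oO FG cF x Ox; have [contF dF] := cF x Ox.
have nFG : \near x, F x = G x.
  by apply: filterS (open_nbhs_nbhs (conj oO Ox)) => y Oy; exact: FG.
split=> [|i].
  suff: G y @[y --> x] --> G x by [].
  rewrite -(FG x Ox).
  by apply: cvg_trans contF; apply: (near_eq_cvg nFG).
exact: near_eq_derivable nFG (dF i).
Qed.

Lemma derive_eq_on O F G i x : open O -> (forall x, O x -> F x = G x) -> O x ->
  'D_(evec R i) F x = 'D_(evec R i) G x.
Proof.
move=> oO FG Ox; apply: near_eq_derive.
by apply: filterS (open_nbhs_nbhs (conj oO Ox)) => y Oy; exact: FG.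
Qed.

Lemma ck_on_eq k O F G : open O -> (forall x, O x -> F x = G x) ->
  ck_on k O F -> ck_on k O G.
Proof.
move=> oO; elim: k F G => [|k IH] F G FG [cF dF].
  by split; [exact: c1_on_eq FG cF |].
split; first exact: c1_on_eq FG cF.
by move=> i; apply: IH (dF i) => x Ox; exact: derive_eq_on FG Ox.
Qed.

Lemma ck_on_local k O F :
  (forall x, O x -> exists2 U, open U & U x /\ ck_on k U F) -> ck_on k O F.
Proof.
elim: k F => [|k IH] F lF; split=> //.
- by move=> x /lF[U _ [Ux /ck_on_c1]]; exact.
- by move=> x /lF[U _ [Ux /ck_on_c1]]; exact.
- by move=> i; apply: IH => x /lF[U oU [Ux [_ /(_ i)]]]; exists U.
Qed.

Lemma ck_on_cst k O (a : R) : ck_on k O (cst a).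
Proof.
elim: k a => [|k IH] a; split=> //.
- by move=> x _; split=> [|i]; [exact: cst_continuous | exact: derivable_cst].
- by move=> x _; split=> [|i]; [exact: cst_continuous | exact: derivable_cst].
- move=> i; rewrite (_ : (fun _ => _) = cst 0); first exact: IH.
  by apply/funext => x; rewrite derive_cst.
Qed.

Lemma c1_on_add O F G : c1_on O F -> c1_on O G -> c1_on O (F + G).
Proof.
move=> cF cG x Ox; have [cFx dF] := cF x Ox; have [cGx dG] := cG x Ox.
by split=> [|i]; [exact: continuousD | exact: derivableD].
Qed.

Lemma ck_on_add k O F G : open O -> ck_on k O F -> ck_on k O G ->
  ck_on k O (F + G).
Proof.
move=> oO; elim: k F G => [|k IH] F G [cF dF] [cG dG].
  by split; [exact: c1_on_add |].
split; first exact: c1_on_add.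
move=> i; apply: (@ck_on_eq k O (pd i F + pd i G)) => // [x Ox|]; last first.
  by apply: IH; [exact: dF | exact: dG].
have [[_ dFx] [_ dGx]] := (cF x Ox, cG x Ox).
exact: esym (deriveD (dFx i) (dGx i)).
Qed.

Lemma c1_on_mul O F G : c1_on O F -> c1_on O G -> c1_on O (F * G).
Proof.
move=> cF cG x Ox; have [cFx dF] := cF x Ox; have [cGx dG] := cG x Ox.
by split=> [|i]; [exact: continuousM | exact: derivableM].
Qed.

Lemma ck_on_mul k O F G : open O -> ck_on k O F -> ck_on k O G ->
  ck_on k O (F * G).
Proof.
move=> oO; elim: k F G => [|k IH] F G ckF ckG.
  by split; [apply: c1_on_mul; [case: ckF | case: ckG] |].
have [[cF dF] [cG dG]] := (ckF, ckG).
split; first exact: c1_on_mul.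
move=> i; apply: (@ck_on_eq k O (F * pd i G + G * pd i F)) => // [x Ox|].
  have [[_ dFx] [_ dGx]] := (cF x Ox, cG x Ox).
  exact: esym (deriveM (dFx i) (dGx i)).
apply: ck_on_add => //.
- exact: IH (ck_onS ckF) (dG i).
- exact: IH (ck_onS ckG) (dF i).
Qed.

Lemma derive_line F i x :
  'D_(evec R i) F x = 'D_1 (fun h : R => F (h *: evec R i + x)) 0.
Proof.
rewrite /derive; set g1 := fun h => h^-1 *: _; set g2 := fun h => h^-1 *: _.
suff -> : g1 = g2 by [].
by rewrite funeqE /g1 /g2 => h /=; rewrite addr0 scale0r add0r [_%:A]mulr1.
Qed.

Lemma derive_comp (phi : R -> R) F i x :
  derivable F x (evec R i) -> derivable phi (F x) 1 ->
  derivable (phi \o F) x (evec R i) /\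
  'D_(evec R i) (phi \o F) x = 'D_1 phi (F x) * 'D_(evec R i) F x.
Proof.
move=> /derivable1P dF dphi.
have F0 : F (0 *: evec R i + x) = F x by rewrite scale0r add0r.
split.
  apply/derivable1P/derivable1_diffP.
  apply: (@differentiable_comp _ _ _ _ (fun h : R => F (h *: evec R i + x)) phi).
    exact/derivable1_diffP.
  by rewrite F0; exact/derivable1_diffP.
have dphi0 : derivable phi (F (0 *: evec R i + x)) 1 by rewrite F0.
have E := derive1_comp dF dphi0; rewrite !derive1E F0 -derive_line in E.
by rewrite derive_line; exact: E.
Qed.

(** All the members of the family [h] are composed with [F] at once: the
    derivative of [h l] is a combination of later members, so that each
    induction step gains one order of differentiability. *)
Lemma ck_on_comp (h : nat -> R -> R) :
  (forall l (t : R), is_derive t (1 : R) (h l) (h l.+2 t - l%:R * h l.+1 t)) ->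
  forall k l O F, open O -> ck_on k O F -> ck_on k O (h l \o F).
Proof.
move=> dh.
have c1h l O F : c1_on O F -> c1_on O (h l \o F).
  move=> cF x /cF[cFx dF].
  have dhx : derivable (h l) (F x) 1 by apply: ex_derive.
  split=> [|i]; last by case: (derive_comp (dF i) dhx).
  apply: continuous_comp => //.
  by apply: differentiable_continuous; exact/derivable1_diffP.
elim=> [|k IH] l O F oO ckF; split; try exact/c1h/(ck_on_c1 ckF).
  by [].
move=> i; have [cF dF] := ckF.
pose S := h l.+2 \o F + cst (- l%:R) * (h l.+1 \o F).
apply: (@ck_on_eq k O (S * pd i F)) => // [x Ox|].
  have [cFx dFx] := cF x Ox; have dhx := dh l (F x).
  have [_ ->] := derive_comp (dFx i) (@ex_derive _ _ _ _ _ _ _ dhx).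
  rewrite (@derive_val _ _ _ _ _ _ _ dhx) /S -mulNr.
  by [].
have ckF' := ck_onS ckF.
apply: ck_on_mul => //; last exact: dF.
apply: ck_on_add => //; first exact: IH.
by apply: ck_on_mul => //; [exact: ck_on_cst | exact: IH].
Qed.

End CkFunctions.

(** * Symmetry of second partial derivatives *)

Lemma ler_distD_half (R : realFieldType) (a b c d e : R) : c = d ->
  `|a - d| <= e / 2 -> `|b - c| <= e / 2 -> `|a - b| <= e.
Proof.
move=> <- ac; rewrite distrC => cb.
by rewrite (splitr e) -(subrKA c) (le_trans (ler_normD _ _)) // lerD.
Qed.

Section Schwarz.
Variables (R : realType) (m : nat).
Implicit Types (O : set 'rV[R]_m) (F : 'rV[R]_m -> R) (i j : 'I_m).

Local Notation pd i F := (fun x => 'D_(evec R i) F x).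

Lemma is_derive_line F (v y : 'rV[R]_m) (s : R) : derivable F (s *: v + y) v ->
  is_derive s (1 : R) (fun t : R => F (t *: v + y)) ('D_v F (s *: v + y)).
Proof.
have E : (fun h : R => h^-1 *: (((fun t : R => F (t *: v + y)) \o shift s)
            (h *: (1 : R)) - F (s *: v + y))) =
         (fun h : R => h^-1 *: ((F \o shift (s *: v + y)) (h *: v)
            - F (s *: v + y))).
  by apply/funext => h /=; rewrite [h *: (1 : R)]mulr1 scalerDl addrA.
by move=> dF; split; rewrite /derivable /derive E.
Qed.

(** Two applications of the mean value theorem express the second difference of
    [F] along a square by one value of the mixed derivative; the second
    difference itself is symmetric in the two directions. *)
Lemma second_difference_mvt O F i j x (h : R) : 0 < h ->
  (forall s t, 0 <= s <= h -> 0 <= t <= h ->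
     O (s *: evec R i + (t *: evec R j + x))) ->
  c1_on O F -> c1_on O (pd i F) ->
  exists s t, [/\ 0 <= s <= h, 0 <= t <= h &
    F (h *: evec R i + (h *: evec R j + x)) - F (h *: evec R i + x)
      - (F (h *: evec R j + x) - F x) =
    'D_(evec R j) (pd i F) (s *: evec R i + (t *: evec R j + x)) * h ^+ 2].
Proof.
move=> h0 box cF cdF.
have box0 s : 0 <= s <= h -> O (s *: evec R i + x).
  by move=> sh; have := box s 0 sh; rewrite scale0r add0r lexx (ltW h0); exact.
have hh : 0 <= h <= h by rewrite lexx ltW.
pose g (s : R) := F (s *: evec R i + (h *: evec R j + x)) - F (s *: evec R i + x).
pose dg (s : R) := 'D_(evec R i) F (s *: evec R i + (h *: evec R j + x))
                   - 'D_(evec R i) F (s *: evec R i + x).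
have dgE s : 0 <= s <= h -> is_derive s (1 : R) g (dg s).
  move=> sh; apply: is_deriveB; apply: is_derive_line.
    by have [_ d] := cF _ (box s h sh hh); exact: d.
  by have [_ d] := cF _ (box0 s sh); exact: d.
have dgE' s : s \in `]0, h[%R -> is_derive s (1 : R) g (dg s).
  by rewrite in_itv /= => /andP[s0 sh]; apply: dgE; rewrite !ltW.
have gc : {within `[0, h], continuous g}.
  apply: derivable_within_continuous => s; rewrite in_itv /= => sh.
  exact: (@ex_derive _ _ _ _ _ _ _ (dgE s sh)).
have [s /andP[s0 sh] gs] := MVT h0 dgE' gc.
have sh' : 0 <= s <= h by rewrite !ltW.
pose k (t : R) := 'D_(evec R i) F (t *: evec R j + (s *: evec R i + x)).
pose dk (t : R) := 'D_(evec R j) (pd i F) (t *: evec R j + (s *: evec R i + x)).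
have swap t : t *: evec R j + (s *: evec R i + x) =
              s *: evec R i + (t *: evec R j + x) by rewrite addrCA.
have dkE t : 0 <= t <= h -> is_derive t (1 : R) k (dk t).
  move=> th; apply: (@is_derive_line (pd i F)).
  have [_ d] := cdF _ (box s t sh' th).
  by rewrite swap; exact: (d j).
have dkE' t : t \in `]0, h[%R -> is_derive t (1 : R) k (dk t).
  by rewrite in_itv /= => /andP[t0 th]; apply: dkE; rewrite !ltW.
have kc : {within `[0, h], continuous k}.
  apply: derivable_within_continuous => t; rewrite in_itv /= => th.
  exact: (@ex_derive _ _ _ _ _ _ _ (dkE t th)).
have [t /andP[t0 th] kt] := MVT h0 dkE' kc.
exists s, t; split; rewrite ?(ltW s0) ?(ltW sh) ?(ltW t0) ?(ltW th) //.
move: gs kt; rewrite /g /dg /k /dk !scale0r !add0r !swap subr0 => -> ->.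
by rewrite -mulrA expr2.
Qed.

(** Both mixed derivatives are values of the same second difference divided by
    [h ^ 2], at points converging to [x]. *)
Lemma derive_commute O F i j x : open O -> ck_on 2 O F -> O x ->
  'D_(evec R i) (pd j F) x = 'D_(evec R j) (pd i F) x.
Proof.
move=> oO [cF dF] Ox; apply/eqP; rewrite -subr_eq0 -normr_eq0.
apply/eqP/le_anti; rewrite normr_ge0 andbT; apply/ler_addgt0Pr => e e0.
rewrite add0r.
have cont a b : {for x, continuous (fun y => 'D_(evec R a) (pd b F) y)}.
  by case: (dF b) => _ /(_ a)[] /(_ x Ox)[].
have e2 : 0 < e / 2 by rewrite divr_gt0.
have /cvgrPdist_le/(_ _ e2) N1 := cont i j.
have /cvgrPdist_le/(_ _ e2) N2 := cont j i.
have N3 := open_nbhs_nbhs (conj oO Ox).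
have [r /= r0 rN] := (nbhs_ballP _ _).1 (filterI N3 (filterI N1 N2)).
pose K : R := `|evec R i| + `|evec R j| + 1.
have K0 : 0 < K by rewrite /K -addrA ltr_wpDl // ltr_wpDl.
pose h := r / 2 / K.
have h0 : 0 < h by rewrite !divr_gt0.
have near a b s t : (a = i /\ b = j) \/ (a = j /\ b = i) ->
    0 <= s <= h -> 0 <= t <= h ->
    ball x r (s *: evec R a + (t *: evec R b + x)).
  move=> ab /andP[s0 sh] /andP[t0 th]; rewrite -ball_normE /=.
  rewrite distrC addrA addrK.
  apply: (@le_lt_trans _ _ (h * (`|evec R a| + `|evec R b|))).
    rewrite mulrDr; apply: le_trans (ler_normD _ _) _.
    by rewrite !normrZ (ger0_norm s0) (ger0_norm t0) lerD // ler_wpM2r.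
  apply: (@le_lt_trans _ _ (h * K)).
    rewrite ler_pM2l // /K.
    by case: ab => -[-> ->]; [|rewrite [leLHS]addrC]; rewrite lerDl.
  by rewrite /h divfK ?gt_eqF // ltr_pdivrMr // ltr_pMr // ltr1n.
have box1 s t : 0 <= s <= h -> 0 <= t <= h ->
    O (s *: evec R i + (t *: evec R j + x)).
  by move=> sh th; have [] := rN _ (near i j s t (or_introl (conj erefl erefl)) sh th).
have box2 s t : 0 <= s <= h -> 0 <= t <= h ->
    O (s *: evec R j + (t *: evec R i + x)).
  by move=> sh th; have [] := rN _ (near j i s t (or_intror (conj erefl erefl)) sh th).
have [s [t [sh th E1]]] := second_difference_mvt h0 box1 cF (proj1 (dF i)).
have [s' [t' [sh' th' E2]]] := second_difference_mvt h0 box2 cF (proj1 (dF j)).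
have E : 'D_(evec R j) (pd i F) (s *: evec R i + (t *: evec R j + x)) =
         'D_(evec R i) (pd j F) (s' *: evec R j + (t' *: evec R i + x)).
  apply: (@mulIf _ (h ^+ 2)); first by rewrite expf_neq0 // gt_eqF.
  have swap4 (a b c d : R) : a - b - (c - d) = a - c - (b - d) by ring.
  apply: (etrans (esym E1)); apply: etrans E2.
  by rewrite swap4 (addrCA (h *: evec R i)).
have [_ [_ B2]] := rN _ (near i j s t (or_introl (conj erefl erefl)) sh th).
have [_ [B1 _]] := rN _ (near j i s' t' (or_intror (conj erefl erefl)) sh' th').
exact: ler_distD_half E B1 B2.
Qed.

End Schwarz.

(** * Smooth cut-off functions *)

Section Flat.
Variable R : realType.

(** The derivatives of [exp (- 1 / t)], extended by zero, are combinations of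
    these functions. *)
Definition flat (n : nat) (t : R) : R :=
  if 0 < t then t^-1 ^+ n * expR (- t^-1) else 0.

(** This bound at 0, for all [n], gives the differentiability of every [flat n]
    there: [flat n t / t] is [flat n.+1 t]. *)
Lemma flat_le n t : `|flat n t| <= n.+1`!%:R * `|t|.
Proof.
rewrite /flat; case: ifPn => [t0|_]; last first.
  by rewrite normr0 mulr_ge0 // ler0n.
have ti0 : 0 < t^-1 by rewrite invr_gt0.
rewrite !ger0_norm ?mulr_ge0 ?exprn_ge0 ?expR_ge0 ?(ltW ti0) ?(ltW t0) //.
have := expR_ge1Dxn n (ltW ti0).
rewrite expRN => E.
have F0 : 0 < n.+1`!%:R :> R by rewrite ltr0n fact_gt0.
rewrite ler_pdivrMr ?expR_gt0 //.
apply: (@le_trans _ _ (n.+1`!%:R * t * (t^-1 ^+ n.+1 / n.+1`!%:R))).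
  rewrite [X in _ <= X](_ : _ = t^-1 ^+ n) // exprS.
  by field; rewrite !gt_eqF.
rewrite ler_pM2l ?mulr_gt0 //; apply: le_trans E.
by rewrite lerDr ler01.
Qed.

Lemma flat_derive0 n : is_derive (0 : R) (1 : R) (flat n) 0.
Proof.
have C : h^-1 *: (flat n (h *: (1 : R) + 0) - flat n 0) @[h --> (0 : R)^'] --> (0 : R).
  apply/cvgrPdist_le => e e0.
  have F0 : 0 < n.+2`!%:R :> R by rewrite ltr0n fact_gt0.
  near=> h.
  have h0 : h != 0 by near: h; exact: nbhs_dnbhs_neq.
  have he : `|h| < e / n.+2`!%:R.
    by near: h; apply: dnbhs0_lt; rewrite divr_gt0.
  rewrite sub0r normrN addr0 [h *: (1 : R)]mulr1 {2}/flat ltxx subr0.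
  have -> : h^-1 *: flat n h = flat n.+1 h.
    rewrite /flat; case: ifP => _; last by rewrite scaler0.
    by rewrite exprS -mulrA.
  apply: le_trans (flat_le _ _) _; rewrite mulrC.
  by rewrite -ler_pdivlMr // ltW.
split; first by apply/cvg_ex; exists 0.
exact: cvg_lim C.
Unshelve. all: by end_near. Qed.

Lemma flat_derive n (t : R) :
  is_derive t (1 : R) (flat n) (flat n.+2 t - n%:R * flat n.+1 t).
Proof.
case: (ltgtP 0 t) => [t0|t0|t0]; last first.
- by rewrite -t0 {2 3}/flat ltxx mulr0 subr0; exact: flat_derive0.
- rewrite [X in is_derive _ _ _ X](_ : _ = 0); last first.
    by rewrite /flat ltNge (ltW t0) /= mulr0 subr0.
  apply: (@near_eq_is_derive _ _ _ (cst 0)).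
  near=> s; rewrite /flat ltNge ifF //; apply/negbF/ltW.
  by near: s; exact: lt_nbhsl.
- have ti : t != 0 by rewrite gt_eqF.
  pose f (s : R) : R := s^-1 ^+ n * expR (- s^-1).
  apply: (@near_eq_is_derive _ _ _ f).
    near=> s; rewrite /flat ifT //.
    by near: s; exact: lt_nbhsr.
  have dV : is_derive t (1 : R) (fun s : R => s^-1) (- t^-1 ^+ 2).
    have d := @is_derive_id _ R t 1.
    have := @is_deriveV R id t 1 1 ti d.
    by rewrite /GRing.scale /= mulr1 exprVn.
  have dE : is_derive t (1 : R) (fun s : R => expR (- s^-1)) (t^-1 ^+ 2 * expR (- t^-1)).
    have dN := @is_deriveN _ _ _ (fun s : R => s^-1) t 1 _ dV.
    have dC := @is_derive1_comp R expR (fun s : R => - s^-1) t _ _ (is_derive_expR _) dN.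
    apply: (is_derive_eq dC).
    by rewrite opprK mulrC.
  have dX := @is_deriveX _ _ (fun s : R => s^-1) n t 1 _ dV.
  have fE : (fun s : R => s^-1) ^+ n * (fun s => expR (- s^-1)) = f.
    by apply/funext => s; rewrite /f -[LHS]/(((fun s : R => s^-1) ^+ n) s * _) fctE.
  have dM := is_deriveM dX dE; rewrite fE in dM.
  apply: (is_derive_eq dM).
  rewrite /flat t0 /GRing.scale /=.
  rewrite [X in X * _ + _](_ : _ = t^-1 ^+ n); last by rewrite fctE.
  move: (expR _) => e; clear; case: n => [|n]; first by rewrite !expr0; ring.
  by rewrite !exprS; ring.
Unshelve. all: by end_near. Qed.

Lemma flat_gt0 n t : 0 < t -> 0 < flat n t.
Proof.
by move=> t0; rewrite /flat t0 mulr_gt0 ?expR_gt0 // exprn_gt0 // invr_gt0.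
Qed.

Lemma flat_le0 n t : t <= 0 -> flat n t = 0.
Proof. by rewrite /flat leNgt => /negbTE ->. Qed.

Lemma flat0_homo s t : 0 < s -> s <= t -> flat 0 s <= flat 0 t.
Proof.
move=> s0 st; have t0 := lt_le_trans s0 st.
by rewrite /flat s0 t0 !expr0 !mul1r ler_expR lerN2 lef_pV2.
Qed.

(** The function [flat 0] is constant only where it vanishes; composing it with
    the nonincreasing function [1 - flat 0 (t - e) / flat 0 e], which is 1 for
    [t <= e] and nonpositive for [2 * e <= t], produces a plateau without
    dividing by a function. *)
Definition plateau (e t : R) : R :=
  flat 0 (1 - flat 0 (t - e) / flat 0 e) / flat 0 1.

Lemma plateau1 e t : t <= e -> plateau e t = 1.
Proof.
move=> te; rewrite /plateau (@flat_le0 0 (t - e)) ?subr_le0 //.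
by rewrite mul0r subr0 divff // gt_eqF // flat_gt0.
Qed.

Lemma plateau0 e t : 0 < e -> 2 * e <= t -> plateau e t = 0.
Proof.
move=> e0 et; rewrite /plateau [X in X / _]flat_le0 ?mul0r //.
rewrite subr_le0 ler_pdivlMr ?flat_gt0 // mul1r flat0_homo //.
by rewrite lerBrDr; apply: le_trans et; rewrite mulr_natl mulr2n.
Qed.

Lemma ck_on_plateau m k (O : set 'rV[R]_m) F e : open O ->
  ck_on k O F -> ck_on k O (plateau e \o F).
Proof.
move=> oO ckF; have dh := flat_derive.
have cst_ck a : ck_on k O (cst a) by exact: ck_on_cst.
rewrite (_ : _ \o _ = (flat 0 \o (cst 1 + cst (- (flat 0 e)^-1) *
    (flat 0 \o (F + cst (- e))))) * cst (flat 0 1)^-1).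
  apply: ck_on_mul => //; apply: (ck_on_comp dh) => //.
  apply: ck_on_add => //; apply: ck_on_mul => //.
  by apply: (ck_on_comp dh) => //; exact: ck_on_add.
apply/funext => x; rewrite /plateau /= !fctE /=.
by rewrite mulNr [(flat 0 e)^-1 * _]mulrC.
Qed.

End Flat.

(** * Calculus in one chart *)

Section ChartReal.
Variables (R : realType) (M : topologicalType) (m : nat) (c : chart R M m).
Implicit Types (W : set M) (f g : M -> R).

(** Smoothness in the single chart [c]. *)
Definition csmR W f := smooth_on (cmap c @` W) (fun x => f (cinv c x)).

(** The image of the whole domain is open and the inverse of the chart is
    continuous on it. *)
Lemma cmap_open W : open W -> W `<=` cdom c -> open (cmap c @` W).
Proof.
move=> oW Wc; rewrite openE => _ [p Wp <-]; rewrite /interior.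
have N1 : nbhs (cmap c p) (cmap c @` cdom c).
  by apply: open_nbhs_nbhs; split; [exact: cim_open | exists p => //; exact: Wc].
have N2 : nbhs (cmap c p) (cinv c @^-1` W).
  apply: (cinv_cont (Wc _ Wp)); rewrite cmapK; last exact: Wc.
  exact: open_nbhs_nbhs.
apply: filterS (filterI N1 N2) => _ [[q cq <-]] /=.
by rewrite cmapK // => Wq; exists q.
Qed.

Lemma csmR_ck W f : csmR W f <-> forall k,
  ck_on k (cmap c @` W) (fun x => f (cinv c x)).
Proof. exact: smooth_on_ckP. Qed.

Section OnOpen.
Variable W : set M.
Hypotheses (oW : open W) (Wc : W `<=` cdom c).
Let oO := cmap_open oW Wc.

Let im_in p : W p -> (cmap c @` W) (cmap c p).
Proof. by exists p. Qed.

Lemma csmR_eq f g : (forall p, W p -> f p = g p) -> csmR W f -> csmR W g.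
Proof.
move=> fg /csmR_ck sf; apply/csmR_ck => k; apply: ck_on_eq (sf k) => //.
by move=> _ [p Wp <-]; rewrite cmapK ?fg //; exact: Wc.
Qed.

Lemma csmR_cst (a : R) : csmR W (fun=> a).
Proof. by apply/csmR_ck => k; exact: ck_on_cst. Qed.

Lemma csmR_add f g : csmR W f -> csmR W g -> csmR W (fun p => f p + g p).
Proof.
move=> /csmR_ck sf /csmR_ck sg; apply/csmR_ck => k.
exact: (ck_on_add oO (sf k) (sg k)).
Qed.

Lemma csmR_mul f g : csmR W f -> csmR W g -> csmR W (fun p => f p * g p).
Proof.
move=> /csmR_ck sf /csmR_ck sg; apply/csmR_ck => k.
exact: (ck_on_mul oO (sf k) (sg k)).
Qed.

Lemma csmR_sum (I : Type) (r : seq I) (f : I -> M -> R) :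
  (forall i, csmR W (f i)) -> csmR W (fun p => \sum_(i <- r) f i p).
Proof.
move=> sf; elim: r => [|i r IH].
  by apply: csmR_eq (csmR_cst 0) => p _; rewrite big_nil.
by apply: csmR_eq (csmR_add (sf i) IH) => p _; rewrite big_cons.
Qed.

Lemma csmR_plateau e f : csmR W f -> csmR W (fun p => plateau e (f p)).
Proof.
move=> /csmR_ck sf; apply/csmR_ck => k.
exact: (ck_on_plateau e oO (sf k)).
Qed.

Lemma pdR_rep i f x : (cmap c @` W) x ->
  pdR c i f (cinv c x) = 'D_(evec R i) (fun x => f (cinv c x)) x.
Proof. by case=> p Wp <-; rewrite /pdR cmapK //; exact: Wc. Qed.

Lemma csmR_pd i f : csmR W f -> csmR W (pdR c i f).
Proof.
move=> /csmR_ck sf; apply/csmR_ck => k.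
apply: (@ck_on_eq _ _ k _
  (fun x => 'D_(evec R i) (fun x => f (cinv c x)) x)) => //.
  by move=> x Ox; rewrite pdR_rep.
by have [_] := sf k.+1; exact.
Qed.

Let drv f p i : csmR W f -> W p ->
  derivable (fun x => f (cinv c x)) (cmap c p) (evec R i).
Proof. by move=> /csmR_ck/(_ 0%N)[sf _] /im_in/sf[_]; exact. Qed.

Lemma pdR_eq i f g p : (forall p, W p -> f p = g p) -> W p ->
  pdR c i f p = pdR c i g p.
Proof.
move=> fg /im_in Wp; apply: derive_eq_on Wp => // _ [q Wq <-].
by rewrite cmapK ?fg //; exact: Wc.
Qed.

Lemma pdR_cst i (a : R) p : pdR c i (fun=> a) p = 0.
Proof. exact: derive_cst. Qed.

Lemma pdR_add i f g p : csmR W f -> csmR W g -> W p ->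
  pdR c i (fun q => f q + g q) p = pdR c i f p + pdR c i g p.
Proof.
by move=> sf sg Wp; rewrite /pdR -deriveD; [|exact: drv..].
Qed.

Lemma pdR_mul i f g p : csmR W f -> csmR W g -> W p ->
  pdR c i (fun q => f q * g q) p = f p * pdR c i g p + g p * pdR c i f p.
Proof.
move=> sf sg Wp; have cp := Wc Wp; rewrite /pdR.
rewrite -[f p](congr1 f (cmapK cp)) -[g p](congr1 g (cmapK cp)).
by rewrite -[RHS]deriveM; [|exact: drv..].
Qed.

Lemma pdR_commute i j f p : csmR W f -> W p ->
  pdR c i (pdR c j f) p = pdR c j (pdR c i f) p.
Proof.
move=> /csmR_ck/(_ 2%N) sf /im_in Wp.
have E k l : pdR c k (pdR c l f) p =
    'D_(evec R k) (fun x => 'D_(evec R l) (fun x => f (cinv c x)) x) (cmap c p).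
  rewrite {1}/pdR; apply: (derive_eq_on (F := fun x => pdR c l f (cinv c x)) k oO _ Wp).
  by move=> x Ox; rewrite pdR_rep.
rewrite (E i j) (E j i).
exact: (@derive_commute R m _ (fun x => f (cinv c x)) i j _ oO sf Wp).
Qed.

End OnOpen.

Lemma csmR_sub W W' f : W' `<=` W -> csmR W f -> csmR W' f.
Proof.
move=> W'W sf s x [p Wp <-]; apply: sf; exists p => //; exact: W'W.
Qed.

Lemma csmR_local W f : (forall p, W p -> exists U, [/\ open U, U p,
  U `<=` cdom c & csmR U f]) -> csmR W f.
Proof.
move=> lf; apply/csmR_ck => k; apply: ck_on_local => _ [p Wp <-].
have [U [oU Up Uc /csmR_ck/(_ k) sf]] := lf p Wp.
by exists (cmap c @` U); [exact: cmap_open | split=> //; exists p].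
Qed.

Lemma is_derive_coord (i k : 'I_m) (x : 'rV[R]_m) :
  is_derive x (evec R i) (fun y : 'rV[R]_m => y 0 k : R) (i == k)%:R.
Proof.
have dF : is_derive (0 : R) (1 : R) (fun h : R => (h *: evec R i + x) 0 k) (i == k)%:R.
  have -> : (fun h : R => (h *: evec R i + x) 0 k) =
            (fun h : R => h * (i == k)%:R + x 0 k).
    by apply/funext => h; rewrite !mxE eqxx /= eq_sym.
  apply: is_derive_eq; rewrite addr0 scaler0 add0r.
  by rewrite /GRing.scale /= mulr1.
split; first by apply/derivable1P; exact: (@ex_derive _ _ _ _ _ _ _ dF).
by rewrite (derive_line (fun y : 'rV[R]_m => y 0 k : R)); exact: derive_val.
Qed.

Lemma csmR_coord k : csmR (cdom c) (fun p => cmap c p 0 k).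
Proof.
apply/csmR_ck => l; have oO := cmap_open (cdom_open c) (@subset_refl _ (cdom c)).
apply: (@ck_on_eq _ _ l _ (fun x => x 0 k)) => //.
  by move=> _ [p cp <-]; rewrite cmapK.
have C : c1_on (cmap c @` cdom c) (fun x : 'rV[R]_m => x 0 k).
  move=> x _; split; last by move=> i; have [] := is_derive_coord i k x.
  exact: coord_continuous.
case: l => [|l]; split => // i.
rewrite (_ : (fun _ => _) = cst (i == k)%:R); first exact: ck_on_cst.
by apply/funext => x; have [] := is_derive_coord i k x.
Qed.

Lemma pdR_coord i k p : cdom c p -> pdR c i (fun q => cmap c q 0 k) p = (i == k)%:R.
Proof.
move=> cp; rewrite /pdR.
have oO := cmap_open (cdom_open c) (@subset_refl _ (cdom c)).
rewrite (@derive_eq_on _ _ _ _ (fun x => x 0 k) i (cmap c p) oO).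
- by have [] := is_derive_coord i k (cmap c p).
- by move=> _ [q cq <-]; rewrite cmapK.
- by exists p.
Qed.

End ChartReal.

Section ChartComplex.
Variables (R : realType) (M : topologicalType) (m : nat) (c : chart R M m).
Local Notation C := R[i].
Implicit Types (W : set M) (f g : M -> C).

Definition csm W f :=
  csmR c W (fun p => complex.Re (f p)) /\ csmR c W (fun p => complex.Im (f p)).

Lemma csm_sub W W' f : W' `<=` W -> csm W f -> csm W' f.
Proof. by move=> W'W [s1 s2]; split; exact: csmR_sub W'W _. Qed.

Lemma csm_local W f : (forall p, W p -> exists U, [/\ open U, U p,
  U `<=` cdom c & csm U f]) -> csm W f.
Proof.
by move=> lf; split; apply: csmR_local => p /lf[U [oU Up Uc [s1 s2]]]; exists U.
Qed.

Lemma csm_coord k : csm (cdom c) (fun p => (cmap c p 0 k)%:C%C).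
Proof.
split; first exact: csmR_coord.
exact: csmR_cst.
Qed.

Lemma pdC_coord i k p : cdom c p ->
  pdC c i (fun q => (cmap c q 0 k)%:C%C) p = (i == k)%:R.
Proof.
move=> cp; rewrite /pdC /= pdR_coord // pdR_cst.
by case: (i == k).
Qed.

Section OnOpen.
Variable W : set M.
Hypotheses (oW : open W) (Wc : W `<=` cdom c).

Lemma csm_eq f g : (forall p, W p -> f p = g p) -> csm W f -> csm W g.
Proof.
by move=> fg [s1 s2]; split;
  [apply: (csmR_eq oW Wc _ s1) | apply: (csmR_eq oW Wc _ s2)] => p /fg ->.
Qed.

Lemma csm_cst (a : C) : csm W (fun=> a).
Proof. by split; exact: csmR_cst. Qed.

Lemma csm_add f g : csm W f -> csm W g -> csm W (fun p => f p + g p).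
Proof.
move=> [f1 f2] [g1 g2]; split.
  apply: csmR_eq (csmR_add oW Wc f1 g1) => // p _.
  by case: (f p) (g p) => ? ? [].
apply: csmR_eq (csmR_add oW Wc f2 g2) => // p _.
by case: (f p) (g p) => ? ? [].
Qed.

Lemma csm_mul f g : csm W f -> csm W g -> csm W (fun p => f p * g p).
Proof.
move=> [f1 f2] [g1 g2].
have N1 : csmR c W (fun=> -1) by exact: csmR_cst.
split.
  apply: csmR_eq (csmR_add oW Wc (csmR_mul oW Wc f1 g1)
    (csmR_mul oW Wc N1 (csmR_mul oW Wc f2 g2))) => // p _.
  by case: (f p) (g p) => a b [a' b'] /=; rewrite mulN1r.
apply: csmR_eq (csmR_add oW Wc (csmR_mul oW Wc f1 g2) (csmR_mul oW Wc f2 g1)) => // p _.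
by case: (f p) (g p) => a b [a' b'] /=; rewrite addrC.
Qed.

Lemma csm_scale (a : C) f : csm W f -> csm W (fun p => a * f p).
Proof. by move=> sf; exact: csm_mul (csm_cst a) sf. Qed.

Lemma csm_sum (I : Type) (r : seq I) (f : I -> M -> C) :
  (forall i, csm W (f i)) -> csm W (fun p => \sum_(i <- r) f i p).
Proof.
move=> sf; elim: r => [|i r IH].
  by apply: csm_eq (csm_cst 0) => p _; rewrite big_nil.
by apply: csm_eq (csm_add (sf i) IH) => p _; rewrite big_cons.
Qed.

Lemma csm_conj f : csm W f -> csm W (fun p => conjc (f p)).
Proof.
move=> [f1 f2]; split.
  by apply: csmR_eq f1 => // p _; case: (f p).
have N1 : csmR c W (fun=> -1) by exact: csmR_cst.
apply: csmR_eq (csmR_mul oW Wc N1 f2) => // p _.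
by case: (f p) => a b /=; rewrite mulN1r.
Qed.

Lemma csm_pd i f : csm W f -> csm W (pdC c i f).
Proof. by move=> [s1 s2]; split; exact: csmR_pd. Qed.

Lemma pdC_eq i f g p : (forall p, W p -> f p = g p) -> W p ->
  pdC c i f p = pdC c i g p.
Proof.
by move=> fg Wp; congr Complex; apply: (pdR_eq oW Wc) => // q /fg ->.
Qed.

Lemma pdC_cst i (a : C) p : pdC c i (fun=> a) p = 0.
Proof. by rewrite /pdC !pdR_cst. Qed.

Lemma pdC_add i f g p : csm W f -> csm W g -> W p ->
  pdC c i (fun q => f q + g q) p = pdC c i f p + pdC c i g p.
Proof.
move=> [f1 f2] [g1 g2] Wp; rewrite /pdC.
rewrite [RHS]/GRing.add /= -(pdR_add i f1 g1 Wp) -(pdR_add i f2 g2 Wp).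
by congr Complex; apply: (pdR_eq oW Wc) => // q _; case: (f q) (g q) => ? ? [].
Qed.

Lemma pdC_mul i f g p : csm W f -> csm W g -> W p ->
  pdC c i (fun q => f q * g q) p = pdC c i f p * g p + f p * pdC c i g p.
Proof.
move=> [f1 f2] [g1 g2] Wp; rewrite /pdC.
have N1 : csmR c W (fun=> -1) by exact: csmR_cst.
have E1 : pdR c i (fun q => complex.Re (f q * g q)) p =
    pdR c i (fun q => complex.Re (f q) * complex.Re (g q)
       + -1 * (complex.Im (f q) * complex.Im (g q))) p.
  apply: (pdR_eq oW Wc) => // q _.
  by case: (f q) (g q) => a b [a' b'] /=; rewrite mulN1r.
have E2 : pdR c i (fun q => complex.Im (f q * g q)) p =
    pdR c i (fun q => complex.Re (f q) * complex.Im (g q)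
       + complex.Im (f q) * complex.Re (g q)) p.
  apply: (pdR_eq oW Wc) => // q _.
  by case: (f q) (g q) => a b [a' b'] /=; rewrite addrC.
have mulS := csmR_mul oW Wc.
rewrite E1 E2 (pdR_add i (mulS _ _ f1 g1) (mulS _ _ N1 (mulS _ _ f2 g2)) Wp).
rewrite (pdR_add i (mulS _ _ f1 g2) (mulS _ _ f2 g1) Wp).
rewrite (pdR_mul Wc i N1 (mulS _ _ f2 g2) Wp) pdR_cst.
rewrite (pdR_mul Wc i f1 g1 Wp) (pdR_mul Wc i f2 g2 Wp).
rewrite (pdR_mul Wc i f1 g2 Wp) (pdR_mul Wc i f2 g1 Wp).
move: (pdR _ _ _ p) (pdR _ _ _ p) (pdR _ _ _ p) (pdR _ _ _ p) => x y z w.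
case: (f p) (g p) => a b [a' b'] /=; apply/eqP.
rewrite eq_complex /=; apply/andP.
by split; apply/eqP; ring.
Qed.

Lemma pdC_scale i (a : C) f p : csm W f -> W p ->
  pdC c i (fun q => a * f q) p = a * pdC c i f p.
Proof.
by move=> sf Wp; rewrite (pdC_mul i (csm_cst a) sf Wp) pdC_cst mul0r add0r.
Qed.

Lemma pdC_opp i f p : csm W f -> W p ->
  pdC c i (fun q => - f q) p = - pdC c i f p.
Proof.
move=> sf Wp; rewrite -mulN1r -(pdC_scale i (-1) sf Wp).
by apply: (pdC_eq i _ Wp) => q _; rewrite mulN1r.
Qed.

Lemma pdC_conj i f p : csm W f -> W p ->
  pdC c i (fun q => conjc (f q)) p = conjc (pdC c i f p).
Proof.
move=> [f1 f2] Wp; rewrite /pdC /=.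
have N1 : csmR c W (fun=> -1) by exact: csmR_cst.
congr Complex; first by apply: (pdR_eq oW Wc) => // q _; case: (f q).
have H := pdR_mul Wc i N1 f2 Wp; rewrite pdR_cst mulr0 addr0 mulN1r in H.
rewrite -[RHS]H.
by apply: (pdR_eq oW Wc) => // q _; case: (f q) => a b /=; rewrite mulN1r.
Qed.

Lemma pdC_commute i j f p : csm W f -> W p ->
  pdC c i (pdC c j f) p = pdC c j (pdC c i f) p.
Proof.
move=> [f1 f2] Wp.
by have H1 := pdR_commute oW Wc i j f1 Wp; have H2 := pdR_commute oW Wc i j f2 Wp;
  apply/eqP; rewrite eq_complex; apply/andP; split; apply/eqP; [exact: H1 | exact: H2].
Qed.

End OnOpen.

End ChartComplex.

(** * Smooth functions on the manifold *)

Section SmoothFunctions.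
Variables (R : realType) (M : topologicalType) (m : nat).
Variable A : smooth_structure R M m.
Local Notation C := R[i].
Implicit Types (U V W : set M) (f g : M -> C).

Lemma smoothC_csm U f : smoothC A U f <->
  forall c, atlas A c -> csm c (U `&` cdom c) f.
Proof.
split=> [[s1 s2] c Ac|sf]; first by split; [exact: s1 | exact: s2].
by split=> c Ac; [exact: proj1 (sf c Ac) | exact: proj2 (sf c Ac)].
Qed.

Lemma smoothC_on c W f : atlas A c -> W `<=` cdom c -> smoothC A W f -> csm c W f.
Proof. by move=> Ac Wc /smoothC_csm/(_ c Ac); rewrite (setIidl Wc). Qed.

Lemma smoothC_sub U V f : V `<=` U -> smoothC A U f -> smoothC A V f.
Proof.
move=> VU /smoothC_csm sf; apply/smoothC_csm => c Ac.
by apply: csm_sub (sf c Ac); exact: setSI.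
Qed.

Lemma smoothC_eq U f g : open U -> (forall p, U p -> f p = g p) ->
  smoothC A U f -> smoothC A U g.
Proof.
move=> oU fg /smoothC_csm sf; apply/smoothC_csm => c Ac.
apply: csm_eq (sf c Ac) => [|p [_]|p []] //; last by move=> Up _; exact: fg.
by apply: openI oU (cdom_open c).
Qed.

Lemma smoothC_cst U (a : C) : smoothC A U (fun=> a).
Proof. by apply/smoothC_csm => c Ac; exact: csm_cst. Qed.

Section Operations.
Variable U : set M.
Hypothesis oU : open U.
Let oUc (c : chart R M m) : open (U `&` cdom c) := openI oU (cdom_open c).
Let Ucc (c : chart R M m) : U `&` cdom c `<=` cdom c := @subIsetr _ U (cdom c).

Lemma smoothC_add f g : smoothC A U f -> smoothC A U g ->
  smoothC A U (fun p => f p + g p).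
Proof.
move=> /smoothC_csm sf /smoothC_csm sg; apply/smoothC_csm => c Ac.
exact: (csm_add (oUc c) (@Ucc c) (sf c Ac) (sg c Ac)).
Qed.

Lemma smoothC_mul f g : smoothC A U f -> smoothC A U g ->
  smoothC A U (fun p => f p * g p).
Proof.
move=> /smoothC_csm sf /smoothC_csm sg; apply/smoothC_csm => c Ac.
exact: (csm_mul (oUc c) (@Ucc c) (sf c Ac) (sg c Ac)).
Qed.

Lemma smoothC_scale (a : C) f : smoothC A U f -> smoothC A U (fun p => a * f p).
Proof. by move=> sf; exact: (smoothC_mul (smoothC_cst U a) sf). Qed.

Lemma smoothC_sum (I : Type) (r : seq I) (f : I -> M -> C) :
  (forall i, smoothC A U (f i)) -> smoothC A U (fun p => \sum_(i <- r) f i p).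
Proof.
move=> sf; elim: r => [|i r IH].
  by apply: smoothC_eq (smoothC_cst U 0) => // p _; rewrite big_nil.
by apply: smoothC_eq (smoothC_add (sf i) IH) => // p _; rewrite big_cons.
Qed.

Lemma smoothC_conj f : smoothC A U f -> smoothC A U (fun p => conjc (f p)).
Proof.
move=> /smoothC_csm sf; apply/smoothC_csm => c Ac.
exact: (csm_conj (oUc c) (@Ucc c) (sf c Ac)).
Qed.

End Operations.

Lemma smoothC_coord c k : atlas A c ->
  smoothC A (cdom c) (fun p => (cmap c p 0 k)%:C%C).
Proof.
move=> Ac; apply/smoothC_csm => c' Ac'; split; last exact: csmR_cst.
have := atlas_compatible Ac' Ac k.
by rewrite setIC.
Qed.

(** The cut-off vanishes outside the preimage of a compact ball contained in the
    image of the chart. This preimage is compact, hence closed as [M] is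
    Hausdorff, and the products with the cut-off vanish on its complement. *)
Lemma exists_cutoff c p0 : hausdorff_space M -> atlas A c -> cdom c p0 ->
  exists W (chi : M -> R), [/\ open W, W p0, W `<=` cdom c,
    forall q, W q -> chi q = 1 &
    forall f, smoothC A (cdom c) f ->
      smoothC A setT (fun q => (chi q)%:C%C * f q)].
Proof.
move=> hM Ac cp0; set x0 := cmap c p0.
pose dist2 (x : 'rV[R]_m) : R := \sum_(k < m) (x 0 k - x0 0 k) ^+ 2.
have dist2_cont : continuous dist2.
  have -> : dist2 = \sum_(k < m) (fun x : 'rV[R]_m => (x 0 k - x0 0 k) ^+ 2).
    by apply/funext => x; rewrite fct_sumE.
  apply: (big_ind (fun F : 'rV[R]_m -> R => continuous F)).
  - exact: cst_continuous.
  - by move=> F G cF cG x; exact: (continuousD (cF x) (cG x)).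
  - move=> k _ x.
    have ck : {for x, continuous (fun y : 'rV[R]_m => y 0 k - x0 0 k)}.
      by apply: continuousB; [exact: coord_continuous | exact: cst_continuous].
    exact: (continuousM ck ck).
have [r /= r0 rim] : exists2 r : R, 0 < r & ball x0 r `<=` cmap c @` cdom c.
  apply/nbhs_ballP; apply: open_nbhs_nbhs; split; first exact: cim_open.
  by exists p0.
(* the Euclidean ball where [dist2 x <= 2 * e] lies in the ball of radius [r]
   of the supremum norm, as [2 * e < r ^ 2] *)
pose e := r ^+ 2 / 4.
have e0 : 0 < e by rewrite divr_gt0 // exprn_gt0.
have small x : dist2 x <= 2 * e -> ball x0 r x.
  move=> xe; rewrite -ball_normE /= distrC.
  rewrite [X in X < _]/Num.Def.normr/= mx_normrE; apply/bigmax_ltP; split=> // -[i k] _ /=.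
  rewrite !mxE ord1.
  suff: (x 0 k - x0 0 k) ^+ 2 < r ^+ 2.
    by rewrite -real_normK ?num_real // ltr_pXn2r // nnegrE ltW.
  apply: (@le_lt_trans _ _ (2 * e)); last first.
    rewrite /e; have : 0 < r ^+ 2 by rewrite exprn_gt0.
    by move=> ?; lra.
  apply: le_trans xe; rewrite /dist2 (bigD1 k) //= lerDl.
  by apply: sumr_ge0 => l _; rewrite sqr_ge0.
pose K := [set x | dist2 x <= 2 * e].
have Kim : K `<=` cmap c @` cdom c by move=> x Kx; exact/rim/small.
have Kcpt : compact K.
  apply: bounded_closed_compact.
    exists (`|x0| + r); split; first exact: num_real.
    move=> b /ltW rb x /small; rewrite -ball_normE /= => /ltW xr.
    apply: le_trans rb; rewrite -[x](subKr x0).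
    by apply: le_trans (ler_normB _ _) _; rewrite lerD2l.
  rewrite /K -[X in closed X]/(dist2 @^-1` [set y | y <= 2 * e]).
  by apply: closed_comp => // *; exact: dist2_cont.
have cK : closed (cinv c @` K).
  apply: compact_closed => //; apply: continuous_compact => //.
  apply: continuous_in_subspaceT => x; rewrite inE => /Kim[p cp <-].
  exact: cinv_cont.
pose chi p := if pselect (cdom c p) then plateau e (dist2 (cmap c p)) else 0.
have chi_in p : cdom c p -> chi p = plateau e (dist2 (cmap c p)).
  by rewrite /chi; case: pselect.
have chi0 p : ~ (cinv c @` K) p -> chi p = 0.
  rewrite /chi; case: pselect => // cp nK; apply: plateau0 => //.
  rewrite leNgt; apply/negP => lt2; apply: nK.
  by exists (cmap c p); [exact: ltW | rewrite cmapK].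
exists (cdom c `&` (fun p => dist2 (cmap c p) < e)), chi; split.
- rewrite openE => p [cp pe]; apply: filterI.
    by apply: open_nbhs_nbhs; split => //; exact: cdom_open.
  have dc : dist2 (cmap c q) @[q --> p] --> dist2 (cmap c p).
    exact: (continuous_comp (cmap_cont cp) (dist2_cont _)).
  by have := dc _ (lt_nbhsl pe).
- by split=> //; rewrite /dist2 big1 // => k _; rewrite subrr expr0n.
- by move=> q [].
- by move=> q [cq qe]; rewrite chi_in // plateau1 // ltW.
- move=> f sf; apply/smoothC_csm => c' Ac'; apply: csm_local => p [_ cp'].
  have [cp|ncp] := pselect (cdom c p).
    have oU : open (cdom c `&` cdom c') by apply: openI; exact: cdom_open.
    exists (cdom c `&` cdom c'); split=> //.
    have Uc' : cdom c `&` cdom c' `<=` cdom c' by move=> ? [].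
    suff chi_sm : csm c' (cdom c `&` cdom c') (fun q => (chi q)%:C%C).
      exact: (csm_mul oU Uc' chi_sm ((smoothC_csm _ _).1 sf c' Ac')).
    split; last exact: csmR_cst.
    apply: (csmR_eq oU Uc') (csmR_plateau oU Uc' e (f := fun p => dist2 (cmap c p)) _).
      by move=> q [cq _]; rewrite chi_in.
    apply: (csmR_sum oU Uc') => k.
    have sk : csmR c' (cdom c `&` cdom c') (fun q => cmap c q 0 k - x0 0 k).
      have [/(_ c' Ac') sk _] := smoothC_coord k Ac.
      have sk' : csmR c' (cdom c `&` cdom c') (fun q => cmap c q 0 k) by exact: sk.
      by apply: (csmR_add oU Uc' sk'); exact: csmR_cst.
    exact: (csmR_mul oU Uc' sk sk).
  have oU : open (~` (cinv c @` K) `&` cdom c').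
    by apply: openI; [exact: closed_openC | exact: cdom_open].
  exists (~` (cinv c @` K) `&` cdom c'); split=> //.
  + by split=> // -[x Kx xp]; apply: ncp; have [q cq qx] := Kim _ Kx;
      rewrite -xp -qx cmapK.
  + have Uc' : ~` (cinv c @` K) `&` cdom c' `<=` cdom c' by move=> ? [].
    apply: (csm_eq oU Uc' _ (csm_cst c' _ 0)).
    by move=> q [nK _]; rewrite chi0 // mul0r.
Qed.

End SmoothFunctions.

(** * Jets and functionals of finite order at a point *)

(** The chart enters only through the Leibniz rule, the commutation of the
    partial derivatives and the coordinates [x] centered at [q]. *)
Section Jets.
Variables (C : numFieldType) (T : Type) (m : nat) (W : T -> Prop) (q : T).
Variables (sm : (T -> C) -> Prop) (pd : 'I_m -> (T -> C) -> T -> C).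
Variable x : 'I_m -> T -> C.
Implicit Types (f g : T -> C) (s : seq 'I_m).
Hypothesis Wq : W q.
Hypothesis sm_cst : forall a, sm (fun=> a).
Hypothesis sm_add : forall f g, sm f -> sm g -> sm (fun p => f p + g p).
Hypothesis sm_mul : forall f g, sm f -> sm g -> sm (fun p => f p * g p).
Hypothesis sm_pd : forall i f, sm f -> sm (pd i f).
Hypothesis sm_x : forall i, sm (x i).
Hypothesis pd_eq : forall i f g p,
  (forall p, W p -> f p = g p) -> W p -> pd i f p = pd i g p.
Hypothesis pd_cst : forall i a p, W p -> pd i (fun=> a) p = 0.
Hypothesis pd_add : forall i f g p, sm f -> sm g -> W p ->
  pd i (fun p => f p + g p) p = pd i f p + pd i g p.
Hypothesis pd_mul : forall i f g p, sm f -> sm g -> W p ->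
  pd i (fun p => f p * g p) p = pd i f p * g p + f p * pd i g p.
Hypothesis pd_commute : forall i j f p, sm f -> W p ->
  pd i (pd j f) p = pd j (pd i f) p.
Hypothesis pd_x : forall i j p, W p -> pd j (x i) p = (j == i)%:R.
Hypothesis x_q : forall i, x i q = 0.

Lemma sm_scale (a : C) f : sm f -> sm (fun p => a * f p).
Proof. by move=> sf; exact: sm_mul (sm_cst a) sf. Qed.

Lemma sm_sum (I : Type) (r : seq I) (f : I -> T -> C) :
  (forall i, sm (f i)) -> sm (fun p => \sum_(i <- r) f i p).
Proof.
move=> sf; elim: r => [|i r IH].
  by under eq_fun do rewrite big_nil; exact: sm_cst.
by under eq_fun do rewrite big_cons; exact: sm_add.
Qed.

Lemma sm_sub f g : sm f -> sm g -> sm (fun p => f p - g p).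
Proof.
by move=> sf /(sm_scale (-1)) sg; under eq_fun do rewrite -mulN1r; exact: sm_add.
Qed.

Lemma pd_scale i (a : C) f p : sm f -> W p ->
  pd i (fun p => a * f p) p = a * pd i f p.
Proof.
by move=> sf Wp; rewrite (pd_mul i (sm_cst a) sf Wp) pd_cst // mul0r add0r.
Qed.

Lemma pd_sum (I : Type) (r : seq I) (f : I -> T -> C) i p :
  (forall k, sm (f k)) -> W p ->
  pd i (fun p => \sum_(k <- r) f k p) p = \sum_(k <- r) pd i (f k) p.
Proof.
move=> sf Wp; elim: r => [|k r IH].
  by under eq_fun do rewrite big_nil; rewrite big_nil pd_cst.
under eq_fun do rewrite big_cons.
by rewrite big_cons -IH -pd_add //; exact: sm_sum.
Qed.

Definition ipd s f : T -> C := foldr (fun i g => pd i g) f s.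

Definition vanish k f : Prop := forall s, (size s < k)%N -> ipd s f q = 0.

Lemma ipd_rcons s i f : ipd (rcons s i) f = ipd s (pd i f).
Proof. by rewrite /ipd foldr_rcons. Qed.

Lemma sm_ipd s f : sm f -> sm (ipd s f).
Proof. by move=> sf; elim: s => [//|i s IH]; exact: (sm_pd i IH). Qed.

Lemma ipd_eq s f g p : (forall p, W p -> f p = g p) -> W p ->
  ipd s f p = ipd s g p.
Proof.
move=> fg; elim: s p => [|i s IH] p Wp /=; first exact: fg.
by apply: (pd_eq i _ Wp) => p' Wp'; exact: IH.
Qed.

Lemma ipd_add s f g p : sm f -> sm g -> W p ->
  ipd s (fun p => f p + g p) p = ipd s f p + ipd s g p.
Proof.
move=> sf sg; elim: s p => [|i s IH] p Wp //=.
rewrite -(pd_add i (sm_ipd s sf) (sm_ipd s sg) Wp).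
by apply: (pd_eq i _ Wp) => p' Wp'; exact: IH.
Qed.

Lemma ipd_scale s (a : C) f p : sm f -> W p ->
  ipd s (fun p => a * f p) p = a * ipd s f p.
Proof.
move=> sf; elim: s p => [|i s IH] p Wp //=.
rewrite -(pd_scale i a (sm_ipd s sf) Wp).
by apply: (pd_eq i _ Wp) => p' Wp'; exact: IH.
Qed.

Lemma vanish_eq k f g : (forall p, W p -> f p = g p) -> vanish k f -> vanish k g.
Proof. by move=> fg vf s sk; rewrite -(ipd_eq s fg) // vf. Qed.

Lemma vanish_le k l f : (l <= k)%N -> vanish k f -> vanish l f.
Proof. by move=> lk vf s sl; apply: vf; exact: leq_trans lk. Qed.

Lemma vanish_add k f g : sm f -> sm g ->
  vanish k f -> vanish k g -> vanish k (fun p => f p + g p).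
Proof. by move=> sf sg vf vg s sk; rewrite ipd_add // vf // vg // addr0. Qed.

Lemma vanish_scale k (a : C) f : sm f -> vanish k f ->
  vanish k (fun p => a * f p).
Proof. by move=> sf vf s sk; rewrite ipd_scale // vf // mulr0. Qed.

Lemma vanish_cst0 k : vanish k (fun=> 0).
Proof.
move=> s _; suff: forall p, W p -> ipd s (fun=> 0) p = 0 by exact.
elim: s => //= i s IH p Wp.
by rewrite (pd_eq i (g := fun=> 0) IH Wp) pd_cst.
Qed.

Lemma vanish_sum k (I : Type) (r : seq I) (f : I -> T -> C) :
  (forall i, sm (f i)) -> (forall i, vanish k (f i)) ->
  vanish k (fun p => \sum_(i <- r) f i p).
Proof.
move=> sf vf; elim: r => [|i r IH].
  by apply: (vanish_eq _ (@vanish_cst0 k)) => p _; rewrite big_nil.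
apply: (vanish_eq (f := fun p => f i p + \sum_(j <- r) f j p)).
  by move=> p _; rewrite big_cons.
apply: vanish_add => //; exact: sm_sum.
Qed.

Lemma vanish_pd k i f : vanish k f -> vanish k.-1 (pd i f).
Proof.
move=> vf s sk; rewrite -ipd_rcons; apply: vf; rewrite size_rcons.
by case: k sk.
Qed.

(** By the Leibniz rule, one derivative lowers the order of one of the two
    factors by one. *)
Lemma vanish_mul a b f g : sm f -> sm g ->
  vanish a f -> vanish b g -> vanish (a + b) (fun p => f p * g p).
Proof.
move=> sf sg va vb s; elim/last_ind: s a b f g sf sg va vb.
  move=> a b f g _ _ va vb /= ab.
  have [a0|a0] := posnP a; last by rewrite [f q](va [::]) ?mul0r.
  by rewrite [g q](vb [::]) ?mulr0 // -[X in (_ < X)%N]add0n -a0.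
move=> s i IH a b f g sf sg va vb; rewrite size_rcons => sab.
rewrite ipd_rcons.
pose fg p := pd i f p * g p + f p * pd i g p.
rewrite (ipd_eq s (g := fg)) //; last by move=> p Wp; rewrite (pd_mul).
have sdf := sm_pd i sf; have sdg := sm_pd i sg.
rewrite (ipd_add s (sm_mul sdf sg) (sm_mul sf sdg) Wq).
have h1 : (size s < a.-1 + b)%N by case: a sab {va} => [/ltnW|a]; rewrite // addSn ltnS.
have h2 : (size s < a + b.-1)%N by case: b sab {vb h1} => [/ltnW|b]; rewrite // addnS ltnS.
rewrite (IH _ _ _ _ sdf sg (vanish_pd i va) vb h1).
by rewrite (IH _ _ _ _ sf sdg va (vanish_pd i vb) h2) addr0.
Qed.

Definition euler f (p : T) : C := \sum_(i < m) x i p * pd i f p.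

Lemma sm_euler f : sm f -> sm (euler f).
Proof.
by move=> sf; apply: sm_sum => i; exact: sm_mul (sm_x i) (sm_pd i sf).
Qed.

(** The commutator of a partial derivative with the Euler field is that partial
    derivative, so each derivative on the left contributes one summand, and the
    Euler field vanishes at [q]. *)
Lemma ipd_euler s f : sm f -> ipd s (euler f) q = (size s)%:R * ipd s f q.
Proof.
elim/last_ind: s f => [|s j IH] f sf.
  rewrite mul0r /= /euler big1 // => i _.
  by rewrite x_q mul0r.
have sdf i := sm_pd i sf.
rewrite !ipd_rcons size_rcons.
rewrite (ipd_eq s (g := fun p => pd j f p + euler (pd j f) p)) //.
  rewrite ipd_add //; last exact: sm_euler.
  by rewrite IH // -[_.+1]addn1 natrD mulrDl mul1r addrC.
move=> p Wp; rewrite /euler.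
rewrite (pd_sum _ (f := fun i p => x i p * pd i f p)) //; last first.
  by move=> i; apply: sm_mul => //; exact: sm_x.
have E i : pd j (fun p => x i p * pd i f p) p =
    (j == i)%:R * pd i f p + x i p * pd i (pd j f) p.
  rewrite (pd_mul j (sm_x i) (sdf i) Wp) pd_x //.
  by rewrite (pd_commute i j sf Wp).
under eq_bigr do rewrite E.
rewrite big_split /=; congr (_ + _).
rewrite (bigD1 j) //= eqxx mul1r big1 ?addr0 // => i ij.
by rewrite eq_sym (negbTE ij) mul0r.
Qed.

Lemma vanish_euler k f : sm f -> vanish k f ->
  vanish k.+1 (fun p => k%:R * f p - euler f p).
Proof.
move=> sf vf s sk; have se := sm_euler sf.
have skf := sm_scale k%:R sf.
have -> : (fun p => k%:R * f p - euler f p) =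
          (fun p => k%:R * f p + -1 * euler f p).
  by apply/funext => p; rewrite mulN1r.
rewrite ipd_add //; last exact: sm_scale.
rewrite !ipd_scale // ipd_euler // mulN1r -mulrBl.
move: sk; rewrite ltnS leq_eqVlt => /orP[/eqP ->|sk]; first by rewrite subrr mul0r.
by rewrite vf // mulr0.
Qed.

(** ** Functionals killing the multiples of a family of functions *)

Section Functionals.
Variable gl : (T -> C) -> Prop.
Hypothesis gl_cst : forall a, gl (fun=> a).
Hypothesis gl_add : forall f g, gl f -> gl g -> gl (fun p => f p + g p).
Hypothesis gl_mul : forall f g, gl f -> gl g -> gl (fun p => f p * g p).
Variables (N : nat) (w : 'I_N -> T -> C) (th : 'I_N -> (T -> C) -> T -> C).
Variable WW : (T -> C) -> Prop.
Hypothesis w_smooth : forall j, gl (w j).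
Hypothesis w_q : forall j, w j q = 0.
Hypothesis WW_sm : forall f, WW f -> sm f.
Hypothesis WW_cst : forall a, WW (fun=> a).
Hypothesis WW_add : forall f g, WW f -> WW g -> WW (fun p => f p + g p).
Hypothesis WW_mul : forall f g, WW f -> WW g -> WW (fun p => f p * g p).
Hypothesis WW_w : forall j, WW (w j).
Hypothesis WW_th : forall j f, WW f -> WW (th j f).
Hypothesis th_vanish : forall j k f, WW f -> vanish k f -> vanish k.-1 (th j f).
Hypothesis th_euler : forall k f, WW f -> vanish k f ->
  vanish k.+1 (fun p => k%:R * f p - \sum_(j < N) w j p * th j f p).

Let gl_scale a f : gl f -> gl (fun p => a * f p).
Proof. by move=> sf; exact: gl_mul (gl_cst a) sf. Qed.

Let gl_sum (I : Type) (r : seq I) (f : I -> T -> C) : (forall i, gl (f i)) ->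
  gl (fun p => \sum_(i <- r) f i p).
Proof.
move=> wf; elim: r => [|i r IH].
  by under eq_fun do rewrite big_nil; exact: gl_cst.
by under eq_fun do rewrite big_cons; exact: gl_add.
Qed.

Let WW_sum (I : Type) (r : seq I) (f : I -> T -> C) : (forall i, WW (f i)) ->
  WW (fun p => \sum_(i <- r) f i p).
Proof.
move=> wf; elim: r => [|i r IH].
  by under eq_fun do rewrite big_nil; exact: WW_cst.
by under eq_fun do rewrite big_cons; exact: WW_add.
Qed.

Let WW_sub f g : WW f -> WW g -> WW (fun p => f p - g p).
Proof.
move=> wf wg; under eq_fun do rewrite -mulN1r.
by apply: WW_add => //; exact: (WW_mul (WW_cst (-1)) wg).
Qed.

(** Dividing the Euler identity by the order [k.+1] writes the leading part as
    [sum_j w j * th j f]; the functions [th j f] are only defined near [q], but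
    their leading parts, of one order less, may be replaced by global functions
    by induction. *)
Lemma leading_part k f : WW f -> vanish k f -> exists P,
  [/\ gl P, WW P, vanish k.+1 (fun p => f p - P p) &
    (0 < k)%N -> exists Q : 'I_N -> T -> C, (forall j, gl (Q j)) /\
      P = (fun p => \sum_(j < N) w j p * Q j p)].
Proof.
elim: k f => [|k IH] f wf vf.
  exists (fun=> f q); split=> //.
  by case=> // _; rewrite /= subrr.
have /choice[P HP] j : exists P,
    [/\ gl P, WW P & vanish k.+1 (fun p => th j f p - P p)].
  have := th_vanish j wf vf; rewrite /= => /(IH _ (WW_th j wf))[P [? ? ? _]].
  by exists P.
pose b : C := k.+1%:R^-1.
have b0 : k.+1%:R != 0 :> C by rewrite pnatr_eq0.
pose Q j p := b * P j p.
have sP j : gl (P j) by have [] := HP j.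
have wP j : WW (P j) by have [] := HP j.
have vP j : vanish k.+1 (fun p => th j f p - P j p) by have [] := HP j.
have sQ j : gl (Q j) by apply: gl_scale.
have wQ j : WW (Q j) by exact: (WW_mul (WW_cst b) (wP j)).
exists (fun p => \sum_(j < N) w j p * Q j p); split.
- by apply: gl_sum => j; exact: gl_mul.
- by apply: WW_sum => j; exact: (WW_mul (WW_w j) (wQ j)).
- pose e0 p := k.+1%:R * f p - \sum_(j < N) w j p * th j f p.
  pose e1 p := \sum_(j < N) w j p * (th j f p - P j p).
  have wd j : WW (fun p => th j f p - P j p) by exact: WW_sub (WW_th j wf) (wP j).
  have we1 : WW e1 by apply: WW_sum => j; exact: (WW_mul (WW_w j) (wd j)).
  have we0 : WW e0.
    apply: WW_sub; first exact: (WW_mul (WW_cst _) wf).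
    by apply: WW_sum => j; exact: (WW_mul (WW_w j) (WW_th j wf)).
  apply: (vanish_eq (f := fun p => b * e0 p + b * e1 p)).
    move=> p _; rewrite -mulrDr /e0 /e1.
    under [X in b * (_ + X)]eq_bigr do rewrite mulrBr.
    rewrite sumrB addrA subrK mulrBr mulrA mulVf // mul1r mulr_sumr.
    by congr (_ - _); apply: eq_bigr => j _; rewrite /Q mulrCA.
  apply: vanish_add.
  + exact/WW_sm/(WW_mul (WW_cst b) we0).
  + exact/WW_sm/(WW_mul (WW_cst b) we1).
  + by apply: vanish_scale; [exact: WW_sm | exact: th_euler].
  + apply: vanish_scale; first exact: WW_sm.
    apply: vanish_sum => j; first exact/WW_sm/(WW_mul (WW_w j) (wd j)).
    rewrite -add1n; apply: vanish_mul => //; try exact: WW_sm.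
    by case=> //= _; exact: w_q.
- by move=> _; exists Q.
Qed.

Variables (D : (T -> C) -> C) (d : nat).
Hypothesis D_lin : forall a f g, gl f -> gl g ->
  D (fun p => f p + a * g p) = D f + a * D g.
Hypothesis D_order : forall f, gl f -> vanish d f -> D f = 0.
Hypothesis D_w : forall j g, gl g -> D (fun p => w j p * g p) = 0.

Let D0 : D (fun=> 0) = 0.
Proof. by apply: D_order; [exact: gl_cst | exact: vanish_cst0]. Qed.

Let D_sum (I : Type) (r : seq I) (f : I -> T -> C) :
  (forall i, gl (f i)) ->
  D (fun p => \sum_(i <- r) f i p) = \sum_(i <- r) D (f i).
Proof.
move=> sf; elim: r => [|i r IH].
  by rewrite big_nil; under eq_fun do rewrite big_nil.
have ss : gl (fun p => \sum_(j <- r) f j p).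
  by apply: gl_sum => //.
rewrite big_cons -IH -[X in _ + X]mul1r -D_lin //; congr D.
by apply/funext => p; rewrite big_cons mul1r.
Qed.

(** The leading parts are removed one by one until the order of vanishing
    exceeds the order of the functional. *)
Lemma functional_value f : gl f -> WW f -> D f = f q * D (fun=> 1).
Proof.
suff kill n k g : (d <= n + k.+1)%N -> gl g -> WW g ->
    vanish k.+1 g -> D g = 0.
  move=> sf wf; pose g p := f p + (- f q) * 1.
  have sg : gl g.
    by exact: gl_add sf (gl_cst _).
  have wg : WW g by apply: WW_add => //; exact: (WW_cst (- f q * 1)).
  have : D g = 0.
    apply: (kill d 0%N) => //; first by rewrite leq_addr.
    by case=> // _; rewrite /= /g mulr1 subrr.
  rewrite /g D_lin //.
  by move/eqP; rewrite mulNr subr_eq0 => /eqP.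
elim: n k g => [|n IH] k g dn sg wg vg.
  by apply: D_order => //; exact: vanish_le vg.
have [P [sP wP vP /(_ isT)[Q [sQ PQ]]]] := leading_part wg vg.
have DP : D P = 0.
  rewrite PQ D_sum; first by rewrite big1 // => j _; exact: D_w.
  by move=> j; apply: gl_mul => //.
have := @D_lin (-1) g P sg sP; rewrite DP mulr0 addr0 => <-.
have E : (fun p => g p + -1 * P p) = (fun p => g p - P p).
  by apply/funext => p; rewrite mulN1r.
rewrite E; apply: (IH k.+1) => //.
- by rewrite addnS -addSn.
- by rewrite -E; apply: gl_add => //; exact: gl_scale.
- exact: WW_sub.
Qed.

End Functionals.

(** Functions with independent differentials at [q] have, modulo second order,
    the same multiples as the coordinates. *)
Lemma functional_value_independent (gl : (T -> C) -> Prop)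
    (w : 'I_m -> T -> C) (D : (T -> C) -> C) (d : nat) :
  (forall a, gl (fun=> a)) ->
  (forall f g, gl f -> gl g -> gl (fun p => f p + g p)) ->
  (forall f g, gl f -> gl g -> gl (fun p => f p * g p)) ->
  (forall f, gl f -> sm f) ->
  (forall j, gl (w j)) -> (forall j, w j q = 0) ->
  (\matrix_(j < m, k < m) pd k (w j) q) \in unitmx ->
  (forall a f g, gl f -> gl g -> D (fun p => f p + a * g p) = D f + a * D g) ->
  (forall f, gl f -> vanish d f -> D f = 0) ->
  (forall j g, gl g -> D (fun p => w j p * g p) = 0) ->
  forall f, gl f -> D f = f q * D (fun=> 1).
Proof.
move=> gl_cst gl_add gl_mul gl_sm w_gl w_q; set J := \matrix_(j, k) _ => uJ.
move=> D_lin D_order D_w f gf.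
have sw j : sm (w j) by exact: gl_sm.
pose th j f p := \sum_(i < m) invmx J i j * pd i f p.
have sth j g : sm g -> sm (th j g).
  by move=> sg; apply: sm_sum => i; apply: sm_scale; exact: sm_pd.
apply: (@functional_value gl gl_cst gl_add gl_mul m w th sm) (D_w) f gf (gl_sm f gf) => //.
  move=> j k g sg vg; apply: vanish_sum => i.
    by apply: sm_scale; exact: sm_pd.
  by apply: vanish_scale; [exact: sm_pd | exact: vanish_pd].
move=> k g sg vg.
pose y i p := x i p - \sum_(j < m) invmx J i j * w j p.
have sy i : sm (y i).
  by apply: sm_sub => //; apply: sm_sum => j; exact: sm_scale.
have vy i : vanish 2 (y i).
  case=> [|l [|l' s]] //= _.
    rewrite /y x_q big1 ?subr0 // => j _.
    by rewrite w_q mulr0.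
  rewrite /y; under [fun p => _]eq_fun do rewrite -mulN1r.
  rewrite pd_add //; last first.
    by apply: sm_scale; apply: sm_sum => j; exact: sm_scale.
  rewrite pd_scale //; last by apply: sm_sum => j; exact: sm_scale.
  rewrite pd_sum //; last by move=> j; exact: sm_scale.
  rewrite pd_x // mulN1r; apply/eqP; rewrite subr_eq0; apply/eqP.
  have := congr1 (fun A : 'M[C]_m => A i l) (mulVmx uJ).
  rewrite !mxE eq_sym => <-; apply: eq_bigr => j _.
  by rewrite pd_scale // !mxE.
pose e p := k%:R * g p - euler g p.
pose r p := \sum_(i < m) y i p * pd i g p.
apply: (vanish_eq (f := fun p => e p + r p)).
  move=> p _; rewrite /e /r /y /euler.
  under [X in _ + X]eq_bigr do rewrite mulrBl mulr_suml.
  rewrite sumrB addrA subrK; congr (_ - _).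
  rewrite exchange_big /=; apply: eq_bigr => j _.
  by rewrite /th mulr_sumr; apply: eq_bigr => i _; rewrite mulrCA mulrA.
apply: vanish_add.
- by apply: sm_sub; [exact: sm_scale | exact: sm_euler].
- by apply: sm_sum => i; apply: sm_mul => //; exact: sm_pd.
- exact: vanish_euler.
- apply: vanish_sum => i; first by apply: sm_mul => //; exact: sm_pd.
  apply: (@vanish_le (2 + k.-1)); first by case: (k).
  by apply: vanish_mul => //; [exact: sm_pd | exact: vanish_pd].
exact: D_order.
Qed.

End Jets.

(** * Holomorphic jets *)

Section HolomorphicJets.
Variables (C : numFieldType) (T : Type) (n : nat) (W : T -> Prop) (q : T).
Variables (sm : (T -> C) -> Prop) (pd : 'I_(n + n) -> (T -> C) -> T -> C).
Variable x : 'I_(n + n) -> T -> C.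
Variable ii : C.
Hypothesis ii2 : ii * ii = -1.
Implicit Types (f g : T -> C) (s : seq 'I_(n + n)).
Hypothesis Wq : W q.
Hypothesis sm_cst : forall a, sm (fun=> a).
Hypothesis sm_add : forall f g, sm f -> sm g -> sm (fun p => f p + g p).
Hypothesis sm_mul : forall f g, sm f -> sm g -> sm (fun p => f p * g p).
Hypothesis sm_pd : forall i f, sm f -> sm (pd i f).
Hypothesis sm_x : forall i, sm (x i).
Hypothesis pd_eq : forall i f g p,
  (forall p, W p -> f p = g p) -> W p -> pd i f p = pd i g p.
Hypothesis pd_cst : forall i a p, W p -> pd i (fun=> a) p = 0.
Hypothesis pd_add : forall i f g p, sm f -> sm g -> W p ->
  pd i (fun p => f p + g p) p = pd i f p + pd i g p.
Hypothesis pd_mul : forall i f g p, sm f -> sm g -> W p ->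
  pd i (fun p => f p * g p) p = pd i f p * g p + f p * pd i g p.
Hypothesis pd_commute : forall i j f p, sm f -> W p ->
  pd i (pd j f) p = pd j (pd i f) p.
Hypothesis pd_x : forall i j p, W p -> pd j (x i) p = (j == i)%:R.
Hypothesis x_q : forall i, x i q = 0.

(** [wirt (- ii)] and [wirt ii] are the Wirtinger derivatives in the complex
    coordinates and in their conjugates. *)
Definition wirt (a : C) (l : 'I_n) f (p : T) : C :=
  2^-1 * (pd (lshift n l) f p + a * pd (rshift n l) f p).

Lemma sm_wirt a l f : sm f -> sm (wirt a l f).
Proof.
move=> sf; apply: (sm_mul (sm_cst _)); apply: sm_add; first exact: sm_pd.
by apply: (sm_mul (sm_cst _)); exact: sm_pd.
Qed.

Lemma wirt_eq a l f g p : (forall p, W p -> f p = g p) -> W p ->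
  wirt a l f p = wirt a l g p.
Proof.
by move=> fg Wp; rewrite /wirt (pd_eq _ fg Wp) (pd_eq (rshift n l) fg Wp).
Qed.

Lemma wirt_cst a l b p : W p -> wirt a l (fun=> b) p = 0.
Proof. by move=> Wp; rewrite /wirt !pd_cst // mulr0 addr0 mulr0. Qed.

Lemma wirt_add a l f g p : sm f -> sm g -> W p ->
  wirt a l (fun p => f p + g p) p = wirt a l f p + wirt a l g p.
Proof. by move=> sf sg Wp; rewrite /wirt !pd_add //; ring. Qed.

Lemma wirt_mul a l f g p : sm f -> sm g -> W p ->
  wirt a l (fun p => f p * g p) p = wirt a l f p * g p + f p * wirt a l g p.
Proof. by move=> sf sg Wp; rewrite /wirt !pd_mul //; ring. Qed.

Lemma wirt_commute a b k l f p : sm f -> W p ->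
  wirt a k (wirt b l f) p = wirt b l (wirt a k f) p.
Proof.
move=> sf Wp.
have E i b' l' : pd i (wirt b' l' f) p =
    2^-1 * (pd i (pd (lshift n l') f) p + b' * pd i (pd (rshift n l') f) p).
  have h1 := sm_pd (lshift n l') sf; have h2 := sm_pd (rshift n l') sf.
  have h3 := sm_mul (sm_cst b') h2.
  rewrite (pd_mul i (sm_cst 2^-1) (sm_add h1 h3) Wp) pd_cst // mul0r add0r.
  by rewrite pd_add // (pd_mul i (sm_cst b') h2 Wp) pd_cst // mul0r add0r.
rewrite {1}/wirt !E {1}/wirt !E.
rewrite (pd_commute (lshift n k) (lshift n l) sf Wp).
rewrite (pd_commute (rshift n k) (lshift n l) sf Wp).
rewrite (pd_commute (lshift n k) (rshift n l) sf Wp).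
rewrite (pd_commute (rshift n k) (rshift n l) sf Wp).
by ring.
Qed.

Lemma wirt_coord a b k l p : W p ->
  wirt a k (fun p => x (lshift n l) p + b * x (rshift n l) p) p =
  2^-1 * (1 + a * b) * (k == l)%:R.
Proof.
move=> Wp; rewrite /wirt !pd_add //; try exact: (sm_mul (sm_cst b)).
rewrite !(pd_mul _ (sm_cst b) (sm_x _) Wp) !pd_cst // !mul0r !add0r !pd_x //.
rewrite !(inj_eq (@lshift_inj n n)) !(inj_eq (@rshift_inj n n)).
rewrite eq_lrshift eq_rlshift mulr0n.
by move: (k == l)%:R => e; ring.
Qed.

Lemma euler_wirt f p : euler pd x f p = \sum_(l < n)
  ((x (lshift n l) p + ii * x (rshift n l) p) * wirt (- ii) l f p +
   (x (lshift n l) p - ii * x (rshift n l) p) * wirt ii l f p).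
Proof.
rewrite /euler big_split_ord /= -big_split /=; apply: eq_bigr => l _.
rewrite /wirt; set a := x _ p; set b := x _ p; set u := pd _ f p; set v := pd _ f p.
have -> : (a + ii * b) * (2^-1 * (u + - ii * v)) +
   (a - ii * b) * (2^-1 * (u + ii * v)) = a * u - ii * ii * (b * v) by field.
by rewrite ii2 mulN1r opprK.
Qed.

(** The jet of a holomorphic function is a polynomial in the holomorphic
    coordinates alone. *)
Lemma functional_value_holomorphic (gl : (T -> C) -> Prop)
    (w : 'I_n -> T -> C) (D : (T -> C) -> C) (d : nat) :
  (forall a, gl (fun=> a)) ->
  (forall f g, gl f -> gl g -> gl (fun p => f p + g p)) ->
  (forall f g, gl f -> gl g -> gl (fun p => f p * g p)) ->
  (forall f, gl f -> sm f) ->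
  (forall j, gl (w j)) ->
  (forall j p, W p -> w j p = x (lshift n j) p + ii * x (rshift n j) p) ->
  (forall a f g, gl f -> gl g -> D (fun p => f p + a * g p) = D f + a * D g) ->
  (forall f, gl f -> vanish q pd d f -> D f = 0) ->
  (forall j g, gl g -> D (fun p => w j p * g p) = 0) ->
  forall f, gl f -> (forall l p, W p -> wirt ii l f p = 0) ->
  D f = f q * D (fun=> 1).
Proof.
move=> gl_cst gl_add gl_mul gl_sm w_gl wE D_lin D_order D_w f gf hf.
pose hol g := sm g /\ forall l p, W p -> wirt ii l g p = 0.
apply: (@functional_value C T _ W q sm pd Wq sm_cst sm_add sm_mul sm_pd
  pd_eq pd_cst pd_add pd_mul gl gl_cst gl_add gl_mul n w (wirt (- ii)) hol _ _ _ _ _ _ _ _ _ _ D d D_lin D_order D_w) => //.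
- by move=> j; rewrite wE // !x_q mulr0 addr0.
- by move=> g [].
- by move=> a; split=> // l p; exact: wirt_cst.
- move=> g h [sg hg] [sh hh]; split; first exact: sm_add.
  by move=> l p Wp; rewrite wirt_add // hg // hh // addr0.
- move=> g h [sg hg] [sh hh]; split; first exact: sm_mul.
  by move=> l p Wp; rewrite wirt_mul // hg // hh // mul0r mulr0 addr0.
- move=> j; split; first exact: gl_sm.
  move=> l p Wp; rewrite (wirt_eq _ _ (wE j) Wp) wirt_coord // ii2.
  by rewrite subrr mulr0 mul0r.
- move=> j g [sg hg]; split; first exact: sm_wirt.
  move=> l p Wp; rewrite wirt_commute //.
  by rewrite (wirt_eq _ _ (g := fun=> 0) (hg l)) // wirt_cst.
- move=> j k g [sg _] vg.
  have s1 := sm_pd (lshift n j) sg; have s2 := sm_pd (rshift n j) sg.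
  have v1 := vanish_pd (lshift n j) vg; have v2 := vanish_pd (rshift n j) vg.
  have s3 := sm_mul (sm_cst (- ii)) s2.
  apply: (vanish_scale Wq sm_cst sm_pd pd_eq pd_cst pd_mul _ (sm_add s1 s3)).
  apply: (vanish_add Wq sm_pd pd_eq pd_add) => //.
  exact: (vanish_scale Wq sm_cst sm_pd pd_eq pd_cst pd_mul).
- move=> k g [sg hg] vg.
  apply: (vanish_eq Wq pd_eq _ (vanish_euler Wq sm_cst sm_add sm_mul sm_pd sm_x
    pd_eq pd_cst pd_add pd_mul pd_commute pd_x x_q sg vg)).
  move=> p Wp; rewrite euler_wirt; congr (_ - _); apply: eq_bigr => l _.
  by rewrite hg // mulr0 addr0 wE.
- by split=> //; exact: gl_sm.
Qed.

End HolomorphicJets.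

(** * Formal products *)

Section FormalProducts.
Variables (C : numFieldType) (T : Type).
Implicit Types (f g h : T -> C) (F G H : nat -> T -> C).
Implicit Type B : nat -> (T -> C) -> (T -> C) -> T -> C.

Definition pstar B F H : nat -> T -> C := fun r p =>
  \sum_(a < r.+1) \sum_(b < (r - a).+1) B a (F b) (H (r - a - b)%N) p.

Definition pconst f : nat -> T -> C := fun r => if r is 0%N then f else fun=> 0.

Definition pnu a : nat -> T -> C := fun r _ => if r == 1%N then a else 0.

Lemma pstar_rev B F H r p :
  pstar B F H r p = pstar (fun r f h => B r h f) H F r p.
Proof.
apply: eq_bigr => a _; rewrite (reindex_inj rev_ord_inj) /=.
by apply: eq_bigr => b _; rewrite subSS subKn // -ltnS.
Qed.

End FormalProducts.

(** * Products of Wick type on a coordinate neighbourhood *)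

Section LocalWick.
Variables (C : numFieldType) (T : Type) (n : nat) (W : T -> Prop).
Variables (sm gl : (T -> C) -> Prop) (pd : 'I_(n + n) -> (T -> C) -> T -> C).
Variable X : 'I_(n + n) -> T -> C.
Implicit Types (f g h : T -> C) (F G H : nat -> T -> C).

(** Calculus on [W]: [sm] are the functions smooth on [W], [gl] those smooth
    everywhere, [X] the real coordinates. *)
Record calculus : Prop := Calculus {
  sm_cst : forall a, sm (fun=> a);
  sm_add : forall f g, sm f -> sm g -> sm (fun p => f p + g p);
  sm_mul : forall f g, sm f -> sm g -> sm (fun p => f p * g p);
  sm_pd : forall i f, sm f -> sm (pd i f);
  sm_X : forall i, sm (X i);
  pd_eq : forall i f g p,
    (forall p, W p -> f p = g p) -> W p -> pd i f p = pd i g p;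
  pd_cst : forall i a p, W p -> pd i (fun=> a) p = 0;
  pd_add : forall i f g p, sm f -> sm g -> W p ->
    pd i (fun p => f p + g p) p = pd i f p + pd i g p;
  pd_mul : forall i f g p, sm f -> sm g -> W p ->
    pd i (fun p => f p * g p) p = pd i f p * g p + f p * pd i g p;
  pd_commute : forall i j f p, sm f -> W p ->
    pd i (pd j f) p = pd j (pd i f) p;
  pd_X : forall i j p, W p -> pd j (X i) p = (j == i)%:R;
  gl_cst : forall a, gl (fun=> a);
  gl_add : forall f g, gl f -> gl g -> gl (fun p => f p + g p);
  gl_mul : forall f g, gl f -> gl g -> gl (fun p => f p * g p);
  gl_sm : forall f, gl f -> sm f }.

Hypothesis cal : calculus.

Let x q i p := X i p - X i q.

Let sm_x q i : sm (x q i).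
Proof. exact: (sm_add cal (sm_X cal i) (sm_cst cal (- X i q))). Qed.

Let pd_x q i j p : W p -> pd j (x q i) p = (j == i)%:R.
Proof.
move=> Wp; rewrite (pd_add cal j (sm_X cal i) (sm_cst cal (- X i q)) Wp).
by rewrite (pd_cst cal) // addr0 (pd_X cal).
Qed.

Let x_q q i : x q i q = 0. Proof. exact: subrr. Qed.

Lemma gl_scale a f : gl f -> gl (fun p => a * f p).
Proof. by move=> gf; exact: (gl_mul cal (gl_cst cal a) gf). Qed.

Lemma gl_sub f g : gl f -> gl g -> gl (fun p => f p - g p).
Proof.
by move=> gf /(gl_scale (-1)) gg; under eq_fun do rewrite -mulN1r; exact: (gl_add cal).
Qed.

Lemma gl_sum (I : Type) (r : seq I) (f : I -> T -> C) : (forall i, gl (f i)) ->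
  gl (fun p => \sum_(i <- r) f i p).
Proof.
move=> wf; elim: r => [|i r IH].
  by under eq_fun do rewrite big_nil; exact: (gl_cst cal).
by under eq_fun do rewrite big_cons; exact: (gl_add cal).
Qed.

Section Products.
Variables (ii : C) (z zb : 'I_n -> T -> C).

Record coordinates : Prop := Coordinates {
  ii2 : ii * ii = -1;
  z_gl : forall l, gl (z l);
  zb_gl : forall l, gl (zb l);
  zE : forall l p, W p -> z l p = X (lshift n l) p + ii * X (rshift n l) p;
  zbE : forall l p, W p -> zb l p = X (lshift n l) p - ii * X (rshift n l) p }.

Hypothesis coo : coordinates.

Local Notation Z := (wirt pd (- ii)).
Local Notation Zb := (wirt pd ii).

(** A functional of finite order at [q] killing the multiples of [z - z q] and
    of [y - y q] is a multiple of the evaluation at [q] as soon as the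
    antiholomorphic derivatives of the functions [y] are independent. *)
Lemma functional_value_zy q (y : 'I_n -> T -> C) (D : (T -> C) -> C) (d : nat) :
  W q -> (forall l, gl (y l)) ->
  \matrix_(k < n, l < n) Zb l (y k) q \in unitmx ->
  (forall a f g, gl f -> gl g -> D (fun p => f p + a * g p) = D f + a * D g) ->
  (forall f, gl f -> vanish q pd d f -> D f = 0) ->
  (forall l g, gl g -> D (fun p => z l p * g p) = z l q * D g) ->
  (forall l g, gl g -> D (fun p => y l p * g p) = y l q * D g) ->
  forall f, gl f -> D f = f q * D (fun=> 1).
Proof.
move=> Wq gy uy D_lin D_order Dz Dy.
pose w (j : 'I_(n + n)) (p : T) : C := match fintype.split j with
  | inl l => z l p - z l q | inr l => y l p - y l q end.
have wl l : w (lshift n l) = (fun p => z l p - z l q).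
  by apply/funext => p; rewrite /w (unsplitK (inl l)).
have wr l : w (rshift n l) = (fun p => y l p - y l q).
  by apply/funext => p; rewrite /w (unsplitK (inr l)).
have case2 (P : (T -> C) -> Prop) (j : 'I_(n + n)) : (forall l, P (fun p => z l p - z l q)) ->
    (forall l, P (fun p => y l p - y l q)) -> P (w j).
  by move=> Pz Py; rewrite -[j]splitK; case: (fintype.split j) => l; rewrite /= ?wl ?wr.
have gz := z_gl coo.
have Dw j g : gl g -> D (fun p => w j p * g p) = 0.
  move=> gg.
  have E v : gl v -> (forall g, gl g -> D (fun p => v p * g p) = v q * D g) ->
      D (fun p => (v p - v q) * g p) = 0.
    move=> gv Dv; have -> : (fun p => (v p - v q) * g p) =
        (fun p => v p * g p + - v q * g p).
      by apply/funext => p; rewrite mulrDl.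
    rewrite D_lin //; last exact: (gl_mul cal).
    by rewrite Dv // mulNr subrr.
  by apply: (case2 (fun v => D (fun p => v p * g p) = 0)) => l; apply: E => //;
    move=> h gh; [exact: Dz | exact: Dy].
apply: (functional_value_independent Wq (sm_cst cal) (sm_add cal) (sm_mul cal)
  (sm_pd cal) (sm_x q) (pd_eq cal) (pd_cst cal) (pd_add cal) (pd_mul cal)
  (pd_commute cal) (pd_x q) (x_q q) (gl_cst cal) (gl_add cal) (gl_mul cal)
  (gl_sm cal) (w := w) _ _ _ D_lin D_order Dw).
- by move=> j; apply: case2 => l; apply: gl_sub => //; exact: (gl_cst cal).
- by move=> j; apply: (case2 (fun v => v q = 0)) => l; rewrite subrr.
- set J := \matrix_(j, k) _.
  have pdw k v a : gl v -> pd k (fun p => v p - a) q = pd k v q.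
    move=> gv; rewrite (pd_add cal k (gl_sm cal gv) (sm_cst cal (- a)) Wq).
    by rewrite (pd_cst cal) // addr0.
  pose P : 'M[C]_n := \matrix_(k, l) pd (lshift n l) (y k) q.
  pose Q : 'M[C]_n := \matrix_(k, l) pd (rshift n l) (y k) q.
  have JE : J = block_mx 1%:M ii%:M P Q.
    have pz k l : pd k (z l) q = (k == lshift n l)%:R + ii * (k == rshift n l)%:R.
      rewrite (pd_eq cal k (zE coo l) Wq).
      have s1 := sm_X cal (rshift n l); have s2 := sm_cst cal ii.
      rewrite (pd_add cal k (sm_X cal (lshift n l)) (sm_mul cal s2 s1) Wq).
      by rewrite (pd_mul cal k s2 s1 Wq) (pd_cst cal) // mul0r add0r !(pd_X cal).
    apply/matrixP => j k; rewrite mxE.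
    rewrite -[j]splitK -[k]splitK; case: (fintype.split j) => l; case: (fintype.split k) => l' /=.
    + rewrite wl pdw // pz block_mxEul mxE (inj_eq (@lshift_inj n n)).
      by rewrite eq_lrshift mulr0 addr0 eq_sym.
    + rewrite wl pdw // pz block_mxEur mxE (inj_eq (@rshift_inj n n)).
      by rewrite eq_rlshift add0r eq_sym mulr_natr.
    + by rewrite wr pdw // block_mxEdl mxE.
    + by rewrite wr pdw // block_mxEdr mxE.
  (* adding multiples of the first columns to the others turns the partial
     derivatives of the [y k] into antiholomorphic ones *)
  pose S : 'M[C]_(n + n) := block_mx 1%:M (- ii)%:M 0 1%:M.
  have JS : J *m S = block_mx 1%:M 0 P ((- ii * 2) *: \matrix_(k, l) Zb l (y k) q).
    rewrite JE mulmx_block !mulmx1 !mulmx0 !mul1mx !addr0; congr block_mx.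
      by apply/matrixP => k l; rewrite !mxE -mulrnDl addNr mul0rn.
    apply/matrixP => k l; rewrite mul_mx_scalar !mxE /wirt.
    set s := pd _ _ _; set t := pd _ _ _.
    have -> : - ii * 2 * (2^-1 * (s + ii * t)) = - ii * s - ii * ii * t by field.
    by rewrite (ii2 coo) mulN1r opprK.
  rewrite unitmxE; have : \det (J *m S) \is a GRing.unit.
    have ii0 : ii != 0.
      apply/eqP => ii0; have := ii2 coo; rewrite ii0 mul0r.
      by move/eqP; rewrite eq_sym oppr_eq0 oner_eq0.
    rewrite JS det_lblock det1 mul1r -unitmxE unitmxZ // unitfE.
    by rewrite mulf_neq0 ?oppr_eq0 // pnatr_eq0.
  by rewrite det_mulmx det_ublock !det1 !mulr1.
Qed.

(** ** The axioms of a product of Wick type *)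

Record wick_product (B : nat -> (T -> C) -> (T -> C) -> T -> C) : Prop :=
  WickProduct {
  wp_gl : forall r f g, gl f -> gl g -> gl (B r f g);
  wp_linl : forall r a f g h p, gl f -> gl g -> gl h -> W p ->
    B r (fun p => f p + a * g p) h p = B r f h p + a * B r g h p;
  wp_linr : forall r a f g h p, gl f -> gl g -> gl h -> W p ->
    B r h (fun p => f p + a * g p) p = B r h f p + a * B r h g p;
  wp_ordl : forall r g q, gl g -> W q -> exists d, forall f, gl f ->
    vanish q pd d f -> B r f g q = 0;
  wp_ordr : forall r g q, gl g -> W q -> exists d, forall f, gl f ->
    vanish q pd d f -> B r g f q = 0;
  wp_assoc : forall F G H, (forall r, gl (F r)) -> (forall r, gl (G r)) ->
    (forall r, gl (H r)) -> forall r p, W p ->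
    pstar B (pstar B F G) H r p = pstar B F (pstar B G H) r p;
  wp_C0 : forall f g p, gl f -> gl g -> W p -> B 0%N f g p = f p * g p;
  wp_cstl : forall r a f p, gl f -> W p -> B r.+1 (fun=> a) f p = 0;
  wp_cstr : forall r a f p, gl f -> W p -> B r.+1 f (fun=> a) p = 0;
  wp_z : forall r l f p, gl f -> W p -> B r.+1 f (z l) p = 0;
  wp_zb : forall r l f p, gl f -> W p -> B r.+1 (zb l) f p = 0 }.

Section OneProduct.
Variable B : nat -> (T -> C) -> (T -> C) -> T -> C.
Hypothesis wB : wick_product B.
Local Notation star := (pstar B).
Local Notation gls F := (forall r, gl (F r)).

Lemma wp_0l r h p : gl h -> W p -> B r (fun=> 0) h p = 0.
Proof.
move=> gh Wp; have g0 := gl_cst cal 0.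
have := wp_linl wB r (-1) g0 g0 gh Wp.
have -> : (fun _ : T => 0 + -1 * 0 : C) = (fun=> 0) by rewrite mulr0 addr0.
by rewrite mulN1r subrr.
Qed.

Lemma wp_0r r h p : gl h -> W p -> B r h (fun=> 0) p = 0.
Proof.
move=> gh Wp; have g0 := gl_cst cal 0.
have := wp_linr wB r (-1) g0 g0 gh Wp.
have -> : (fun _ : T => 0 + -1 * 0 : C) = (fun=> 0) by rewrite mulr0 addr0.
by rewrite mulN1r subrr.
Qed.

Lemma vanish_on_W d f q : W q -> (forall p, W p -> f p = 0) -> vanish q pd d f.
Proof.
move=> Wq f0; apply: (vanish_eq Wq (pd_eq cal) (f := fun=> 0)).
  by move=> p Wp; rewrite f0.
exact: (vanish_cst0 Wq (pd_eq cal) (pd_cst cal)).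
Qed.

(** An operator of finite order only sees the jets at [q]. *)
Lemma wp_locall r f f' g p : gl f -> gl f' -> gl g ->
  (forall p, W p -> f p = f' p) -> W p -> B r f g p = B r f' g p.
Proof.
move=> gf gf' gg ff' Wp; have [d Bd] := wp_ordl wB r gg Wp.
have gd : gl (fun p => f p + -1 * f' p).
  by apply: (gl_add cal) => //; exact: gl_scale.
have v : vanish p pd d (fun p => f p + -1 * f' p).
  by apply: vanish_on_W => // p' Wp'; rewrite mulN1r ff' // subrr.
have := Bd _ gd v; rewrite (wp_linl wB) // mulN1r => /eqP.
by rewrite subr_eq0 => /eqP.
Qed.

Lemma wp_localr r f f' g p : gl f -> gl f' -> gl g ->
  (forall p, W p -> f p = f' p) -> W p -> B r g f p = B r g f' p.
Proof.
move=> gf gf' gg ff' Wp; have [d Bd] := wp_ordr wB r gg Wp.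
have gd : gl (fun p => f p + -1 * f' p).
  by apply: (gl_add cal) => //; exact: gl_scale.
have v : vanish p pd d (fun p => f p + -1 * f' p).
  by apply: vanish_on_W => // p' Wp'; rewrite mulN1r ff' // subrr.
have := Bd _ gd v; rewrite (wp_linr wB) // mulN1r => /eqP.
by rewrite subr_eq0 => /eqP.
Qed.

Lemma gls_const f : gl f -> gls (pconst f).
Proof. by move=> gf [|r] //=; exact: (gl_cst cal). Qed.

Lemma gls_nu a : gls (pnu a).
Proof. by move=> r; exact: (gl_cst cal). Qed.

Lemma gls_star F H : gls F -> gls H -> gls (star F H).
Proof.
by move=> gF gH r; apply: gl_sum => a; apply: gl_sum => b; exact: (wp_gl wB).
Qed.

Lemma star_local F F' H H' : gls F -> gls F' -> gls H -> gls H' ->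
  (forall r p, W p -> F r p = F' r p) -> (forall r p, W p -> H r p = H' r p) ->
  forall r p, W p -> star F H r p = star F' H' r p.
Proof.
move=> gF gF' gH gH' FF' HH' r p Wp; apply: eq_bigr => a _; apply: eq_bigr => b _.
rewrite (wp_locall _ (gF b) (gF' b)) //; last by move=> ?; exact: FF'.
by apply: wp_localr => // ?; exact: HH'.
Qed.

Lemma star_constl f H r p : gl f -> gls H -> W p ->
  star (pconst f) H r p = \sum_(a < r.+1) B a f (H (r - a)%N) p.
Proof.
move=> gf gH Wp; apply: eq_bigr => a _.
rewrite big_ord_recl /= subn0 big1 ?addr0 // => b _.
exact: wp_0l.
Qed.

Lemma star_constr F h r p : gls F -> gl h -> W p ->
  star F (pconst h) r p = \sum_(a < r.+1) B a (F (r - a)%N) h p.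
Proof.
move=> gF gh Wp; apply: eq_bigr => a _.
rewrite big_ord_recr /= subnn /= big1 ?add0r // => b _.
have : (0 < r - a - b)%N by rewrite subn_gt0.
by case: (r - a - b)%N => // k _; exact: wp_0r.
Qed.

Lemma star_const2 f h r p : gl f -> gl h -> W p ->
  star (pconst f) (pconst h) r p = B r f h p.
Proof.
move=> gf gh Wp; rewrite star_constl //; last exact: gls_const.
rewrite big_ord_recr /= subnn /= big1 ?add0r // => a _.
have : (0 < r - a)%N by rewrite subn_gt0.
by case: (r - a)%N => // k _; exact: wp_0r.
Qed.

(** Reduces the left factor to functions. *)
Lemma star_expandl F H r p : gls F -> gls H -> W p ->
  star F H r p = \sum_(b < r.+1) star (pconst (F b)) H (r - b) p.
Proof.
move=> gF gH Wp.
transitivity (\sum_(a < r.+1) \sum_(b < r.+1 | (b < (r - a).+1)%N)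
    B a (F b) (H (r - a - b)%N) p).
  apply: eq_bigr => a _.
  rewrite (big_ord_widen r.+1 (fun b => B a (F b) (H (r - a - b)%N) p)) //.
  by rewrite ltnS leq_subr.
rewrite (exchange_big_dep predT) //=; apply: eq_bigr => b _.
rewrite star_constl // (big_ord_widen r.+1
  (fun a => B a (F b) (H (r - b - a)%N) p)) ?ltnS ?leq_subr //.
apply: eq_big => [a|a _]; last by rewrite subnAC.
have ar : (a <= r)%N by rewrite -ltnS.
have br : (b <= r)%N by rewrite -ltnS.
by rewrite !ltnS leq_subRL // leq_subRL // addnC.
Qed.

Lemma star_addr F G H r p : gls F -> gls G -> gls H -> W p ->
  star F (fun r p => G r p + H r p) r p = star F G r p + star F H r p.
Proof.
move=> gF gG gH Wp; rewrite /pstar -big_split; apply: eq_bigr => a _ /=.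
rewrite -big_split; apply: eq_bigr => b _ /=.
rewrite -[X in _ + X]mul1r -(wp_linr wB) //; congr B.
by apply/funext => p'; rewrite mul1r.
Qed.

Lemma star_scaler F G (a : C) r p : gls F -> gls G -> W p ->
  star F (fun r p => a * G r p) r p = a * star F G r p.
Proof.
move=> gF gG Wp; rewrite /pstar mulr_sumr; apply: eq_bigr => k _.
rewrite mulr_sumr; apply: eq_bigr => b _.
have := wp_linr wB k a (gl_cst cal 0) (gG (r - k - b)%N) (gF b) Wp.
rewrite wp_0r // add0r => <-; congr B.
by apply/funext => p'; rewrite add0r.
Qed.

Lemma star_nur F a r p : gls F -> W p ->
  star F (pnu a) r p = if r is r'.+1 then a * F r' p else 0.
Proof.
move=> gF Wp; rewrite /pstar big_ord_recl [X in _ + X]big1 ?addr0; last first.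
  move=> k _; rewrite big1 // => b _ /=.
  exact: (wp_cstr wB).
rewrite subn0.
under eq_bigr => b _ do rewrite /= (wp_C0 wB (gF b) (gls_nu a _) Wp) /pnu.
case: r => [|r]; first by rewrite big_ord1 mulr0.
rewrite big_ord_recr /= subnn mulr0 addr0 big_ord_recr /= subSnn /= mulrC.
rewrite big1 ?add0r // => b _.
have : (0 < r - b)%N by rewrite subn_gt0.
by rewrite subSn ?(ltnW (ltn_ord b)) // eqSS => /gtn_eqF ->; rewrite mulr0.
Qed.

Lemma star_z F l r p : gls F -> W p ->
  star F (pconst (z l)) r p = F r p * z l p.
Proof.
move=> gF Wp; have gz := z_gl coo l.
rewrite star_constr // big_ord_recl subn0 (wp_C0 wB) // big1 ?addr0 // => a _.
exact: (wp_z wB).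
Qed.

Lemma star_zb F l r p : gls F -> W p ->
  star (pconst (zb l)) F r p = zb l p * F r p.
Proof.
move=> gF Wp; have gz := zb_gl coo l.
rewrite star_constl // big_ord_recl subn0 (wp_C0 wB) // big1 ?addr0 // => a _.
exact: (wp_zb wB).
Qed.

Lemma star_1l F r p : gls F -> W p -> star (pconst (fun=> 1)) F r p = F r p.
Proof.
move=> gF Wp; have g1 := gl_cst cal 1.
rewrite star_constl // big_ord_recl subn0 (wp_C0 wB) // mul1r big1 ?addr0 // => a _.
exact: (wp_cstl wB).
Qed.

Lemma star_constl_lin H r a f g p : gls H -> gl f -> gl g -> W p ->
  star (pconst (fun p => f p + a * g p)) H r p =
  star (pconst f) H r p + a * star (pconst g) H r p.
Proof.
move=> gH gf gg Wp; rewrite !star_constl //; last first.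
  by apply: (gl_add cal) => //; exact: gl_scale.
rewrite mulr_sumr -big_split; apply: eq_bigr => b _ /=.
exact: (wp_linl wB).
Qed.

Lemma star_constl_order H r q : gls H -> W q -> exists d, forall f, gl f ->
  vanish q pd d f -> star (pconst f) H r q = 0.
Proof.
move=> gH Wq.
have /choice[d Hd] (a : 'I_r.+1) := wp_ordl wB a (gH (r - a)%N) Wq.
exists (\max_(a < r.+1) d a)%N => f gf vf.
rewrite star_constl // big1 // => a _; apply: Hd => //.
by apply: vanish_le vf; exact: leq_bigmax.
Qed.

Lemma wirt_lin a l b f g p : gl f -> gl g -> W p ->
  wirt pd a l (fun p => f p + b * g p) p = wirt pd a l f p + b * wirt pd a l g p.
Proof.
move=> gf gg Wp; have sf := gl_sm cal gf; have sg := gl_sm cal gg.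
have sb := sm_mul cal (sm_cst cal b) sg.
rewrite (wirt_add (pd_add cal)) // (wirt_mul (pd_mul cal)) ?(wirt_cst (pd_cst cal)) //.
  by rewrite mul0r add0r.
exact: (sm_cst cal).
Qed.

Lemma wirt_vanish a l f q : W q -> vanish q pd 2 f -> wirt pd a l f q = 0.
Proof.
move=> Wq vf; rewrite /wirt.
have -> : pd (lshift n l) f q = 0 by exact: (vf [:: lshift n l]).
have -> : pd (rshift n l) f q = 0 by exact: (vf [:: rshift n l]).
by rewrite mulr0 addr0 mulr0.
Qed.

Lemma Z_z l k g p : gl g -> W p ->
  Z k (fun p => z l p * g p) p = (k == l)%:R * g p + z l p * Z k g p.
Proof.
move=> gg Wp; have sz := gl_sm cal (z_gl coo l).
rewrite (wirt_mul (pd_mul cal)) //; last exact: (gl_sm cal).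
congr (_ * _ + _); rewrite (wirt_eq (pd_eq cal) _ _ (zE coo l) Wp).
rewrite (wirt_coord (sm_cst cal) (sm_mul cal) (sm_X cal) (pd_cst cal) (pd_add cal) (pd_mul cal) (pd_X cal)) //.
by rewrite mulNr (ii2 coo) opprK mulVf ?mul1r // pnatr_eq0.
Qed.

Lemma Z_zb l k g p : gl g -> W p ->
  Z k (fun p => zb l p * g p) p = zb l p * Z k g p.
Proof.
move=> gg Wp; have sz := gl_sm cal (zb_gl coo l).
rewrite (wirt_mul (pd_mul cal)) //; last exact: (gl_sm cal).
rewrite (wirt_eq (pd_eq cal) _ _ (g := fun p => X (lshift n l) p + - ii * X (rshift n l) p)) //; last first.
  by move=> p' Wp'; rewrite (zbE coo) // mulNr.
rewrite (wirt_coord (sm_cst cal) (sm_mul cal) (sm_X cal) (pd_cst cal) (pd_add cal) (pd_mul cal) (pd_X cal)) //.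
by rewrite mulrNN (ii2 coo) subrr mulr0 mul0r mul0r add0r.
Qed.

Lemma Zb_zb k l p : W p -> Zb l (zb k) p = (k == l)%:R.
Proof.
move=> Wp.
rewrite (wirt_eq (pd_eq cal) _ _ (g := fun p => X (lshift n k) p + - ii * X (rshift n k) p)) //; last first.
  by move=> p' Wp'; rewrite (zbE coo) // mulNr.
rewrite (wirt_coord (sm_cst cal) (sm_mul cal) (sm_X cal) (pd_cst cal) (pd_add cal) (pd_mul cal) (pd_X cal)) //.
by rewrite mulrN (ii2 coo) opprK mulVf ?mul1r ?pnatr_eq0 // eq_sym.
Qed.

(** Right multiplication by [u k] commutes with left multiplication by [zb]
    and satisfies the same commutation relation with right multiplication by
    [z] as the operator [u k + nu Z k]. *)
Lemma star_u (k : 'I_n) (u : nat -> T -> C) : gls u ->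
  (forall l r p, W p -> star u (pconst (z l)) r p - star (pconst (z l)) u r p =
     pnu (- (k == l)%:R) r p) ->
  forall f r p, gl f -> W p ->
  star (pconst f) u r p = f p * u r p + (r == 1%N)%:R * Z k f p.
Proof.
move=> gu urel f r q gf Wq; have gz := z_gl coo; have gzb := zb_gl coo.
pose D f := star (pconst f) u r q - (f q * u r q + (r == 1%N)%:R * Z k f q).
suff : D f = f q * D (fun=> 1).
  rewrite /D star_1l // (wirt_cst (pd_cst cal)) // mulr0 addr0 mul1r subrr mulr0.
  by move/eqP; rewrite subr_eq0 => /eqP.
have [d Hd] := star_constl_order r gu Wq.
apply: (@functional_value_zy q zb D (maxn 2 d)) => //.
- rewrite (_ : \matrix_(_, _) _ = 1%:M) ?unitmx1 //.
  by apply/matrixP => i j; rewrite !mxE Zb_zb.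
- move=> a g h gg gh; rewrite /D star_constl_lin // wirt_lin //.
  by ring.
- move=> g gg vg; rewrite /D Hd //; last by apply: vanish_le vg; rewrite leq_maxr.
  have v2 : vanish q pd 2 g by apply: vanish_le vg; rewrite leq_maxl.
  have g0 : g q = 0 by exact: (v2 [::]).
  by rewrite wirt_vanish // g0 mul0r mulr0 addr0 subrr.
- move=> l g gg; rewrite /D Z_z //.
  have gzg : gl (fun p => z l p * g p) by exact: (gl_mul cal).
  have gsg := gls_star (gls_const gg) gu.
  have gzu := gls_star (gls_const (gz l)) gu.
  have guz := gls_star gu (gls_const (gz l)).
  have -> : star (pconst (fun p => z l p * g p)) u r q =
      star (star (pconst g) (pconst (z l))) u r q.
    apply: star_local => //; try exact: gls_const.
      exact/gls_star/gls_const/gz/gls_const.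
    move=> r' p Wp; rewrite star_z //; last exact: gls_const.
    by case: r' => [|r'] /=; rewrite ?mul0r // mulrC.
  rewrite (wp_assoc wB) //; try exact: gls_const.
  have -> : star (pconst g) (star (pconst (z l)) u) r q =
      star (pconst g) (fun r p => star u (pconst (z l)) r p + pnu (k == l)%:R r p) r q.
    apply: star_local => //; try exact: gls_const.
      by move=> r'; apply: (gl_add cal) => //; exact: gls_nu.
    move=> r' p Wp; have := urel l r' p Wp.
    move/eqP; rewrite subr_eq addrC => /eqP ->; rewrite -addrA /pnu.
    by case: ifP => _; rewrite ?addNr !addr0.
  rewrite star_addr //; [|exact: gls_const|exact: gls_nu].
  rewrite star_nur //; last exact: gls_const.
  rewrite -(wp_assoc wB) //; try exact: gls_const.
  rewrite star_z //.
  case: r {d Hd D} => [|[|r]] /=; rewrite ?mul0r ?mulr0 ?mul1r ?mul0rn; ring.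
- move=> l g gg; rewrite /D Z_zb //.
  have gzg : gl (fun p => zb l p * g p) by exact: (gl_mul cal).
  have gsg := gls_star (gls_const gg) gu.
  have -> : star (pconst (fun p => zb l p * g p)) u r q =
      star (star (pconst (zb l)) (pconst g)) u r q.
    apply: star_local => //; try exact: gls_const.
      exact/gls_star/gls_const/gg/gls_const.
    move=> r' p Wp; rewrite star_zb //; last exact: gls_const.
    by case: r' => [|r'] /=; rewrite ?mulr0.
  rewrite (wp_assoc wB) //; try exact: gls_const.
  by rewrite star_zb //; ring.
Qed.

End OneProduct.

End Products.

(** ** The opposite product *)

Lemma coordinates_conj ii z zb : coordinates ii z zb -> coordinates (- ii) zb z.
Proof.
case=> i2 gz gzb Ez Ezb; split=> //; first by rewrite mulrNN.
- by move=> l p Wp; rewrite mulNr Ezb.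
- by move=> l p Wp; rewrite mulNr opprK Ez.
Qed.

Lemma wick_product_opp z zb B : wick_product z zb B ->
  wick_product zb z (fun r f h => B r h f).
Proof.
case=> h1 h2 h3 h4 h5 h6 h7 h8 h9 h10 h11.
have E F H : pstar (fun r f h => B r h f) F H = pstar B H F.
  by apply/funext => r; apply/funext => p; exact: pstar_rev.
split.
- by move=> r f g gf gg; exact: h1.
- by move=> r a f g h p gf gg gh Wp; exact: h3.
- by move=> r a f g h p gf gg gh Wp; exact: h2.
- exact: h5.
- exact: h4.
- by move=> F G H gF gG gH r p Wp; rewrite !E h6.
- by move=> f g p gf gg Wp; rewrite h7 // mulrC.
- exact: h9.
- exact: h8.
- exact: h11.
- exact: h10.
Qed.

Section Uniqueness.
Variables (ii : C) (z zb : 'I_n -> T -> C).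
Hypothesis coo : coordinates ii z zb.
Local Notation Z := (wirt pd (- ii)).
Local Notation Zb := (wirt pd ii).
Local Notation gls F := (forall r, gl (F r)).

(** The relations defining the local potentials of the characterizing form. *)
Definition u_rel B (u : 'I_n -> nat -> T -> C) := forall k l r p, W p ->
  pstar B (u k) (pconst (z l)) r p - pstar B (pconst (z l)) (u k) r p =
    pnu (- (k == l)%:R) r p.

Definition v_rel B (v : 'I_n -> nat -> T -> C) := forall k l r p, W p ->
  pstar B (v l) (pconst (zb k)) r p - pstar B (pconst (zb k)) (v l) r p =
    pnu (k == l)%:R r p.

(** For the opposite product, [v l] plays the role of [u k] and the two kinds of
    coordinates are exchanged. *)
Lemma star_v B v l f r p : wick_product z zb B -> gls (v l) -> v_rel B v ->
  gl f -> W p ->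
  pstar B (v l) (pconst f) r p = f p * v l r p + (r == 1%N)%:R * Zb l f p.
Proof.
move=> wB gv vrel gf Wp; rewrite pstar_rev.
have := star_u (coordinates_conj coo) (wick_product_opp wB) (k := l) gv _ r gf Wp.
rewrite opprK; apply=> k r' p' Wp'.
rewrite -(pstar_rev B) -(pstar_rev B) -opprB vrel // (eq_sym k l) /pnu.
by case: ifP => _; rewrite ?oppr0.
Qed.

Lemma star_expandr B F H r p : wick_product z zb B -> gls F -> gls H -> W p ->
  pstar B F H r p = \sum_(b < r.+1) pstar B F (pconst (H b)) (r - b) p.
Proof.
move=> wB gF gH Wp; rewrite pstar_rev (star_expandl (wick_product_opp wB)) //.
by apply: eq_bigr => b _; rewrite -pstar_rev.
Qed.

Lemma wp_mulz B r l f g p : wick_product z zb B -> gl f -> gl g -> W p ->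
  B r f (fun p => z l p * g p) p = z l p * B r f g p.
Proof.
move=> wB gf gg Wp; have gz := z_gl coo l.
have gzg : gl (fun p => z l p * g p) by exact: (gl_mul cal).
have cf := gls_const gf; have cg := gls_const gg; have cz := gls_const gz.
rewrite -(star_const2 wB) //.
have -> : pstar B (pconst f) (pconst (fun p => z l p * g p)) r p =
    pstar B (pconst f) (pstar B (pconst g) (pconst (z l))) r p.
  apply: (star_local wB) => //; first exact: gls_const.
    exact: (gls_star wB).
  move=> r' p' Wp'; rewrite (star_z coo wB) //.
  by case: r' => [|r'] /=; rewrite ?mul0r // mulrC.
rewrite -(wp_assoc wB) // (star_z coo wB) //; last exact: (gls_star wB).
by rewrite (star_const2 wB) // mulrC.
Qed.

(** Left multiplication by [f] commutes with right multiplication by [z], so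
    [B r.+1 f] kills the multiples of [z - z q], hence all the jets of
    holomorphic functions. *)
Lemma wp_holomorphic B r f g q : wick_product z zb B -> gl f -> gl g ->
  (forall l p, W p -> Zb l g p = 0) -> W q -> B r.+1 f g q = 0.
Proof.
move=> wB gf gg hg Wq.
have [d Hd] := wp_ordr wB r.+1 gf Wq.
have gz := z_gl coo.
have gw l : gl (fun p => z l p - z l q) by exact: gl_sub (gl_cst cal _).
have D_lin a f1 f2 : gl f1 -> gl f2 ->
    B r.+1 f (fun p => f1 p + a * f2 p) q = B r.+1 f f1 q + a * B r.+1 f f2 q.
  by move=> g1 g2; exact: (wp_linr wB).
have Dw l h : gl h -> B r.+1 f (fun p => (z l p - z l q) * h p) q = 0.
  move=> gh; have -> : (fun p => (z l p - z l q) * h p) =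
      (fun p => z l p * h p + - z l q * h p).
    by apply/funext => p; rewrite mulrDl.
  by rewrite D_lin ?wp_mulz // ?mulNr ?subrr //; exact: (gl_mul cal).
have wE l p : W p -> z l p - z l q = x q (lshift n l) p + ii * x q (rshift n l) p.
  by move=> Wp; rewrite !(zE coo) // /x; ring.
rewrite (functional_value_holomorphic (ii2 coo) Wq (sm_cst cal) (sm_add cal)
  (sm_mul cal) (sm_pd cal) (sm_x q) (pd_eq cal) (pd_cst cal) (pd_add cal)
  (pd_mul cal) (pd_commute cal) (pd_x q) (x_q q) (gl_cst cal) (gl_add cal)
  (gl_mul cal) (gl_sm cal) gw wE D_lin Hd Dw gg hg).
by rewrite (wp_cstr wB) // mulr0.
Qed.

Lemma star_holomorphic B f H r p : wick_product z zb B -> gl f -> gls H ->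
  (forall r l p, W p -> Zb l (H r) p = 0) -> W p ->
  pstar B (pconst f) H r p = f p * H r p.
Proof.
move=> wB gf gh hh Wp; rewrite (star_constl wB) // big_ord_recl subn0.
rewrite (wp_C0 wB) // big1 ?addr0 // => a _.
by apply: wp_holomorphic => // l p' Wp'; exact: hh.
Qed.

Section TwoProducts.
Variables B1 B2 : nat -> (T -> C) -> (T -> C) -> T -> C.
Hypotheses (wB1 : wick_product z zb B1) (wB2 : wick_product z zb B2).
Variables u1 u2 : 'I_n -> nat -> T -> C.
Hypotheses (gu1 : forall k, gls (u1 k)) (gu2 : forall k, gls (u2 k)).
Hypotheses (rel1 : u_rel B1 u1) (rel2 : u_rel B2 u2).
Hypothesis u12 : forall k l r p, W p -> Zb l (u1 k r) p = Zb l (u2 k r) p.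

(** The difference of the two potentials is holomorphic, so that both products
    have the same right multiplication by [u2]. *)
Lemma star_same_potential k g r p : gl g -> W p ->
  pstar B1 (pconst g) (u2 k) r p = pstar B2 (pconst g) (u2 k) r p.
Proof.
move=> gg Wp; rewrite (star_u coo wB2 (gu2 k) (rel2 k)) //.
pose h r p := u1 k r p - u2 k r p.
have gh : gls h by move=> r'; exact: gl_sub.
have hh r' l p' : W p' -> Zb l (h r') p' = 0.
  move=> Wp'; rewrite /h; under [fun p => _]eq_fun do rewrite -mulN1r.
  by rewrite wirt_lin // u12 // mulN1r subrr.
have := star_u coo wB1 (gu1 k) (rel1 k) r gg Wp.
have {1}-> : u1 k = (fun r p => u2 k r p + h r p).
  by apply/funext => r'; apply/funext => p'; rewrite /h addrC subrK.
rewrite (star_addr wB1) //; last exact: gls_const.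
rewrite (star_holomorphic r wB1 gg gh hh Wp) /h => E.
by apply: (addIr (g p * (u1 k r p - u2 k r p))); rewrite E; ring.
Qed.

Hypothesis unit_u2 : forall q, W q ->
  \matrix_(k < n, l < n) Zb l (u2 k 0%N) q \in unitmx.

(** Left multiplications commute with the right multiplications by [z] and
    [u2]; in degree [r] this determines the operator [B r f], as the lower
    degrees agree by induction. *)
Lemma wick_product_unique r f g q : gl f -> gl g -> W q ->
  B1 r f g q = B2 r f g q.
Proof.
elim/ltn_ind: r f g q => r IH f g q gf gg Wq.
pose D g := B1 r f g q - B2 r f g q.
suff : D g = g q * D (fun=> 1).
  have -> : D (fun=> 1) = 0.
    rewrite /D; case: (r) => [|r']; last by rewrite (wp_cstr wB1) // (wp_cstr wB2) // subrr.
    by rewrite (wp_C0 wB1) ?(wp_C0 wB2) ?subrr //; exact: (gl_cst cal).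
  by rewrite mulr0 => /eqP; rewrite subr_eq0 => /eqP.
have [d1 H1] := wp_ordr wB1 r gf Wq; have [d2 H2] := wp_ordr wB2 r gf Wq.
apply: (@functional_value_zy _ _ _ coo q (fun k => u2 k 0%N) D (maxn d1 d2)) => //.
- exact: unit_u2.
- move=> a h1 h2 g1 g2; rewrite /D (wp_linr wB1) // (wp_linr wB2) //.
  by ring.
- move=> h gh vh; rewrite /D H1 ?H2 ?subrr //.
    by apply: vanish_le vh; rewrite leq_maxr.
  by apply: vanish_le vh; rewrite leq_maxl.
- by move=> l h gh; rewrite /D !wp_mulz // mulrBr.
move=> k {g gg} g gg.
(* [Z k g] is defined on [W] only; [e] is a global function equal to it on [W],
   so that [G] can be multiplied by [f] *)
pose e p := pstar B1 (pconst g) (u2 k) 1%N p - g p * u2 k 1%N p.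
pose G r p := g p * u2 k r p + (if r == 1%N then e p else 0).
have gst B : wick_product z zb B -> gls (pstar B (pconst g) (u2 k)).
  by move=> wB; apply: (gls_star wB) => //; exact: gls_const.
have ge : gl e.
  by apply: gl_sub; [exact: (gst B1) | exact: (gl_mul cal)].
have gG : gls G.
  move=> r'; apply: (gl_add cal); first exact: (gl_mul cal).
  by case: (r' == 1%N); [exact: ge | exact: (gl_cst cal)].
have GE2 r' p : W p -> pstar B2 (pconst g) (u2 k) r' p = G r' p.
  move=> Wp; rewrite /G /e; have [->|nr] := eqVneq r' 1%N.
    by rewrite addrC subrK star_same_potential.
  by rewrite (star_u coo wB2 (gu2 k) (rel2 k)) // (negbTE nr) mul0r.
have GE1 r' p : W p -> pstar B1 (pconst g) (u2 k) r' p = G r' p.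
  by move=> Wp; rewrite star_same_potential // GE2.
have starR B1' : wick_product z zb B1' ->
    (forall r p, W p -> pstar B1' (pconst g) (u2 k) r p = G r p) ->
    \sum_(b < r.+1) pstar B1' (pconst (pstar B1' (pconst f) (pconst g) b)) (u2 k) (r - b) q =
    \sum_(a < r.+1) B1' a f (G (r - a)%N) q.
  move=> wB GE; have cf := gls_const gf; have cg := gls_const gg.
  rewrite -(star_expandl wB r (gls_star wB cf cg) (gu2 k) Wq).
  rewrite (wp_assoc wB) // -(star_constl wB r gf gG Wq).
  by apply: (star_local wB) => //; exact: (gst B1').
have E1 := starR B1 wB1 GE1; have E2 := starR B2 wB2 GE2.
have G0 : G 0%N = (fun p => u2 k 0%N p * g p).
  by apply/funext => p; rewrite /G /= addr0 mulrC.
have gF B b : wick_product z zb B -> gl (pstar B (pconst f) (pconst g) b).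
  by move=> wB; apply: (gls_star wB); exact: gls_const.
have same b : (b < r)%N ->
    pstar B1 (pconst (pstar B1 (pconst f) (pconst g) b)) (u2 k) (r - b) q =
    pstar B2 (pconst (pstar B2 (pconst f) (pconst g) b)) (u2 k) (r - b) q.
  move=> br; rewrite star_same_potential //; last exact: (gF B1).
  apply: (star_local wB2) => //; try exact/gls_const/gF.
  case=> [|r'] p Wp //=.
  by rewrite (star_const2 wB1) // (star_const2 wB2) // IH.
have S1 : \sum_(i < r) pstar B1 (pconst (pstar B1 (pconst f) (pconst g) i)) (u2 k) (r - i) q =
    \sum_(i < r) pstar B2 (pconst (pstar B2 (pconst f) (pconst g) i)) (u2 k) (r - i) q.
  by apply: eq_bigr => i _; exact: same.
have S2 : \sum_(i < r) B1 i f (G (r - i)%N) q = \sum_(i < r) B2 i f (G (r - i)%N) q.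
  by apply: eq_bigr => i _; exact: IH.
move: E1 E2; rewrite !big_ord_recr /= !subnn S1 S2 G0.
rewrite (star_u coo wB2 (gu2 k) (rel2 k)) //; last exact: (gF B2).
rewrite star_same_potential //; last exact: (gF B1).
rewrite (star_u coo wB2 (gu2 k) (rel2 k)) //; last exact: (gF B1).
rewrite (star_const2 wB1) // (star_const2 wB2) // !mul0r !addr0.
rewrite /D; set s := \sum_(i < r) _; set t := \sum_(i < r) _.
move=> E1 E2.
have -> : B1 r f (fun p => u2 k 0%N p * g p) q = s + B1 r f g q * u2 k 0%N q - t.
  by rewrite E1 addrAC subrr add0r.
have -> : B2 r f (fun p => u2 k 0%N p * g p) q = s + B2 r f g q * u2 k 0%N q - t.
  by rewrite E2 addrAC subrr add0r.
by ring.
Qed.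

End TwoProducts.

(** Two potentials of one product differ by a series [w] that multiplies
    pointwise from the right; comparing with left multiplication by [v l]
    shows that [w] is holomorphic. *)
Lemma potential_unique B u1 u2 v k l r p : wick_product z zb B ->
  gls (u1 k) -> gls (u2 k) -> gls (v l) ->
  u_rel B u1 -> u_rel B u2 -> v_rel B v -> W p ->
  Zb l (u1 k r) p = Zb l (u2 k r) p.
Proof.
move=> wB g1 g2 gv rel1 rel2 vrel Wp.
pose w r p := u1 k r p + -1 * u2 k r p.
have gw : gls w by move=> r'; apply: (gl_add cal) => //; exact: gl_scale.
have Fw f r' : gl f -> pstar B (pconst f) w r' p = f p * w r' p.
  move=> gf; rewrite (star_addr wB) //; try exact: gls_const.
    rewrite (star_scaler wB) //; last exact: gls_const.
    rewrite (star_u coo wB g1 (rel1 k)) // (star_u coo wB g2 (rel2 k)) // /w.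
    by ring.
  by move=> r''; exact: gl_scale.
have E1 : pstar B (v l) w r.+1 p = \sum_(b < r.+2) v l b p * w (r.+1 - b)%N p.
  by rewrite (star_expandl wB) //; apply: eq_bigr => b _; rewrite Fw.
have E2 : pstar B (v l) w r.+1 p = \sum_(b < r.+2) w b p * v l (r.+1 - b)%N p + Zb l (w r) p.
  rewrite star_expandr //.
  under eq_bigr do rewrite (star_v _ wB gv vrel (gw _) Wp).
  rewrite big_split /=; congr (_ + _).
  rewrite big_ord_recr /= subnn mul0r addr0 big_ord_recr /= subSnn mul1r.
  rewrite big1 ?add0r // => b _.
  have : (0 < r - b)%N by rewrite subn_gt0.
  by rewrite subSn ?(ltnW (ltn_ord b)) // eqSS => /gtn_eqF ->; rewrite mul0r.
have E3 : \sum_(b < r.+2) w b p * v l (r.+1 - b)%N p =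
    \sum_(b < r.+2) v l b p * w (r.+1 - b)%N p.
  rewrite (reindex_inj rev_ord_inj) /=; apply: eq_bigr => b _.
  have br : (b <= r.+1)%N := ltn_ord b.
  by rewrite subSS (subKn br) mulrC.
have : Zb l (w r) p = 0.
  by apply: (addrI (\sum_(b < r.+2) w b p * v l (r.+1 - b)%N p)); rewrite -E2 E1 E3 addr0.
by rewrite /w wirt_lin // mulN1r => /eqP; rewrite subr_eq0 => /eqP.
Qed.

End Uniqueness.

End LocalWick.

(** * Bidifferential operators *)

Lemma chart_calculus (R : realType) (M : topologicalType) (n : nat)
  (A : smooth_structure R M (n + n)) c W : atlas A c -> open W -> W `<=` cdom c ->
  @calculus R[i] M n W (csm c W) (smoothC A setT) (pdC c)
    (fun i p => (cmap c p 0 i)%:C%C).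
Proof.
move=> Ac oW Wc; split.
- exact: csm_cst.
- by move=> f g; exact: csm_add.
- by move=> f g; exact: csm_mul.
- by move=> i f; exact: csm_pd.
- by move=> i; exact: csm_sub Wc (csm_coord c _).
- by move=> i f g p; exact: (pdC_eq oW Wc).
- by move=> i a p _; exact: pdC_cst.
- by move=> i f g p; exact: (pdC_add oW Wc).
- by move=> i f g p; exact: (pdC_mul oW Wc).
- by move=> i j f p; exact: (pdC_commute oW Wc).
- by move=> i j p Wp; rewrite pdC_coord //; exact: Wc.
- exact: smoothC_cst.
- by move=> f g; apply: smoothC_add; exact: openT.
- by move=> f g; apply: smoothC_mul; exact: openT.
- by move=> f sf; apply: (smoothC_on Ac Wc); exact: smoothC_sub sf.
Qed.

Section Bidifferential.
Variables (R : realType) (M : topologicalType) (n : nat).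
Local Notation m := (n + n)%N.
Variable A : smooth_structure R M m.
Local Notation C := R[i].
Implicit Types (U W : set M) (f g h : M -> C).

Lemma mpd_ipd (c : chart R M m) N (a : {ffun 'I_m -> 'I_N.+1}) f :
  mpd c a f = ipd (pdC c) (flatten [seq nseq (a i) i | i <- enum 'I_m]) f.
Proof.
rewrite /mpd /ipd; elim: (enum 'I_m) => //= i s ->.
by rewrite foldr_cat; elim: (nat_of_ord (a i)) => //= k ->.
Qed.

Lemma csm_ipd (c : chart R M m) W s f : open W -> W `<=` cdom c -> csm c W f ->
  csm c W (ipd (pdC c) s f).
Proof. by move=> oW Wc sf; elim: s => [//|i s IH]; exact: (csm_pd oW Wc i IH). Qed.

(** The local formula holds in every chart of the atlas, so smoothness can be
    checked without changing coordinates. *)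
Lemma bidiff_smooth (B : (M -> C) -> (M -> C) -> M -> C) f h :
  bidifferential A B -> smoothC A setT f -> smoothC A setT h ->
  smoothC A setT (B f h).
Proof.
move=> bB sf sh; apply/smoothC_csm => c Ac; apply: csm_local => p [_ cp].
have [U [N [b [oU Up Uc sb BE]]]] := bB c Ac p cp.
have sfU := smoothC_sub (@subsetT _ U) sf; have shU := smoothC_sub (@subsetT _ U) sh.
have cf := smoothC_on Ac Uc sfU; have ch := smoothC_on Ac Uc shU.
exists U; split; [exact: oU | exact: Up | exact: Uc |].
apply: (csm_eq oU Uc (f := fun q => \sum_al \sum_be
    b al be q * mpd c al f q * mpd c be h q)).
  by move=> q Uq; rewrite (BE U oU (@subset_refl _ U) f h sfU shU q Uq).
apply: (csm_sum oU Uc) => al; apply: (csm_sum oU Uc) => be.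
rewrite !mpd_ipd; have sb' := smoothC_on Ac Uc (sb al be).
exact: (csm_mul oU Uc (csm_mul oU Uc sb' (csm_ipd _ oU Uc cf)) (csm_ipd _ oU Uc ch)).
Qed.

(** The local formula frozen at one point, with the multi-indices unfolded into
    lists of partial derivatives. *)
Lemma bidiff_pointE (B : (M -> C) -> (M -> C) -> M -> C) c q :
  bidifferential A B -> atlas A c -> cdom c q ->
  exists (I : finType) (s t : I -> seq 'I_m) (b : I -> C) U,
    [/\ open U, U q, U `<=` cdom c & forall W, open W -> W `<=` U -> W q ->
      forall f h, smoothC A W f -> smoothC A W h ->
      B f h q = \sum_(i : I) b i * ipd (pdC c) (s i) f q * ipd (pdC c) (t i) h q].
Proof.
move=> bB Ac cq; have [U [N [b [oU Uq Uc sb BE]]]] := bB c Ac q cq.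
pose S (a : {ffun 'I_m -> 'I_N.+1}) := flatten [seq nseq (a i) i | i <- enum 'I_m].
exists ({ffun 'I_m -> 'I_N.+1} * {ffun 'I_m -> 'I_N.+1})%type.
exists (fun i => S i.1), (fun i => S i.2), (fun i => b i.1 i.2 q), U.
split; [exact: oU | exact: Uq | exact: Uc |] => W oW WU Wq f h sf sh.
rewrite (BE W oW WU f h sf sh q Wq) pair_big /=; apply: eq_bigr => -[al be] _.
by rewrite /= !mpd_ipd.
Qed.

Section AtPoint.
Variables (B : (M -> C) -> (M -> C) -> M -> C) (c : chart R M m) (W : set M) (q : M).
Hypotheses (bB : bidifferential A B) (Ac : atlas A c).
Hypotheses (oW : open W) (Wc : W `<=` cdom c) (Wq : W q).

Let addE s a f g : smoothC A setT f -> smoothC A setT g ->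
  ipd (pdC c) s (fun p => f p + a * g p) q =
  ipd (pdC c) s f q + a * ipd (pdC c) s g q.
Proof.
move=> sf sg.
have cf := smoothC_on Ac Wc (smoothC_sub (@subsetT _ W) sf).
have cg := smoothC_on Ac Wc (smoothC_sub (@subsetT _ W) sg).
have cal := chart_calculus Ac oW Wc.
have cag := csm_scale oW Wc a cg.
rewrite (ipd_add (sm_pd cal) (pd_eq cal) (pd_add cal) s cf cag Wq).
by rewrite (ipd_scale (sm_cst cal) (sm_pd cal) (pd_eq cal) (pd_cst cal) (pd_mul cal) s a cg Wq).
Qed.

Lemma bidiff_linl a f g h : smoothC A setT f -> smoothC A setT g ->
  smoothC A setT h ->
  B (fun p => f p + a * g p) h q = B f h q + a * B g h q.
Proof.
move=> sf sg sh.
have [I [s [t [b [U [oU Uq Uc BE]]]]]] := bidiff_pointE bB Ac (Wc Wq).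
have E f1 h1 s1 s2 := BE U oU (@subset_refl _ U) Uq f1 h1
  (smoothC_sub (@subsetT _ U) s1) (smoothC_sub (@subsetT _ U) s2).
have sfg : smoothC A setT (fun p => f p + a * g p).
  exact: (smoothC_add openT sf (smoothC_scale openT a sg)).
rewrite (E _ _ sfg sh) (E _ _ sf sh) (E _ _ sg sh).
rewrite mulr_sumr -big_split; apply: eq_bigr => i _ /=.
by rewrite (addE _ _ sf sg) mulrDr mulrDl !mulrA [b i * a]mulrC.
Qed.

Lemma bidiff_linr a f g h : smoothC A setT f -> smoothC A setT g ->
  smoothC A setT h ->
  B h (fun p => f p + a * g p) q = B h f q + a * B h g q.
Proof.
move=> sf sg sh.
have [I [s [t [b [U [oU Uq Uc BE]]]]]] := bidiff_pointE bB Ac (Wc Wq).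
have E f1 h1 s1 s2 := BE U oU (@subset_refl _ U) Uq f1 h1
  (smoothC_sub (@subsetT _ U) s1) (smoothC_sub (@subsetT _ U) s2).
have sfg : smoothC A setT (fun p => f p + a * g p).
  exact: (smoothC_add openT sf (smoothC_scale openT a sg)).
rewrite (E _ _ sh sfg) (E _ _ sh sf) (E _ _ sh sg).
rewrite mulr_sumr -big_split; apply: eq_bigr => i _ /=.
by rewrite (addE _ _ sf sg) mulrDr mulrCA.
Qed.

Lemma bidiff_ordl h : smoothC A setT h -> exists d, forall f,
  smoothC A setT f -> vanish q (pdC c) d f -> B f h q = 0.
Proof.
move=> sh; have [I [s [t [b [U [oU Uq Uc BE]]]]]] := bidiff_pointE bB Ac (Wc Wq).
have E f1 h1 s1 s2 := BE U oU (@subset_refl _ U) Uq f1 h1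
  (smoothC_sub (@subsetT _ U) s1) (smoothC_sub (@subsetT _ U) s2).
exists (\max_i size (s i))%N.+1 => f sf vf.
rewrite (E _ _ sf sh).
rewrite big1 // => i _; have -> : ipd (pdC c) (s i) f q = 0.
  by apply: vf; rewrite ltnS; exact: (@leq_bigmax I (fun i => size (s i)) i).
by rewrite mulr0 mul0r.
Qed.

Lemma bidiff_ordr h : smoothC A setT h -> exists d, forall f,
  smoothC A setT f -> vanish q (pdC c) d f -> B h f q = 0.
Proof.
move=> sh; have [I [s [t [b [U [oU Uq Uc BE]]]]]] := bidiff_pointE bB Ac (Wc Wq).
have E f1 h1 s1 s2 := BE U oU (@subset_refl _ U) Uq f1 h1
  (smoothC_sub (@subsetT _ U) s1) (smoothC_sub (@subsetT _ U) s2).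
exists (\max_i size (t i))%N.+1 => f sf vf.
rewrite (E _ _ sh sf).
rewrite big1 // => i _; have -> : ipd (pdC c) (t i) f q = 0.
  by apply: vf; rewrite ltnS; exact: (@leq_bigmax I (fun i => size (t i)) i).
by rewrite mulr0.
Qed.

Lemma bidiff_local f f' h h' : smoothC A W f -> smoothC A W f' ->
  smoothC A W h -> smoothC A W h' ->
  (forall p, W p -> f p = f' p) -> (forall p, W p -> h p = h' p) ->
  B f h q = B f' h' q.
Proof.
move=> sf sf' sh sh' ff' hh'.
have [I [s [t [b [U [oU Uq Uc BE]]]]]] := bidiff_pointE bB Ac (Wc Wq).
have cal := chart_calculus Ac oW Wc.
have oV := openI oW oU.
have sV f1 (s1 : smoothC A W f1) := smoothC_sub (@subIsetl _ W U) s1.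
have E f1 h1 s1 s2 := BE (W `&` U) oV (@subIsetr _ W U) (conj Wq Uq) f1 h1
  (sV _ s1) (sV _ s2).
rewrite (E _ _ sf sh) (E _ _ sf' sh').
apply: eq_bigr => i _.
by rewrite (ipd_eq (pd_eq cal) (s i) ff' Wq) (ipd_eq (pd_eq cal) (t i) hh' Wq).
Qed.

End AtPoint.

End Bidifferential.

(** * Holomorphic functions *)

Lemma sum_Complex (R : realType) (I : Type) (r : seq I) (a b : I -> R) :
  \sum_(i <- r) Complex (a i) (b i) =
  Complex (\sum_(i <- r) a i) (\sum_(i <- r) b i) :> R[i].
Proof.
elim: r => [|i r IH]; first by rewrite !big_nil.
by rewrite !big_cons IH.
Qed.

Lemma sign_subn (A : pzRingType) (a r : nat) : (a <= r)%N ->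
  (-1) ^+ r * (-1) ^+ (r - a) = (-1) ^+ a :> A.
Proof.
by move=> ar; rewrite -{1}(subnKC ar) exprD -mulrA -expr2 sqrr_sign mulr1.
Qed.

Section Holomorphic.
Variables (R : realType) (M : topologicalType) (n : nat).
Variable X : pseudo_kahler R M n.
Local Notation C := R[i].
Local Notation ii := (Complex 0 1 : C).
Local Notation chart := (chart R M (n + n)).
Implicit Types (U W : set M) (f g h : M -> C) (c : chart).

Lemma conjc_ii : conjc ii = - ii.
Proof. by apply/eqP; rewrite eq_complex /= oppr0 !eqxx. Qed.

Lemma conjc_oppii : conjc (- ii) = ii.
Proof. by apply/eqP; rewrite eq_complex /= oppr0 opprK !eqxx. Qed.

Lemma ii_sqr : ii * ii = -1.
Proof. by apply/eqP; rewrite eq_complex /=; apply/andP; split; apply/eqP; ring. Qed.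

Lemma mul_ii (a b : R) : ii * Complex a b = Complex (- b) a.
Proof. by apply/eqP; rewrite eq_complex /=; apply/andP; split; apply/eqP; ring. Qed.

(** In another chart the differential of [zcoord c k] is read off from the
    Jacobian matrix, which intertwines the two matrices of [I]. *)
Lemma holomorphic_zcoord c W k f : holomorphic_chart X c -> open W ->
  W `<=` cdom c -> smoothC X W f -> (forall p, W p -> f p = zcoord c k p) ->
  holomorphic X W f.
Proof.
move=> [Ac Ic] oW Wc sf fz; split=> // c' p Ac' cp' Wp i.
have oU := openI oW (cdom_open c').
have pf j : pdC c' j f p = Complex (Defs.jacobian c' c p (lshift n k) j)
                                   (Defs.jacobian c' c p (rshift n k) j).
  rewrite (pdC_eq oU (@subIsetr _ _ _) j (g := zcoord c k)) //; last first.
    by move=> q [Wq _]; exact: fz.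
  by rewrite !mxE.
have cp := Wc _ Wp.
have := (pk_endo X).2 c' c p Ac' Ac cp' cp; rewrite Ic //.
move: (Defs.jacobian c' c p) pf => J pf JI.
under eq_bigr => j _ do rewrite pf.
have E j : Complex (J (lshift n k) j) (J (rshift n k) j) * (pk_I X c' p j i)%:C%C =
  Complex (J (lshift n k) j * pk_I X c' p j i) (J (rshift n k) j * pk_I X c' p j i).
  by apply/eqP; rewrite eq_complex /=; apply/andP; split; apply/eqP; ring.
under eq_bigr do rewrite E.
rewrite sum_Complex pf mul_ii.
have JIE a : \sum_j J a j * pk_I X c' p j i = (J *m pk_I X c' p) a i by rewrite mxE.
rewrite !JIE JI; congr Complex; rewrite mxE big_split_ord /=.
  rewrite big1 ?add0r => [|j _]; last by rewrite block_mxEul mxE mul0r.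
  rewrite (bigD1 k) //= block_mxEur !mxE eqxx mulN1r big1 ?addr0 // => j jk.
  by rewrite block_mxEur !mxE eq_sym (negbTE jk) oppr0 mul0r.
rewrite [X in _ + X]big1 ?addr0 => [|j _]; last first.
  by rewrite block_mxEdr mxE mul0r.
rewrite (bigD1 k) //= block_mxEdl !mxE eqxx mul1r big1 ?addr0 // => j jk.
by rewrite block_mxEdl !mxE eq_sym (negbTE jk) mul0r.
Qed.

Let conj_sum c p U f i (e : C) : open U -> U p -> atlas X c -> cdom c p ->
  smoothC X U f ->
  \sum_(j < n + n) pdC c j f p * (pk_I X c p j i)%:C%C = e * pdC c i f p ->
  \sum_(j < n + n) pdC c j (fun q => conjc (f q)) p * (pk_I X c p j i)%:C%C =
    conjc e * pdC c i (fun q => conjc (f q)) p.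
Proof.
move=> oU Up Ac cp sf E.
have oV := openI oU (cdom_open c).
have Vc := @subIsetr _ U (cdom c).
have cf : csm c (U `&` cdom c) f by move/smoothC_csm: sf; exact.
have pc j : pdC c j (fun q => conjc (f q)) p = conjc (pdC c j f p).
  exact: (pdC_conj oV Vc j cf (conj Up cp)).
rewrite pc -rmorphM -E rmorph_sum; apply: eq_bigr => j _.
by rewrite pc rmorphM; congr (_ * _); exact: esym (conjc_real _).
Qed.

(** The matrix of [I] is real. *)
Lemma antiholomorphic_conj U f : open U -> holomorphic X U f ->
  antiholomorphic X U (fun p => conjc (f p)).
Proof.
move=> oU [sf hf]; split; first exact: (smoothC_conj oU sf).
move=> c p Ac cp Up i; have := conj_sum oU Up Ac cp sf (hf c p Ac cp Up i).
by rewrite conjc_ii.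
Qed.

Lemma holomorphic_conj U f : open U -> antiholomorphic X U f ->
  holomorphic X U (fun p => conjc (f p)).
Proof.
move=> oU [sf hf]; split; first exact: (smoothC_conj oU sf).
move=> c p Ac cp Up i; have := conj_sum oU Up Ac cp sf (hf c p Ac cp Up i).
by rewrite conjc_oppii.
Qed.

Lemma holomorphic_cst U (a : C) : holomorphic X U (fun=> a).
Proof.
split; first exact: smoothC_cst.
by move=> c p _ _ _ i; rewrite big1 => [|j _]; rewrite pdC_cst ?mulr0 ?mul0r.
Qed.

Lemma antiholomorphic_cst U (a : C) : antiholomorphic X U (fun=> a).
Proof.
split; first exact: smoothC_cst.
by move=> c p _ _ _ i; rewrite big1 => [|j _]; rewrite pdC_cst ?mulr0 ?mul0r.
Qed.

End Holomorphic.

(** * Star products of Wick type *)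

Section WickAlgebra.
Variables (R : realType) (M : topologicalType) (n : nat).
Variable X : pseudo_kahler R M n.
Local Notation C := R[i].
Local Notation ii := (Complex 0 1 : C).
Local Notation chart := (chart R M (n + n)).
Local Notation gl := (smoothC X setT).
Implicit Types (U W : set M) (f g h : M -> C) (c : chart) (F G H : fseries R M).
Implicit Type B : nat -> (M -> C) -> (M -> C) -> M -> C.

(** The part of the axioms of a star product, and then of the Wick condition,
    that is invariant under the involutions [twist] below. *)
Record assoc_product B : Prop := AssocProduct {
  ap_bidiff : forall r, bidifferential X (B r);
  ap_assoc : forall F G H, smooth_series X setT F -> smooth_series X setT G ->
    smooth_series X setT H -> forall r p,
    fstar B (fstar B F G) H r p = fstar B F (fstar B G H) r p;
  ap_C0 : forall f h, gl f -> gl h -> forall p, B 0%N f h p = f p * h p;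
  ap_cst : forall r (a : C) f, gl f -> forall p,
    B r.+1 (fun=> a) f p = 0 /\ B r.+1 f (fun=> a) p = 0 }.

Record wick_algebra B : Prop := WickAlgebra {
  wa_product : assoc_product B;
  wa_hol : forall U r f h p, open U -> gl f -> gl h -> holomorphic X U h ->
    U p -> B r.+1 f h p = 0;
  wa_anti : forall U r f h p, open U -> gl f -> gl h -> antiholomorphic X U f ->
    U p -> B r.+1 f h p = 0 }.

Section Bilinear.
Variable B : (M -> C) -> (M -> C) -> M -> C.
Hypothesis bB : bidifferential X B.

Lemma bidiff_0l g p : gl g -> B (fun=> 0) g p = 0.
Proof.
move=> sg; have [c [Ac cp]] := atlas_cover X p.
have s0 : gl (fun=> 0) by exact: smoothC_cst.
have := bidiff_linl bB Ac (@cdom_open _ _ _ c) (@subset_refl _ _) cp (-1) s0 s0 sg.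
have -> : (fun _ : M => 0 + -1 * 0 : C) = (fun=> 0) by rewrite mulr0 addr0.
by rewrite mulN1r subrr.
Qed.

Lemma bidiff_0r g p : gl g -> B g (fun=> 0) p = 0.
Proof.
move=> sg; have [c [Ac cp]] := atlas_cover X p.
have s0 : gl (fun=> 0) by exact: smoothC_cst.
have := bidiff_linr bB Ac (@cdom_open _ _ _ c) (@subset_refl _ _) cp (-1) s0 s0 sg.
have -> : (fun _ : M => 0 + -1 * 0 : C) = (fun=> 0) by rewrite mulr0 addr0.
by rewrite mulN1r subrr.
Qed.

Lemma bidiff_scale_on c W a b f h p : atlas X c -> open W -> W `<=` cdom c ->
  W p -> smoothC X W f -> smoothC X W h ->
  B (fun p => a * f p) (fun p => b * h p) p = a * b * B f h p.
Proof.
move=> Ac oW Wc Wp sf sh.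
have [I [s [t [k [U [oU Up Uc BE]]]]]] := bidiff_pointE bB Ac (Wc _ Wp).
have oV := openI oW oU.
have VU := @subIsetr _ W U; have VW := @subIsetl _ W U.
have Vc : W `&` U `<=` cdom c by move=> q [/Wc].
have Vp : (W `&` U) p by split.
have sfV := smoothC_sub VW sf; have shV := smoothC_sub VW sh.
rewrite (BE _ oV VU Vp _ _ (smoothC_scale oV a sfV) (smoothC_scale oV b shV)).
rewrite (BE _ oV VU Vp _ _ sfV shV) mulr_sumr; apply: eq_bigr => i _.
have cal := chart_calculus Ac oV Vc.
have scE l e g : smoothC X (W `&` U) g ->
    ipd (pdC c) l (fun p => e * g p) p = e * ipd (pdC c) l g p.
  move=> sg; exact: (ipd_scale (sm_cst cal) (sm_pd cal) (pd_eq cal) (pd_cst cal)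
    (pd_mul cal) l e (smoothC_on Ac Vc sg) Vp).
by rewrite (scE _ _ _ sfV) (scE _ _ _ shV); ring.
Qed.

Lemma bidiff_scale a b f h p : gl f -> gl h ->
  B (fun p => a * f p) (fun p => b * h p) p = a * b * B f h p.
Proof.
move=> sf sh; have [c [Ac cp]] := atlas_cover X p.
exact: (bidiff_scale_on a b Ac (cdom_open c) (@subset_refl _ _) cp
  (smoothC_sub (@subsetT _ _) sf) (smoothC_sub (@subsetT _ _) sh)).
Qed.

End Bilinear.

Lemma fstar_const2 B f h r p : (forall r, bidifferential X (B r)) ->
  gl f -> gl h -> fstar B (fconst f) (fconst h) r p = B r f h p.
Proof.
move=> bB sf sh.
have s0 : gl (fun=> 0) by exact: smoothC_cst.
have sc k : gl (fconst h k) by case: k => [|k]; [exact: sh | exact: s0].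
rewrite /fstar big_ord_recr /= subnn big_ord1 subn0 /= big1 ?add0r // => a _.
rewrite big_ord_recl /= subn0 big1 ?addr0 => [|b _].
  have : (0 < r - a)%N by rewrite subn_gt0.
  by case: (r - a)%N => // k _; exact: (bidiff_0r (bB a) _ sf).
exact: (bidiff_0l (bB a) _ (sc _)).
Qed.

Lemma star_product_assoc B : star_product X B -> assoc_product B.
Proof. by case. Qed.

Lemma star_product_wick B : star_product X B -> wick_type X (fstar B) ->
  wick_algebra B.
Proof.
move=> sB wB; have aB := star_product_assoc sB; have bB := ap_bidiff aB.
have s0 : gl (fun=> 0) by exact: smoothC_cst.
split; first exact: aB.
- move=> U r f h p oU sf sh hh Up.
  have [+ _] := wB U oU f f h _ sf sf sh s0 hh (antiholomorphic_cst X U 0) r.+1 p Up.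
  by rewrite fstar_const2.
- move=> U r f h p oU sf sh hf Up.
  have [_] := wB U oU h h _ f sh sh s0 sf (holomorphic_cst X U 0) hf r.+1 p Up.
  by rewrite fstar_const2.
Qed.

(** ** The involutions [B r f h |-> (-1) ^ r s (B r (s h) (s f))] *)

Section Twist.
Variable s : {rmorphism C -> C}.
Hypothesis sK : forall a, s (s a) = a.
Hypothesis s_smooth : forall U f, open U -> smoothC X U f ->
  smoothC X U (fun p => s (f p)).
Hypothesis s_pd : forall c W i f p, open W -> W `<=` cdom c -> csm c W f ->
  W p -> pdC c i (fun q => s (f q)) p = s (pdC c i f p).

(** For complex conjugation this is the conjugate product; for the identity it
    reverses the order of the factors and the sign of [nu]. *)
Definition twist B r f h p : C :=
  (-1) ^+ r * s (B r (fun q => s (h q)) (fun q => s (f q)) p).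

Definition twist_series F : fseries R M := fun r p => (-1) ^+ r * s (F r p).

Lemma twist_seriesK F : twist_series (twist_series F) = F.
Proof.
apply/funext => r; apply/funext => p.
by rewrite /twist_series rmorphM rmorph_sign sK mulrA -expr2 sqrr_sign mul1r.
Qed.

Lemma smooth_twist_series F : smooth_series X setT F ->
  smooth_series X setT (twist_series F).
Proof.
by move=> sF r; exact: (smoothC_scale openT _ (s_smooth openT (sF r))).
Qed.

Let s_ipd c W l f p : open W -> W `<=` cdom c -> csm c W f -> W p ->
  ipd (pdC c) l (fun q => s (f q)) p = s (ipd (pdC c) l f p).
Proof.
move=> oW Wc cf; elim: l p => [//|i l IH] p Wp /=.
rewrite (pdC_eq oW Wc i (g := fun q => s (ipd (pdC c) l f q)) IH Wp).
exact: (s_pd i oW Wc (csm_ipd l oW Wc cf) Wp).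
Qed.

Lemma twist_bidiff B r : bidifferential X (B r) -> bidifferential X (twist B r).
Proof.
move=> bB c Ac p cp; have [U [N [b [oU Up Uc sb BE]]]] := bB c Ac p cp.
exists U, N, (fun al be q => (-1) ^+ r * s (b be al q)).
split; [exact: oU | exact: Up | exact: Uc | |].
  by move=> al be; exact: (smoothC_scale oU _ (s_smooth oU (sb be al))).
move=> W oW WU f h sf sh q Wq.
have Wc : W `<=` cdom c by move=> x /WU; exact: Uc.
have cf := smoothC_on Ac Wc sf; have ch := smoothC_on Ac Wc sh.
rewrite /twist (BE W oW WU _ _ (s_smooth oW sh) (s_smooth oW sf) q Wq).
rewrite [RHS]exchange_big rmorph_sum mulr_sumr; apply: eq_bigr => al _.
rewrite rmorph_sum mulr_sumr; apply: eq_bigr => be _.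
rewrite !mpd_ipd (s_ipd _ oW Wc ch Wq) (s_ipd _ oW Wc cf Wq) !rmorphM !sK.
by ring.
Qed.

(** The signs [(-1) ^ b] and [(-1) ^ (r - a - b)] of the two series combine with
    the outer sign [(-1) ^ r] to the sign [(-1) ^ a] of the twisted
    operator. *)
Lemma fstar_twist_on B c W F H r p : (forall r, bidifferential X (B r)) ->
  atlas X c -> open W -> W `<=` cdom c -> W p ->
  smooth_series X W F -> smooth_series X W H ->
  fstar (twist B) F H r p =
  twist_series (fstar B (twist_series H) (twist_series F)) r p.
Proof.
move=> bB Ac oW Wc Wp sF sH; rewrite /fstar /twist_series rmorph_sum mulr_sumr.
apply: eq_bigr => a _; rewrite rmorph_sum mulr_sumr.
rewrite (reindex_inj rev_ord_inj) /=; apply: eq_bigr => b _.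
have ar : (a <= r)%N := ltn_ord a; have br : (b <= r - a)%N := ltn_ord b.
rewrite subSS (subKn br) /twist.
rewrite (bidiff_scale_on (bB a) _ _ Ac oW Wc Wp (s_smooth oW (sH b))
  (s_smooth oW (sF (r - a - b)%N))).
rewrite !rmorphM !rmorph_sign !mulrA -[in RHS](mulrA ((-1) ^+ r)) -exprD subnKC //.
by rewrite sign_subn.
Qed.

Lemma fstar_twist B F H r p : (forall r, bidifferential X (B r)) ->
  smooth_series X setT F -> smooth_series X setT H ->
  fstar (twist B) F H r p =
  twist_series (fstar B (twist_series H) (twist_series F)) r p.
Proof.
move=> bB sF sH; have [c [Ac cp]] := atlas_cover X p.
apply: (fstar_twist_on r bB Ac (cdom_open c) (@subset_refl _ _) cp) => k.
- exact: (smoothC_sub (@subsetT _ _) (sF k)).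
- exact: (smoothC_sub (@subsetT _ _) (sH k)).
Qed.

Lemma smooth_fstar B F H : (forall r, bidifferential X (B r)) ->
  smooth_series X setT F -> smooth_series X setT H ->
  smooth_series X setT (fstar B F H).
Proof.
move=> bB sF sH r; apply: (smoothC_sum openT) => a; apply: (smoothC_sum openT) => b.
exact: (bidiff_smooth (bB a) (sF b) (sH _)).
Qed.

Lemma twist_assoc_product B : assoc_product B -> assoc_product (twist B).
Proof.
move=> [bB aB B0 Bc]; split.
- by move=> r; exact: twist_bidiff.
- move=> F G H sF sG sH r p.
  have sF' := smooth_twist_series sF; have sG' := smooth_twist_series sG.
  have sH' := smooth_twist_series sH.
  have E F1 G1 : smooth_series X setT F1 -> smooth_series X setT G1 ->
      fstar (twist B) F1 G1 = twist_series (fstar B (twist_series G1) (twist_series F1)).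
    move=> s1 s2; apply/funext => r1; apply/funext => p1.
    exact: (fstar_twist r1 p1 bB s1 s2).
  have sT F1 G1 : smooth_series X setT F1 -> smooth_series X setT G1 ->
      smooth_series X setT (fstar (twist B) F1 G1).
    by move=> s1 s2; apply: smooth_fstar => // r1; exact: twist_bidiff.
  rewrite (E _ _ (sT _ _ sF sG) sH) (E _ _ sF sG) twist_seriesK.
  rewrite (E _ _ sF (sT _ _ sG sH)) (E _ _ sG sH) twist_seriesK.
  by congr (_ * s _); exact: (esym (aB _ _ _ sH' sG' sF' r p)).
- move=> f h sf sh p.
  rewrite /twist expr0 mul1r (B0 _ _ (s_smooth openT sh) (s_smooth openT sf)).
  by rewrite rmorphM !sK mulrC.
- move=> r a f sf p; rewrite /twist.
  have [-> ->] := Bc r (s a) _ (s_smooth openT sf) p.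
  by rewrite rmorph0 mulr0.
Qed.

End Twist.

End WickAlgebra.

(** * Forms of type (1,1) in a holomorphic chart *)

Section Forms.
Variables (R : realType) (M : topologicalType) (n : nat).
Variable X : pseudo_kahler R M n.
Local Notation C := R[i].
Local Notation ii := (Complex 0 1 : C).
Local Notation chart := (chart R M (n + n)).
Local Notation Zvec := (@Defs.Zvec R n).
Local Notation Zbvec := (@Defs.Zbvec R n).
Local Notation dz := (@Defs.dz R n).
Local Notation dzb := (@Defs.dzb R n).

Let pairing (a b : C) (k l : 'I_n) :
  (delta_mx 0 (lshift n k) + a *: delta_mx 0 (rshift n k) : 'rV[C]_(n + n)) *m
  (2^-1 *: (delta_mx (lshift n l) 0 + b *: delta_mx (rshift n l) 0)) =
  (2^-1 * (1 + a * b) * (k == l)%:R)%:M :> 'M[C]_1.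
Proof.
rewrite -scalemxAr mulmxDl !mulmxDr -!scalemxAl -!scalemxAr !mul_delta_mx_cond.
rewrite !(inj_eq (@lshift_inj n n)) !(inj_eq (@rshift_inj n n)).
rewrite eq_lrshift eq_rlshift !mulr0n !scaler0 addr0 add0r.
apply/matrixP => i j; rewrite !ord1 !mxE !eqxx.
have -> : (('e_0 *+ (k == l)) : 'M[C]_1) 0 0 = (k == l)%:R.
  by case: (k == l); rewrite mxE.
by rewrite /= mulr1n; ring.
Qed.

Let half2 : 2^-1 * (1 + 1) = 1 :> C.
Proof. by rewrite mulVf // pnatr_eq0. Qed.

Let i2 : ii * ii = -1 := ii_sqr R.

Lemma dz_Zvec k l : dz k *m Zvec l = (k == l)%:R%:M :> 'M[C]_1.
Proof.
rewrite /Defs.dz /Defs.Zvec -scaleNr pairing.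
by rewrite mulrN i2 opprK half2 mul1r.
Qed.

Lemma dz_Zbvec k l : dz k *m Zbvec l = 0 :> 'M[C]_1.
Proof.
by rewrite /Defs.dz /Defs.Zbvec pairing i2 subrr mulr0 mul0r raddf0.
Qed.

Lemma dzb_Zvec k l : dzb k *m Zvec l = 0 :> 'M[C]_1.
Proof.
rewrite /Defs.dzb /Defs.Zvec -!scaleNr pairing.
by rewrite mulrNN i2 subrr mulr0 mul0r raddf0.
Qed.

Lemma dzb_Zbvec k l : dzb k *m Zbvec l = (k == l)%:R%:M :> 'M[C]_1.
Proof.
rewrite /Defs.dzb /Defs.Zbvec -scaleNr pairing.
by rewrite mulNr i2 opprK half2 mul1r.
Qed.

Let conj_ii : conjc ii = - ii := conjc_ii R.

Let conj_half : conjc (2^-1 : C) = 2^-1.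
Proof. by rewrite fmorphV rmorph_nat. Qed.

Let conjZ p q (a : C) (Y : 'M[C]_(p, q)) :
  map_mx conjc (a *: Y) = conjc a *: map_mx conjc Y.
Proof. exact: map_mxZ. Qed.

Lemma conj_Zvec k : map_mx conjc (Zvec k) = Zbvec k.
Proof.
rewrite /Defs.Zvec /Defs.Zbvec conjZ map_mxB conjZ !map_delta_mx.
by rewrite conj_half conj_ii scaleNr opprK.
Qed.

Lemma conj_Zbvec k : map_mx conjc (Zbvec k) = Zvec k.
Proof.
rewrite /Defs.Zvec /Defs.Zbvec conjZ map_mxD conjZ !map_delta_mx.
by rewrite conj_half conj_ii scaleNr.
Qed.

Lemma conj_dz k : map_mx conjc (dz k) = dzb k.
Proof.
by rewrite /Defs.dz /Defs.dzb map_mxD conjZ !map_delta_mx conj_ii scaleNr.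
Qed.

Lemma conj_dzb k : map_mx conjc (dzb k) = dz k.
Proof.
by rewrite /Defs.dz /Defs.dzb map_mxB conjZ !map_delta_mx conj_ii scaleNr opprK.
Qed.

Lemma wedge_mulmx (a b : 'rV[C]_(n + n)) (v w : 'cV[C]_(n + n)) :
  v^T *m wedge a b *m w =
  (a *m v)^T *m (b *m w) - (b *m v)^T *m (a *m w).
Proof. by rewrite /wedge mulmxBr mulmxBl !trmx_mul !mulmxA. Qed.

Let sum_delta2 (a : 'I_n -> 'I_n -> C) k l :
  \sum_(i < n) \sum_(j < n) a i j * ((i == k)%:R * (j == l)%:R) = a k l.
Proof.
rewrite (bigD1 k) //= [X in _ + X]big1 ?addr0 => [|i ik].
  rewrite (bigD1 l) //= !eqxx !mulr1 big1 ?addr0 // => j jl.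
  by rewrite (negbTE jl) !mulr0.
by rewrite big1 // => j _; rewrite (negbTE ik) mul0r mulr0.
Qed.

(** Only one of the two terms of each wedge product survives, since [v] is
    killed by all the [be i]. *)
Let wedge_coef (al be : 'I_n -> 'rV[C]_(n + n)) (a : 'I_n -> 'I_n -> C)
    (v w : 'cV[C]_(n + n)) k l :
  (forall i, al i *m v = (i == k)%:R%:M :> 'M[C]_1) ->
  (forall i, be i *m w = (i == l)%:R%:M :> 'M[C]_1) ->
  (forall i, be i *m v = 0 :> 'M[C]_1) ->
  (v^T *m (\sum_(i < n) \sum_(j < n) a i j *: wedge (al i) (be j)) *m w) 0 0 = a k l.
Proof.
move=> alv bew bev; rewrite -[RHS]sum_delta2 mulmx_sumr mulmx_suml summxE.
apply: eq_bigr => i _; rewrite mulmx_sumr mulmx_suml summxE.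
apply: eq_bigr => j _; rewrite -scalemxAr -scalemxAl wedge_mulmx alv bew bev.
by rewrite trmx0 mul0mx subr0 tr_scalar_mx -scalar_mxM !mxE eqxx mulr1n.
Qed.

Lemma dbar10_coef (c : chart) (a : 'I_n -> M -> C) p k l :
  ((Zbvec l)^T *m dbar10 c a p *m Zvec k) 0 0 = Zbder c l (a k) p.
Proof.
rewrite /dbar10 exchange_big /=.
apply: (wedge_coef (al := dzb) (be := dz)) => i.
- exact: dzb_Zbvec.
- exact: dz_Zvec.
- exact: dz_Zbvec.
Qed.

Lemma del01_coef (c : chart) (b : 'I_n -> M -> C) p k l :
  ((Zvec k)^T *m del01 c b p *m Zbvec l) 0 0 = Zder c k (b l) p.
Proof.
rewrite /del01 exchange_big /=.
apply: (wedge_coef (al := dz) (be := dzb)) => i.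
- exact: dz_Zvec.
- exact: dzb_Zbvec.
- exact: dzb_Zvec.
Qed.

Let scale_mid (v w : 'cV[C]_(n + n)) e Y :
  v^T *m (e *: Y) *m w = e *: (v^T *m Y *m w).
Proof. by rewrite -scalemxAr -scalemxAl. Qed.

Lemma conj_wedge (a b : 'rV[C]_(n + n)) :
  map_mx conjc (wedge a b) = wedge (map_mx conjc a) (map_mx conjc b).
Proof. by rewrite /wedge map_mxB !map_mxM !map_trmx. Qed.

(** Conjugation exchanges the two expressions of [K], so that reality is an
    identity between the coefficients of [dzb wedge dz]. *)
Lemma real_dbar10_coef (c : chart) (a b : 'I_n -> M -> C) (K : 'M[C]_(n + n)) p r :
  K = dbar10 c a p -> K = del01 c b p ->
  (-1) ^+ r *: map_mx conjc K = K <->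
  (forall k l, Zbder c l (a k) p = (-1) ^+ r * conjc (Zder c l (b k) p)).
Proof.
move=> Ka Kb; split=> [Kr k l|ab].
  rewrite -dbar10_coef -Ka -Kr scale_mid mxE; congr (_ * _).
  rewrite -del01_coef -Kb -(conj_Zvec l) -(conj_Zbvec k) map_trmx -!map_mxM.
  by rewrite mxE.
rewrite {1}Kb Ka /del01 /dbar10 map_mx_sum scaler_sumr; apply: eq_bigr => k _.
rewrite map_mx_sum scaler_sumr; apply: eq_bigr => l _.
by rewrite conjZ conj_wedge conj_dz conj_dzb scalerA ab.
Qed.

Lemma omega_unit (c : chart) p : atlas X c -> cdom c p -> pk_omega X c p \in unitmx.
Proof.
move=> Ac cp; rewrite /pk_omega map_unitmx unitmx_mul unitmx_tr.
have [_ ->] := (pk_metric X).2 c p Ac cp; rewrite andbT.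
have : pk_I X c p *m (- pk_I X c p) = 1%:M.
  by rewrite mulmxN (pk_almost_complex Ac cp) opprK.
by case/mulmx1_unit.
Qed.

Let dual_sum (be : 'I_n -> 'rV[C]_(n + n)) (zv : 'I_n -> 'cV[C]_(n + n))
    (v : 'I_n -> C) k :
  (forall k l, be k *m zv l = (k == l)%:R%:M :> 'M[C]_1) ->
  be k *m (\sum_(l < n) v l *: zv l) = (v k)%:M :> 'M[C]_1.
Proof.
move=> bz; rewrite mulmx_sumr (bigD1 k) //= -scalemxAr bz eqxx big1 => [|l lk].
  by rewrite addr0 scale_scalar_mx mulr1.
by rewrite -scalemxAr bz eq_sym (negbTE lk) raddf0 scaler0.
Qed.

Let annihilated_sum (be : 'I_n -> 'rV[C]_(n + n)) (zv : 'I_n -> 'cV[C]_(n + n))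
    (v : 'I_n -> C) k :
  (forall k l, be k *m zv l = 0 :> 'M[C]_1) ->
  be k *m (\sum_(l < n) v l *: zv l) = 0 :> 'M[C]_1.
Proof.
by move=> bz; rewrite mulmx_sumr big1 // => l _; rewrite -scalemxAr bz scaler0.
Qed.

(** A linear relation between the rows of the coefficient matrix gives a vector
    of type (1,0) in the kernel of the form. *)
Lemma dbar10_unit (c : chart) (a : 'I_n -> M -> C) p :
  dbar10 c a p \in unitmx ->
  \matrix_(k < n, l < n) Zbder c l (a k) p \in unitmx.
Proof.
move=> uK; rewrite -row_free_unit; apply/inj_row_free => v vG.
pose Y : 'cV[C]_(n + n) := \sum_(k < n) v 0 k *: Zvec k.
have dzY k : dz k *m Y = (v 0 k)%:M :> 'M[C]_1 by exact: dual_sum dz_Zvec.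
have dzbY k : dzb k *m Y = 0 :> 'M[C]_1 by exact: annihilated_sum dzb_Zvec.
have KY : dbar10 c a p *m Y = 0.
  rewrite /dbar10 mulmx_suml.
  under eq_bigr => k _ do rewrite mulmx_suml.
  rewrite exchange_big big1 //= => l _.
  transitivity ((\sum_(k < n) v 0 k * Zbder c l (a k) p) *: (dzb l)^T).
    rewrite scaler_suml; apply: eq_bigr => k _.
    rewrite -scalemxAl /wedge mulmxBl -!mulmxA dzY dzbY mulmx0 subr0.
    by rewrite mul_mx_scalar scalerA mulrC.
  have := congr1 (fun A : 'rV[C]_n => A 0 l) vG; rewrite !mxE => E.
  suff -> : \sum_(k < n) v 0 k * Zbder c l (a k) p = 0 by rewrite scale0r.
  by rewrite -[RHS]E; apply: eq_bigr => k _; congr (_ * _); rewrite mxE.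
have Y0 : Y = 0 by rewrite -[Y](mulKmx uK) KY mulmx0.
apply/rowP => k; have := dzY k; rewrite Y0 mulmx0.
by move=> /(congr1 (fun A : 'M[C]_1 => A 0 0)); rewrite !mxE eqxx mulr1n.
Qed.

End Forms.

(** * Star products of Wick type around a point *)

Section LocalStar.
Variables (R : realType) (M : topologicalType) (n : nat).
Variable X : pseudo_kahler R M n.
Local Notation C := R[i].
Local Notation ii := (Complex 0 1 : C).
Local Notation chart := (chart R M (n + n)).
Local Notation gl := (smoothC X setT).
Implicit Types (U W : set M) (f g h : M -> C) (F G H : fseries R M).
Implicit Type B : nat -> (M -> C) -> (M -> C) -> M -> C.

Lemma smoothC_zcoord (c : chart) k : atlas X c -> smoothC X (cdom c) (zcoord c k).
Proof.
move=> Ac; have oc := cdom_open c.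
have sx := smoothC_coord (lshift n k) Ac; have sy := smoothC_coord (rshift n k) Ac.
have := smoothC_add oc sx (smoothC_scale oc ii sy).
congr (smoothC X (cdom c) _); apply/funext => p.
by apply/eqP; rewrite eq_complex /=; apply/andP; split; apply/eqP; ring.
Qed.

Lemma smoothC_zbcoord (c : chart) k : atlas X c -> smoothC X (cdom c) (zbcoord c k).
Proof.
by move=> Ac; exact: (smoothC_conj (cdom_open c) (smoothC_zcoord k Ac)).
Qed.

Lemma fstar_local B F F' H H' (c : chart) W r p :
  (forall r, bidifferential X (B r)) -> atlas X c -> open W -> W `<=` cdom c ->
  smooth_series X W F -> smooth_series X W F' ->
  smooth_series X W H -> smooth_series X W H' ->
  (forall r p, W p -> F r p = F' r p) -> (forall r p, W p -> H r p = H' r p) ->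
  W p -> fstar B F H r p = fstar B F' H' r p.
Proof.
move=> bB Ac oW Wc sF sF' sH sH' FF' HH' Wp.
apply: eq_bigr => a _; apply: eq_bigr => b _.
exact: (bidiff_local (bB a) Ac oW Wc Wp (sF b) (sF' b) (sH _) (sH' _) (FF' b) (HH' _)).
Qed.

Lemma fstar_oppl B F H r p : (forall r, bidifferential X (B r)) ->
  smooth_series X setT F -> smooth_series X setT H ->
  fstar B (fun r p => - F r p) H r p = - fstar B F H r p.
Proof.
move=> bB sF sH; rewrite /fstar -sumrN; apply: eq_bigr => a _.
rewrite -sumrN; apply: eq_bigr => b _.
have := bidiff_scale (bB a) (-1) 1 p (sF b) (sH (r - a - b)%N).
rewrite mulr1 mulN1r => <-; congr (B a _ _ p); apply/funext => q.
  by rewrite mulN1r.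
by rewrite mul1r.
Qed.

Lemma fstar_oppr B F H r p : (forall r, bidifferential X (B r)) ->
  smooth_series X setT F -> smooth_series X setT H ->
  fstar B F (fun r p => - H r p) r p = - fstar B F H r p.
Proof.
move=> bB sF sH; rewrite /fstar -sumrN; apply: eq_bigr => a _.
rewrite -sumrN; apply: eq_bigr => b _.
have := bidiff_scale (bB a) 1 (-1) p (sF b) (sH (r - a - b)%N).
rewrite mul1r mulN1r => <-; congr (B a _ _ p); apply/funext => q.
  by rewrite mul1r.
by rewrite mulN1r.
Qed.

(** ** The conjugate product *)

Local Notation conjm := (@conjc R : {rmorphism R[i] -> R[i]}).
Local Notation bar := (twist conjm).

Let conj_smooth U f : open U -> smoothC X U f -> smoothC X U (fun p => conjm (f p)).
Proof. by move=> oU; exact: (smoothC_conj oU). Qed.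

Let conj_pd (c : chart) W i f p : open W -> W `<=` cdom c -> csm c W f ->
  W p -> pdC c i (fun q => conjm (f q)) p = conjm (pdC c i f p).
Proof. by move=> oW Wc; exact: (pdC_conj oW Wc). Qed.

Let conjmK (a : C) : conjm (conjm a) = a.
Proof. exact: conjcK. Qed.

Lemma conj_seriesK F : conj_series (conj_series F) = F.
Proof. exact: (twist_seriesK conjmK). Qed.

Lemma smooth_conj_series F : smooth_series X setT F ->
  smooth_series X setT (conj_series F).
Proof. exact: (smooth_twist_series conj_smooth). Qed.

Lemma fstar_bar B F H r p : (forall r, bidifferential X (B r)) ->
  smooth_series X setT F -> smooth_series X setT H ->
  fstar (bar B) F H r p = conj_series (fstar B (conj_series H) (conj_series F)) r p.
Proof. exact: (fstar_twist conj_smooth). Qed.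

Lemma bar_wick B : wick_algebra X B -> wick_algebra X (bar B).
Proof.
move=> [aB hB hbB]; split.
- exact: (twist_assoc_product conjmK conj_smooth conj_pd aB).
- move=> U r f h p oU sf sh hh Up; rewrite /twist.
  have sf' := conj_smooth openT sf; have sh' := conj_smooth openT sh.
  rewrite (hbB U r _ _ p oU sh' sf' (antiholomorphic_conj oU hh) Up).
  by rewrite rmorph0 mulr0.
- move=> U r f h p oU sf sh hf Up; rewrite /twist.
  have sf' := conj_smooth openT sf; have sh' := conj_smooth openT sh.
  rewrite (hB U r _ _ p oU sh' sf' (holomorphic_conj oU hf) Up).
  by rewrite rmorph0 mulr0.
Qed.

(** Both sides of the Hermitian condition are coefficient series of the
    product and of its conjugate, up to the involution [C]. *)
Lemma hermitian_bar B : (forall r, bidifferential X (B r)) ->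
  hermitian_star X (fstar B) <->
  (forall r f h p, gl f -> gl h -> B r f h p = bar B r f h p).
Proof.
move=> bB; split=> [HB r f h p sf sh|E F H sF sH r p].
  have s0 : gl (fun=> 0) by exact: smoothC_cst.
  have sc g : gl g -> smooth_series X setT (fconst g).
    by move=> sg [|k]; [exact: sg | exact: s0].
  have bbB k : bidifferential X (bar B k) by exact: (twist_bidiff conjmK conj_smooth conj_pd).
  rewrite -(fstar_const2 r p bB sf sh) -(fstar_const2 r p bbB sf sh).
  rewrite (fstar_bar r p bB (sc _ sf) (sc _ sh)).
  have -> : fstar B (conj_series (fconst h)) (conj_series (fconst f)) =
            conj_series (fstar B (fconst f) (fconst h)).
    by apply/funext => k; apply/funext => q; exact: (esym (HB _ _ (sc _ sf) (sc _ sh) k q)).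
  by rewrite conj_seriesK.
have sF' := smooth_conj_series sF; have sH' := smooth_conj_series sH.
transitivity (fstar (bar B) (conj_series H) (conj_series F) r p).
  by rewrite (fstar_bar r p bB sH' sF') !conj_seriesK.
apply: eq_bigr => a _; apply: eq_bigr => b _.
exact: (esym (E a _ _ p (sH' b) (sF' _))).
Qed.

(** ** Cut-off coordinates and potentials *)

Section Chart.
Variables (c : chart) (W : set M) (chi : M -> R).
Hypothesis hc : holomorphic_chart X c.
Hypotheses (oW : open W) (Wc : W `<=` cdom c).
Hypothesis chi1 : forall q, W q -> chi q = 1.

Definition cutoff f : M -> C := fun q => (chi q)%:C%C * f q.

Hypothesis cut_smooth : forall f, smoothC X (cdom c) f -> gl (cutoff f).

Let Ac : atlas X c := hc.1.

Let cut_W f q : W q -> cutoff f q = f q.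
Proof. by move=> Wq; rewrite /cutoff chi1 // mul1r. Qed.

Let cal := chart_calculus Ac oW Wc.

Let z l := cutoff (zcoord c l).
Let zb l := cutoff (zbcoord c l).

Let z_gl l : gl (z l). Proof. exact: (cut_smooth (smoothC_zcoord l Ac)). Qed.
Let zb_gl l : gl (zb l). Proof. exact: (cut_smooth (smoothC_zbcoord l Ac)). Qed.

Let conj_z l : (fun q => conjc (z l q)) = zb l.
Proof. by apply/funext => q; rewrite /z /zb /cutoff rmorphM; congr (_ * _); exact: conjc_real. Qed.

Lemma chart_coordinates :
  coordinates W gl (fun i p => (cmap c p 0 i)%:C%C) ii z zb.
Proof.
split.
- exact: ii_sqr.
- exact: z_gl.
- exact: zb_gl.
- move=> l p Wp; rewrite /z cut_W //.
  by apply/eqP; rewrite eq_complex /=; apply/andP; split; apply/eqP; ring.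
- move=> l p Wp; rewrite /zb cut_W //.
  by apply/eqP; rewrite eq_complex /=; apply/andP; split; apply/eqP; ring.
Qed.

Let hol_z l : holomorphic X W (z l).
Proof.
apply: (@holomorphic_zcoord _ _ _ _ c W l _ hc oW Wc).
  exact: (smoothC_sub (@subsetT _ W) (z_gl l)).
by move=> p Wp; exact: cut_W.
Qed.

Let antihol_zb l : antiholomorphic X W (zb l).
Proof. by rewrite -conj_z; exact: (antiholomorphic_conj oW (hol_z l)). Qed.

Lemma chart_wick_product B : wick_algebra X B ->
  wick_product W gl (pdC c) z zb B.
Proof.
move=> [[bB aB B0 Bc] hB hbB]; split.
- by move=> r f g; exact: (bidiff_smooth (bB r)).
- move=> r a f g h p sf sg sh Wp.
  exact: (bidiff_linl (bB r) Ac oW Wc Wp a sf sg sh).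
- move=> r a f g h p sf sg sh Wp.
  exact: (bidiff_linr (bB r) Ac oW Wc Wp a sf sg sh).
- by move=> r g q sg Wq; exact: (bidiff_ordl (bB r) Ac Wc Wq sg).
- by move=> r g q sg Wq; exact: (bidiff_ordr (bB r) Ac Wc Wq sg).
- by move=> F G H sF sG sH r p _; exact: (aB F G H sF sG sH r p).
- by move=> f g p sf sg _; exact: B0.
- by move=> r a f p sf _; case: (Bc r a f sf p).
- by move=> r a f p sf _; case: (Bc r a f sf p).
- by move=> r l f p sf Wp; exact: (hB W r f _ p oW sf (z_gl l) (hol_z l) Wp).
- by move=> r l f p sf Wp; exact: (hbB W r _ f p oW (zb_gl l) sf (antihol_zb l) Wp).
Qed.

Definition cut_series (u : 'I_n -> fseries R M) k : fseries R M :=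
  fun r => cutoff (u k r).

Let cut_series_gl u k : smooth_series X (cdom c) (u k) ->
  smooth_series X setT (cut_series u k).
Proof. by move=> su r; exact: cut_smooth. Qed.

Let s0 : gl (fun=> 0). Proof. exact: smoothC_cst. Qed.

Let sconst U f : smoothC X U f -> smooth_series X U (fconst f).
Proof. by move=> sf [|k]; [exact: sf | exact: smoothC_cst]. Qed.

Let onW F : smooth_series X (cdom c) F -> smooth_series X W F.
Proof. by move=> sF r; exact: (smoothC_sub Wc (sF r)). Qed.

Let glW F : smooth_series X setT F -> smooth_series X W F.
Proof. by move=> sF r; exact: (smoothC_sub (@subsetT _ W) (sF r)). Qed.

Let const_cut f r p : W p -> fconst (cutoff f) r p = fconst f r p.
Proof. by case: r => [|r] //; exact: cut_W. Qed.

Lemma cut_u_rel B u : wick_algebra X B -> u_relation X (fstar B) c u ->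
  u_rel W z B (cut_series u).
Proof.
move=> wB [su ur] k l r p Wp; have bB := ap_bidiff (wa_product wB).
apply: (etrans _ (ur k l r p (Wc Wp))); congr (_ - _).
  apply: (fstar_local r bB Ac oW Wc _ _ _ _ _ _ Wp).
  - exact: (glW (cut_series_gl (su k))).
  - exact: (onW (su k)).
  - exact: (glW (sconst (z_gl l))).
  - exact: (onW (sconst (smoothC_zcoord l Ac))).
  - by move=> r' p' Wp'; exact: cut_W.
  - by move=> r' p' Wp'; exact: const_cut.
apply: (fstar_local r bB Ac oW Wc _ _ _ _ _ _ Wp).
- exact: (glW (sconst (z_gl l))).
- exact: (onW (sconst (smoothC_zcoord l Ac))).
- exact: (glW (cut_series_gl (su k))).
- exact: (onW (su k)).
- by move=> r' p' Wp'; exact: const_cut.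
- by move=> r' p' Wp'; exact: cut_W.
Qed.

Lemma cut_v_rel B v : wick_algebra X B -> v_relation X (fstar B) c v ->
  v_rel W zb B (cut_series v).
Proof.
move=> wB [sv vr] k l r p Wp; have bB := ap_bidiff (wa_product wB).
apply: (etrans _ (vr k l r p (Wc Wp))); congr (_ - _).
  apply: (fstar_local r bB Ac oW Wc _ _ _ _ _ _ Wp).
  - exact: (glW (cut_series_gl (sv l))).
  - exact: (onW (sv l)).
  - exact: (glW (sconst (zb_gl k))).
  - exact: (onW (sconst (smoothC_zbcoord k Ac))).
  - by move=> r' p' Wp'; exact: cut_W.
  - by move=> r' p' Wp'; exact: const_cut.
apply: (fstar_local r bB Ac oW Wc _ _ _ _ _ _ Wp).
- exact: (glW (sconst (zb_gl k))).
- exact: (onW (sconst (smoothC_zbcoord k Ac))).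
- exact: (glW (cut_series_gl (sv l))).
- exact: (onW (sv l)).
- by move=> r' p' Wp'; exact: const_cut.
- by move=> r' p' Wp'; exact: cut_W.
Qed.

(** Conjugation turns the potentials [v] into potentials [- C v] of the
    conjugate product. *)
Definition conj_potential (v : 'I_n -> fseries R M) k : fseries R M :=
  fun r p => - conj_series (cut_series v k) r p.

Let conj_potential_gl v k : smooth_series X (cdom c) (v k) ->
  smooth_series X setT (conj_potential v k).
Proof.
move=> sv r; have := smooth_conj_series (cut_series_gl sv) r.
move=> /(smoothC_scale openT (-1)).
congr (smoothC X setT _); apply/funext => p; rewrite mulN1r.
by [].
Qed.

Lemma bar_u_rel B v : wick_algebra X B -> v_relation X (fstar B) c v ->
  u_rel W z (bar B) (conj_potential v).
Proof.
move=> wB vr k l r p Wp; have bB := ap_bidiff (wa_product wB).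
have sv := vr.1 k; have sv' := cut_series_gl sv.
have sp := conj_potential_gl sv.
have szb := sconst (zb_gl l); have sz := sconst (z_gl l).
have Ez : conj_series (fconst (z l)) = fconst (zb l).
  apply/funext => r'; apply/funext => p'; rewrite /conj_series -conj_z.
  case: r' => [|r']; first by rewrite expr0 mul1r.
  by rewrite -[LHS]/((-1) ^+ r'.+1 * conjc (0 : C)) conjc0 mulr0.
have Ep : conj_series (conj_potential v k) = (fun r p => - cut_series v k r p).
  apply/funext => r'; apply/funext => p'.
  rewrite -[in RHS](conj_seriesK (cut_series v k)) {1 3}/conj_series.
  by rewrite /conj_potential rmorphN mulrN.
have E1 : pstar (bar B) (conj_potential v k) (pconst (z l)) r p =
    conj_series (fun r p => - fstar B (fconst (zb l)) (cut_series v k) r p) r p.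
  transitivity (conj_series (fstar B (conj_series (fconst (z l)))
      (conj_series (conj_potential v k))) r p).
    exact: (fstar_bar r p bB sp sz).
  rewrite Ez Ep /conj_series; congr (_ * conjc _).
  exact: (fstar_oppr r p bB szb sv').
have E2 : pstar (bar B) (pconst (z l)) (conj_potential v k) r p =
    conj_series (fun r p => - fstar B (cut_series v k) (fconst (zb l)) r p) r p.
  transitivity (conj_series (fstar B (conj_series (conj_potential v k))
      (conj_series (fconst (z l)))) r p).
    exact: (fstar_bar r p bB sz sp).
  rewrite Ez Ep /conj_series; congr (_ * conjc _).
  exact: (fstar_oppl r p bB sv' szb).
rewrite E1 E2 /conj_series -mulrBr -rmorphB opprK addrC.
have := cut_v_rel wB vr l k r Wp.
rewrite -[pstar B _ _ r p]/(fstar B _ _ r p) -[pstar B (pconst _) _ r p]/(fstar B _ _ r p).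
move=> ->; rewrite /pnu (eq_sym l k); case: eqP => [->|_]; last by rewrite rmorph0 mulr0.
by rewrite expr1 mulN1r rmorph_nat.
Qed.

End Chart.

End LocalStar.

(** * Hermitian star products and real characterizing forms *)

Section Main.
Variables (R : realType) (M : topologicalType) (n : nat).
Variable X : pseudo_kahler R M n.
Local Notation C := R[i].
Local Notation ii := (Complex 0 1 : C).
Local Notation chart := (chart R M (n + n)).
Local Notation gl := (smoothC X setT).
Implicit Type B : nat -> (M -> C) -> (M -> C) -> M -> C.
Local Notation bar := (twist (@conjc R : {rmorphism R[i] -> R[i]})).

Section Wirtinger.
Variables (c : chart) (W : set M).
Hypotheses (oW : open W) (Wc : W `<=` cdom c).
Implicit Types f g : M -> C.

Lemma Zbder_eq l f g p : (forall p, W p -> f p = g p) -> W p ->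
  Zbder c l f p = Zbder c l g p.
Proof.
move=> fg Wp; rewrite /Zbder (pdC_eq oW Wc (lshift n l) fg Wp).
by rewrite (pdC_eq oW Wc (rshift n l) fg Wp).
Qed.

Lemma Zbder_opp l f p : csm c W f -> W p ->
  Zbder c l (fun q => - f q) p = - Zbder c l f p.
Proof.
move=> cf Wp; rewrite /Zbder (pdC_opp oW Wc (lshift n l) cf Wp).
by rewrite (pdC_opp oW Wc (rshift n l) cf Wp) mulrN -opprD mulrN.
Qed.

Lemma Zbder_scale l (a : C) f p : csm c W f -> W p ->
  Zbder c l (fun q => a * f q) p = a * Zbder c l f p.
Proof.
move=> cf Wp; rewrite /Zbder (pdC_scale oW Wc (lshift n l) a cf Wp).
by rewrite (pdC_scale oW Wc (rshift n l) a cf Wp); ring.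
Qed.

Lemma Zbder_conj l f p : csm c W f -> W p ->
  Zbder c l (fun q => conjc (f q)) p = conjc (Zder c l f p).
Proof.
move=> cf Wp; rewrite /Zbder /Zder (pdC_conj oW Wc (lshift n l) cf Wp).
rewrite (pdC_conj oW Wc (rshift n l) cf Wp).
have conj_half : conjc (2^-1 : C) = 2^-1 by rewrite fmorphV rmorph_nat.
rewrite [RHS]rmorphM rmorphB rmorphM; congr (_ * (_ + _)); first exact: esym conj_half.
by rewrite -mulNr; congr (_ * _); rewrite -[LHS]opprK; congr (- _); exact: esym (conjc_ii R).
Qed.

End Wirtinger.

Lemma map_conjc_real p q (Y : 'M[R]_(p, q)) :
  map_mx conjc (map_mx (real_complex R) Y) = map_mx (real_complex R) Y.
Proof. by apply/matrixP => i j; rewrite !mxE; exact: conjc_real. Qed.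

(** The Jacobian matrices are real, so reality may be checked in one chart. *)
Lemma conj_form_covariant (c c' : chart) (K : form_series R M n) r p :
  two_form X (K r) -> atlas X c -> atlas X c' -> cdom c p -> cdom c' p ->
  conj_form K r c p = K r c p -> conj_form K r c' p = K r c' p.
Proof.
move=> [[_ covK] _] Ac Ac' cp cp' Kr.
rewrite /conj_form (covK c' c p Ac' Ac cp' cp) /=.
move: (map_conjc_real (Defs.jacobian c' c p)).
move: (map_mx (real_complex R) _) => J Jr.
rewrite !map_mxM -map_trmx Jr scalemxAl scalemxAr.
by congr (_ *m _ *m _); exact: Kr.
Qed.

Section AroundPoint.
Variables (B : nat -> (M -> C) -> (M -> C) -> M -> C) (K : form_series R M n).
Hypothesis wB : wick_algebra X B.
Variables (c : chart) (u v : 'I_n -> fseries R M) (W : set M) (chi : M -> R).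
Hypothesis hc : holomorphic_chart X c.
Hypotheses (ur : u_relation X (fstar B) c u) (vr : v_relation X (fstar B) c v).
Hypothesis Kuv : forall r p, cdom c p ->
  K r c p = dbar10 c (fun k q => - u k r q) p /\
  K r c p = del01 c (fun l => v l r) p.
Hypotheses (oW : open W) (Wc : W `<=` cdom c).
Hypothesis chi1 : forall q, W q -> chi q = 1.
Hypothesis cut_smooth : forall f, smoothC X (cdom c) f -> gl (cutoff chi f).

Let Ac : atlas X c := hc.1.
Let cal := chart_calculus Ac oW Wc.
Let coo := chart_coordinates hc chi1 cut_smooth.
Let wpB := chart_wick_product hc oW Wc chi1 cut_smooth wB.
Let wpB' := chart_wick_product hc oW Wc chi1 cut_smooth (bar_wick wB).
Let u1 := cut_series chi u.
Let u2 := conj_potential chi v.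
Let v1 := cut_series chi v.
Let rel1 := cut_u_rel hc oW Wc chi1 cut_smooth wB ur.
Let relv := cut_v_rel hc oW Wc chi1 cut_smooth wB vr.
Let rel2 := bar_u_rel hc oW Wc chi1 cut_smooth wB vr.

Let gu1 k r : gl (u1 k r). Proof. exact: cut_smooth (ur.1 k r). Qed.
Let gv1 k r : gl (v1 k r). Proof. exact: cut_smooth (vr.1 k r). Qed.
Let gu2 k r : gl (u2 k r).
Proof.
have := smooth_conj_series (gv1 k) r; move=> /(smoothC_scale openT (-1)).
by congr (smoothC X setT _); apply/funext => p; rewrite mulN1r.
Qed.

Let csW f : smoothC X (cdom c) f -> csm c W f.
Proof. by move=> sf; exact: (smoothC_on Ac Wc (smoothC_sub Wc sf)). Qed.

Let cutW f q : W q -> cutoff chi f q = f q.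
Proof. by move=> Wq; rewrite /cutoff chi1 // mul1r. Qed.

Let Zb_u1 k l r p : W p ->
  wirt (pdC c) ii l (u1 k r) p = - Zbder c l (fun q => - u k r q) p.
Proof.
move=> Wp; rewrite (Zbder_opp oW Wc l (csW (ur.1 k r)) Wp) opprK.
apply: (Zbder_eq oW Wc l _ Wp) => q Wq; exact: cutW.
Qed.

Let Zb_u2 k l r p : W p ->
  wirt (pdC c) ii l (u2 k r) p = - ((-1) ^+ r * conjc (Zder c l (v k r) p)).
Proof.
move=> Wp; have cv := csW (vr.1 k r); have ccv := csm_conj oW Wc cv.
rewrite -(Zbder_conj oW Wc l cv Wp) -(Zbder_scale oW Wc l _ ccv Wp).
rewrite -(Zbder_opp oW Wc l (csm_scale oW Wc _ ccv) Wp).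
apply: (Zbder_eq oW Wc l _ Wp) => q Wq.
by rewrite /u2 /conj_potential /conj_series /cut_series cutW.
Qed.

(** In the chart, the reality of [K] says that [u1] and [u2] have the same
    antiholomorphic derivatives. *)
Let real_iff p r : W p -> conj_form K r c p = K r c p <->
  (forall k l, wirt (pdC c) ii l (u1 k r) p = wirt (pdC c) ii l (u2 k r) p).
Proof.
move=> Wp; have [Ku Kv] := Kuv r (Wc Wp).
have H := real_dbar10_coef r Ku Kv.
split=> [/(H.1) E k l|E]; first by rewrite Zb_u1 // Zb_u2 // E.
by apply: H.2 => k l; apply: oppr_inj; rewrite -Zb_u1 // -Zb_u2.
Qed.

(** The matrix of antiholomorphic derivatives of the leading terms of [u2] is
    the coefficient matrix of [omega], up to the sign. *)
Lemma real_bar_eq : (forall p, cdom c p -> K 0%N c p = pk_omega X c p) ->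
  (forall r p, W p -> conj_form K r c p = K r c p) ->
  forall r f h p, gl f -> gl h -> W p -> B r f h p = bar B r f h p.
Proof.
move=> Kom Kr r f h p sf sh Wp.
have u12 k l r' p' : W p' ->
    wirt (pdC c) ii l (u1 k r') p' = wirt (pdC c) ii l (u2 k r') p'.
  by move=> Wp'; exact: ((real_iff r' Wp').1 (Kr r' p' Wp')).
apply: (wick_product_unique cal coo wpB wpB' gu1 gu2 rel1 rel2 u12 _ r sf sh Wp).
move=> q Wq.
have uK : dbar10 c (fun k q => - u k 0%N q) q \in unitmx.
  have [<- _] := Kuv 0 (Wc Wq).
  by rewrite Kom; [exact: (omega_unit Ac (Wc Wq)) | exact: Wc].
have := dbar10_unit uK.
have -> : \matrix_(k < n, l < n) wirt (pdC c) ii l (u2 k 0%N) q =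
    (-1) *: \matrix_(k < n, l < n) Zbder c l (fun q => - u k 0%N q) q.
  by apply/matrixP => k l; rewrite !mxE -u12 // Zb_u1 // mulN1r.
by move=> uG; rewrite unitmxZ // unitrN1.
Qed.

Lemma bar_eq_real : (forall r f h p, gl f -> gl h -> B r f h p = bar B r f h p) ->
  forall r p, W p -> conj_form K r c p = K r c p.
Proof.
move=> BB r p Wp; apply: (real_iff r Wp).2 => k l.
have rel2' : u_rel W (fun l => cutoff chi (zcoord c l)) B u2.
  move=> k' l' r' p' Wp'; have := rel2 k' l' r' Wp'.
  have s0 : gl (fun=> 0) by exact: smoothC_cst.
  have gz : gl (cutoff chi (zcoord c l')) by exact: cut_smooth (smoothC_zcoord l' Ac).
  have gc r1 : gl (pconst (cutoff chi (zcoord c l')) r1).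
    by case: r1 => [|r1]; [exact: gz | exact: s0].
  have E F H : (forall r, gl (F r)) -> (forall r, gl (H r)) ->
      pstar (bar B) F H r' p' = pstar B F H r' p'.
    move=> gF gH; apply: eq_bigr => a _; apply: eq_bigr => b _.
    exact: (esym (BB a _ _ p' (gF b) (gH _))).
  by rewrite (E _ _ (gu2 k') gc) (E _ _ gc (gu2 k')).
exact: (potential_unique cal coo r wpB (gu1 k) (gu2 k) (gv1 l) rel1 rel2' relv Wp).
Qed.

End AroundPoint.

Lemma wick_hermitian_iff_real B (K : form_series R M n) : wick_algebra X B ->
  characterizing_form X (fstar B) K ->
  hermitian_star X (fstar B) <-> real_form X K.
Proof.
move=> wB [[K2 [K0 _]] Kloc]; have bB := ap_bidiff (wa_product wB).
rewrite (hermitian_bar bB); split=> [BB r c' p Ac' cp'|Kr r f h p sf sh].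
- have [c [u [v [hc cp _ [ur vr] Kuv]]]] := Kloc p.
  have [W [chi [oW Wp Wc chi1 cs]]] := exists_cutoff (pk_hausdorff X) hc.1 cp.
  apply: (conj_form_covariant (K2 r) hc.1 Ac' cp cp').
  exact: (bar_eq_real wB hc ur vr Kuv oW Wc chi1 cs BB r Wp).
- have [c [u [v [hc cp _ [ur vr] Kuv]]]] := Kloc p.
  have [W [chi [oW Wp Wc chi1 cs]]] := exists_cutoff (pk_hausdorff X) hc.1 cp.
  apply: (real_bar_eq wB hc ur vr Kuv oW Wc chi1 cs _ _ r sf sh Wp).
    by move=> q cq; exact: (K0 c q hc.1 cq).
  by move=> r' q Wq; exact: (Kr r' c q hc.1 (Wc _ Wq)).
Qed.

(** ** Star products of anti-Wick type *)

Local Notation idm := (idfun : {rmorphism R[i] -> R[i]}).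
Local Notation par := (twist idm).

Let id_smooth (U : set M) f : open U -> smoothC X U f ->
  smoothC X U (fun p => idm (f p)).
Proof. by []. Qed.

Let id_pd (c : chart) (W : set M) i (f : M -> C) p : open W -> W `<=` cdom c ->
  csm c W f -> W p -> pdC c i (fun q => idm (f q)) p = idm (pdC c i f p).
Proof. by []. Qed.

Let idK (a : C) : idm (idm a) = a. Proof. by []. Qed.

Lemma par_wick B : star_product X B -> anti_wick_type X (fstar B) ->
  wick_algebra X (par B).
Proof.
move=> sB wB; have aB := star_product_assoc sB; have bB := ap_bidiff aB.
have s0 : gl (fun=> 0) by exact: smoothC_cst.
split; first exact: (twist_assoc_product idK id_smooth id_pd aB).
- move=> U r f h p oU sf sh hh Up; rewrite /twist.
  have [+ _] := wB U oU f f h _ sf sf sh s0 hh (antiholomorphic_cst X U 0) r.+1 p Up.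
  by rewrite (fstar_const2 _ _ bB) // => ->; rewrite rmorph0 mulr0.
- move=> U r f h p oU sf sh hf Up; rewrite /twist.
  have [_ +] := wB U oU h h _ f sh sh s0 sf (holomorphic_cst X U 0) hf r.+1 p Up.
  by rewrite (fstar_const2 _ _ bB) // => ->; rewrite rmorph0 mulr0.
Qed.

(** The relations for the potentials involve functions defined on the chart
    only, where the reversed product is still given by the local formula. *)
Lemma characterizing_par B (K : form_series R M n) :
  (forall r, bidifferential X (B r)) ->
  anti_characterizing_form X (fstar B) K ->
  characterizing_form X (fstar (par B)) (par_form K).
Proof.
move=> bB [hK Kloc]; split; first exact: hK.
move=> p0; have [c [u [v [hc cp Vc [[su ur] [sv vr]] Kuv]]]] := Kloc p0.
exists c, u, v; split; [exact: hc | exact: cp | exact: Vc | | exact: Kuv].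
have sc U f : smoothC X U f -> smooth_series X U (fconst f).
  by move=> sf [|k]; [exact: sf | exact: smoothC_cst].
have E F H r p : smooth_series X (cdom c) F -> smooth_series X (cdom c) H ->
    cdom c p -> fstar (par B) F H r p = par_opp (fstar B) F H r p.
  move=> sF sH cp'.
  exact: (fstar_twist_on id_smooth r bB hc.1 (cdom_open c) (@subset_refl _ _) cp' sF sH).
have sz l := sc _ _ (smoothC_zcoord l hc.1).
have szb l := sc _ _ (smoothC_zbcoord l hc.1).
split; split; [exact: su | | exact: sv |] => k l r p cp'.
  by rewrite (E _ _ r p (su k) (sz l) cp') (E _ _ r p (sz l) (su k) cp'); exact: ur.
by rewrite (E _ _ r p (sv l) (szb k) cp') (E _ _ r p (szb k) (sv l) cp'); exact: vr.
Qed.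

Lemma real_par (K : form_series R M n) : real_form X (par_form K) <-> real_form X K.
Proof.
have E r c p : conj_form (par_form K) r c p = (-1) ^+ r *: conj_form K r c p.
  by rewrite /conj_form /par_form map_mxZ; congr (_ *: (_ *: _)); exact: rmorph_sign.
split=> H r c p Ac cp; last by rewrite E /par_form (H r c p Ac cp).
have s0 : (-1) ^+ r != 0 :> C by rewrite signr_eq0.
by apply: (scalerI s0); rewrite -E; exact: (H r c p Ac cp).
Qed.

Lemma hermitian_par B : (forall r, bidifferential X (B r)) ->
  hermitian_star X (fstar (par B)) <-> hermitian_star X (fstar B).
Proof.
move=> bB.
have bP r : bidifferential X (par B r) by exact: (twist_bidiff idK id_smooth id_pd).
have E r f h p : bar (par B) r f h p = (-1) ^+ r * bar B r h f p.
  rewrite /twist; congr (_ * _); rewrite [LHS]rmorphM; congr (_ * _).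
  exact: rmorph_sign.
rewrite (hermitian_bar bP) (hermitian_bar bB); split=> H r f h p sf sh.
  have := H r h f p sh sf; rewrite E => /(congr1 (fun a => (-1) ^+ r * a)).
  by rewrite /par_form {1}/twist !mulrA -expr2 sqrr_sign !mul1r.
by rewrite E -H // /twist.
Qed.

Lemma anti_wick_hermitian_iff_real B (K : form_series R M n) :
  star_product X B -> anti_wick_type X (fstar B) ->
  anti_characterizing_form X (fstar B) K ->
  hermitian_star X (fstar B) <-> real_form X K.
Proof.
move=> sB aB hK; have bB := ap_bidiff (star_product_assoc sB).
rewrite -(hermitian_par bB) -real_par.
exact: (wick_hermitian_iff_real (par_wick sB aB) (characterizing_par bB hK)).
Qed.

End Main.

Theorem proposition6p10 (R : realType) (M : topologicalType) (n : nat)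
  (X : pseudo_kahler R M n)
  (B : nat -> (M -> R[i]) -> (M -> R[i]) -> M -> R[i])
  (star_B : star_product X B) :
  (wick_type X (fstar B) ->
     forall K : form_series R M n, characterizing_form X (fstar B) K ->
       (hermitian_star X (fstar B) <-> real_form X K)) /\
  (anti_wick_type X (fstar B) ->
     forall K : form_series R M n, anti_characterizing_form X (fstar B) K ->
       (hermitian_star X (fstar B) <-> real_form X K)).
Proof.
split=> wB K hK.
- exact: (wick_hermitian_iff_real (star_product_wick star_B wB) hK).
- exact: (anti_wick_hermitian_iff_real star_B wB hK).
Qed.
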